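(* Let $n\ge1$ and let $(A,u)$ be an easy quantum group (in its maximal version) with fundamental corepresentation of size $n\times n$, associated with the category of partitions $\mathcal{C}$. Assume that the partition $\pi_0\in P(3,3)$ with blocks $\{1,2,2',3'\}$ and $\{3,1'\}$ (upper points $1,2,3$, lower points $1',2',3'$, numbered from left to right) lies in $\mathcal{C}$. Then $A\cong C^*(\Gamma)\bowtie C(S_n)$ for some strongly symmetric reflection group $\Gamma$ on $n$ generators. Denoting the generators of $\Gamma$ by $g_1,\dots,g_n$ and the fundamental corepresentation of $C(S_n)$ by $(p_{ij})$, the fundamental corepresentation of $A$ is identified with $(u_{g_i}p_{ij})$ under this isomorphism. Moreover, every strongly symmetric reflection group on $n$ generators arises this way.
   Context: A compact matrix quantum group (CMQG) of size $n$ is a pair $(A,u)$ of a unital $C^*$-algebra $A$ and a unitary $u=(u_{ij})\in M_n(A)$ such that the $u_{ij}$ generate $A$, there is a $*$-homomorphism $\Delta:A\to A\otimes A$ with $\Delta(u_{ij})=\sum_k u_{ik}\otimes u_{kj}$, and $u^t$ is invertible. It is orthogonal if $u_{ij}^*=u_{ij}$ for all $i,j$. It is in its maximal version if $A$ is the universal enveloping $C^*$-algebra of the $*$-algebra generated by the $u_{ij}$. An isomorphism of CMQGs is a $*$-isomorphism mapping fundamental corepresentation to fundamental corepresentation entrywise. Partitions: $P(k,l)$ is the set of set partitions (into blocks) of $k$ upper and $l$ lower points, each row ordered from left to right. Operations: tensor product $p\otimes q$ (juxtaposition); composition $qp\in P(k,m)$ for $p\in P(k,l)$, $q\in P(l,m)$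 (put $p$ above $q$, join along the $l$ middle points, delete the middle points and any blocks contained in them); involution $p^*\in P(l,k)$ (turn upside down); rotation (moving the leftmost, or rightmost, point of one row to the leftmost, resp. rightmost, position of the other row, keeping blocks). A category of partitions $\mathcal{C}$ is a collection of subsets $\mathcal{C}(k,l)\subset P(k,l)$, $k,l\ge0$, closed under these operations and containing the one-block pair partition on two points. For $p\in P(k,l)$ and multi-indices $i\in\{1,\dots,n\}^k$, $j\in\{1,\dots,n\}^l$ put $\delta_p(i,j)=1$ if labelling the points of $p$ by $i$ (upper row) and $j$ (lower row) gives equal labels on each block, and $0$ otherwise; $T_p:(\mathbb{C}^n)^{\otimes k}\to(\mathbb{C}^n)^{\otimes l}$ is $T_p(e_{i_1}\otimes\cdots\otimes e_{i_k})=\sum_j\delta_p(i,j)\,e_{j_1}\otimes\cdots\otimes e_{j_l}$. An orthogonal CMQG $(A,u)$ is easy, associated with the category $\mathcal{C}$, if for all $k,l$ the space of intertwiners $\{T: Tu^{\otimes k}=u^{\otimes l}T\}$ equals $\mathrm{span}\{T_p: p\in\mathcal{C}(k,l)\}$. $\mathbb{Z}_2^{*n}$ is the free product of $n$ copies of $\mathbb{Z}/2\mathbb{Z}$ with canonical generators $a_1,\dots,a_n$. For any map $\phi:\{1,\dots,n\}\to\{1,\dots,n\}$ let $\sigma_\phi$ be the endomorphism $a_k\mapsto a_{\phi(k)}$ of $\mathbb{Z}_2^{*n}$. A strongly symmetric reflection group on $n$ generators is a quotient $\Gamma$ of $\mathbb{Z}_2^{*n}$ by a normal subgroup $N$ with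 $\sigma_\phi(N)\subset N$ for all maps $\phi$, together with its generators $g_i=$ image of $a_i$. $C(S_n)$ has fundamental corepresentation $p_{ij}(\sigma)=1$ if $\sigma(j)=i$, $0$ otherwise. $C^*(\Gamma)\bowtie C(S_n)$ denotes the CMQG with $C^*$-algebra $C^*(\Gamma)\otimes C(S_n)$ (maximal group $C^*$-algebra with canonical unitaries $u_g$) and fundamental corepresentation $(u_{g_i}p_{ij})$. *)

(* Defs.v *)
From HB Require Import structures.
From mathcomp Require Import all_boot all_order all_algebra all_fingroup.
From mathcomp Require Import sesquilinear.
From mathcomp Require Import all_classical all_reals.
From mathcomp Require Import topology normedtype sequences.
From mathcomp.real_closed Require Import complex.

Set Implicit Arguments.
Unset Strict Implicit.
Unset Printing Implicit Defensive.

Import Order.TTheory GRing.Theory Num.Theory.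
Import numFieldNormedType.Exports.
Import ComplexField.Normc.

Local Open Scope classical_set_scope.
Local Open Scope ring_scope.

(** * Unital C*-algebras *)

(* MathComp's structures combining a norm with a multiplication are all numeric
   domains, so the (real-valued) norm and its completeness are part of the
   mixin.  As an [algType] has [1 != 0], the zero algebra is excluded. *)
HB.mixin Record isCStar (R : realType) A & GRing.Algebra R[i] A := {
  star : A -> A;
  starK : involutive star;
  starD : {morph star : x y / x + y};
  starZ : forall (c : R[i]) (x : A), star (c *: x) = c^* *: star x;
  starM : forall x y : A, star (x * y) = star y * star x;
  cnorm : A -> R;
  cnorm0_eq0 : forall x : A, cnorm x = 0 -> x = 0;
  ler_cnormD : forall x y : A, cnorm (x + y) <= cnorm x + cnorm y;
  cnormZ : forall (c : R[i]) (x : A), cnorm (c *: x) = normc c * cnorm x;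
  ler_cnormM : forall x y : A, cnorm (x * y) <= cnorm x * cnorm y;
  cnorm_star : forall x : A, cnorm (star x * x) = cnorm x ^+ 2;
  cnorm_complete : forall x : nat -> A,
    (forall e : R, 0 < e -> \forall m & m' \near \oo, cnorm (x m - x m') < e) ->
    exists l : A, cnorm (x m - l) @[m --> \oo] --> (0 : R)
}.

#[short(type="cstarAlgType")]
HB.structure Definition CStarAlgebra (R : realType) :=
  {A of isCStar R A & GRing.Algebra R[i] A}.

Definition star_hom (R : realType) (A B : cstarAlgType R)
    (f : {lrmorphism A -> B}) : Prop := {morph f : x / star x}.

Section Generation.
Context {R : realType} {A : cstarAlgType R}.
Implicit Types S G : set A.

Definition star_subalg S : Prop :=
  [/\ S 1, (forall (c : R[i]) x y, S x -> S y -> S (c *: x + y)),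
      (forall x y, S x -> S y -> S (x * y)) & (forall x, S x -> S (star x))].

Definition star_alg_gen G : set A := smallest star_subalg G.

Definition cstar_dense S : Prop :=
  forall (x : A) (e : R), 0 < e -> exists2 y, S y & cnorm (x - y) < e.

Definition cstar_generates G : Prop := cstar_dense (star_alg_gen G).

(* Only the values of [f] on the *-subalgebra [S] matter. *)
Definition star_hom_on (B : cstarAlgType R) S (f : A -> B) : Prop :=
  [/\ f 1 = 1,
      (forall (c : R[i]) x y, S x -> S y -> f (c *: x + y) = c *: f x + f y),
      (forall x y, S x -> S y -> f (x * y) = f x * f y) &
      (forall x, S x -> f (star x) = star (f x))].

End Generation.

(** * Spatial (minimal) tensor products *)

(* A Hilbert space is a pair (H, ip) satisfying [hilbert ip]; [ip] is linear in
   its first argument. *)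
Definition hilbert (R : realType) (H : completeNormedModType R[i])
    (ip : {dot H for (@Num.conj R[i])}) : Prop :=
  forall x : H, `|x| ^+ 2 = ip x x.

Definition star_rep (R : realType) (A : cstarAlgType R)
    (H : completeNormedModType R[i]) (ip : {dot H for (@Num.conj R[i])})
    (pi : A -> {linear H -> H}) : Prop :=
  [/\ (forall x, pi 1 x = x),
      (forall (c : R[i]) a b x, pi (c *: a + b) x = c *: pi a x + pi b x),
      (forall a b x, pi (a * b) x = pi a (pi b x)) &
      (forall a x y, ip (pi a x) y = ip x (pi (star a) y))].

(* The squared norm in the Hilbert space tensor product of H and K of the sum
   of the elementary tensors listed in [s]. *)
Definition tensor_sqnorm (R : realType) (H K : completeNormedModType R[i])
    (ipH : {dot H for (@Num.conj R[i])}) (ipK : {dot K for (@Num.conj R[i])})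
    (s : seq (H * K)) : R[i] :=
  \sum_(x <- s) \sum_(y <- s) ipH x.1 y.1 * ipK x.2 y.2.

(* [spatial_norm_le t c]: the element sum_(a <- t) a.1 (x) a.2 of the algebraic
   tensor product has spatial norm at most [c], i.e. the operator
   sum_(a <- t) pi a.1 (x) rho a.2 on H (x) K has norm at most [c] for all
   representations pi, rho on Hilbert spaces H, K; it is enough to test this
   on the dense algebraic tensor product of H and K. *)
Definition spatial_norm_le (R : realType) (A B : cstarAlgType R)
    (t : seq (A * B)) (c : R) : Prop :=
  forall (H K : completeNormedModType R[i])
    (ipH : {dot H for (@Num.conj R[i])}) (ipK : {dot K for (@Num.conj R[i])})
    (pi : A -> {linear H -> H}) (rho : B -> {linear K -> K}),
  hilbert ipH -> hilbert ipK -> star_rep ipH pi -> star_rep ipK rho ->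
  forall s : seq (H * K),
    tensor_sqnorm ipH ipK [seq (pi a.1 x.1, rho a.2 x.2) | a <- t, x <- s]
      <= (c ^+ 2)%:C%C * tensor_sqnorm ipH ipK s.

(* T is the completion of the algebraic tensor product of A and B in the
   spatial norm; [i1 a * i2 b] is the elementary tensor of a and b. *)
Definition is_tensor (R : realType) (A B T : cstarAlgType R)
    (i1 : {lrmorphism A -> T}) (i2 : {lrmorphism B -> T}) : Prop :=
  [/\ star_hom i1 /\ star_hom i2,
      (forall a b, i1 a * i2 b = i2 b * i1 a),
      cstar_dense [set x | exists t : seq (A * B),
                     x = \sum_(a <- t) i1 a.1 * i2 a.2] &
      forall (t : seq (A * B)) (c : R), 0 <= c ->
        (cnorm (\sum_(a <- t) i1 a.1 * i2 a.2) <= c <-> spatial_norm_le t c)].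

(** * Compact matrix quantum groups *)

Section CMQG.
Context {R : realType} {n : nat} {A : cstarAlgType R}.
Implicit Types u : 'M[A]_n.

Definition adjmx u : 'M[A]_n := map_mx star u^T.

Definition entries u : set A := [set x | exists i j, x = u i j].

Definition is_cmqg u : Prop :=
  [/\ (u *m adjmx u = 1%:M /\ adjmx u *m u = 1%:M),
      cstar_generates (entries u),
      (exists (T : cstarAlgType R) (i1 i2 Delta : {lrmorphism A -> T}),
        [/\ is_tensor i1 i2, star_hom Delta &
            forall i j, Delta (u i j) = \sum_k i1 (u i k) * i2 (u k j)]) &
      exists v : 'M[A]_n, u^T *m v = 1%:M /\ v *m u^T = 1%:M].

Definition orthogonal_cmqg u : Prop :=
  is_cmqg u /\ forall i j, star (u i j) = u i j.

Definition maximal_version u : Prop :=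
  forall (D : cstarAlgType R) (f : A -> D),
    star_hom_on (star_alg_gen (entries u)) f ->
    exists F : {lrmorphism A -> D},
      star_hom F /\ forall x, star_alg_gen (entries u) x -> F x = f x.

End CMQG.

(** * Categories of partitions *)

(* P(k,l): [inl] are the upper points, [inr] the lower ones.  Being a partition
   is imposed in [partition_category]. *)
Definition part k l := {set {set ('I_k + 'I_l)%type}}.

Definition relabel (X Y : finType) (f : X -> Y) (p : {set {set X}}) :
  {set {set Y}} := [set f @: B | B : {set X} in p]%SET.

Definition sum_swap (X Y : Type) (x : X + Y) : Y + X :=
  match x with inl i => inr i | inr j => inl j end.

Definition part_tensor k l k' l' (p : part k l) (q : part k' l') :
    part (k + k') (l + l') :=
  (relabel (fun x => match x with
                     | inl i => inl (lshift k' i) | inr j => inr (lshift l' j)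
                     end) p
   :|: relabel (fun x => match x with
                     | inl i => inl (rshift k i) | inr j => inr (rshift l j)
                     end) q)%SET.

(* On the three rows of the diagram of p placed above q: two points in the same
   block of p or in the same block of q. *)
Definition glue k l m (p : part k l) (q : part l m) :
    rel ('I_k + 'I_l + 'I_m)%type :=
  let dn := fun x : 'I_l + 'I_m =>
    match x with inl j => inl (inr j) | inr h => inr h end in
  fun x y =>
    [exists B in relabel inl p, (x \in B) && (y \in B)] ||
    [exists B in relabel dn q, (x \in B) && (y \in B)].

Definition part_comp k l m (q : part l m) (p : part k l) : part k m :=
  let out := fun x : 'I_k + 'I_m =>
    match x with inl i => inl (inl i) | inr h => inr h end in
  equivalence_partition
    (fun x y => connect (glue p q) (out x) (out y)) [set: 'I_k + 'I_m]%SET.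

Definition part_inv k l (p : part k l) : part l k := relabel (@sum_swap _ _) p.

(* Moves the upper point [e k] to the position [e l] of the lower row; the
   leftmost points are [@ord0], the rightmost ones [@ord_max]. *)
Definition rot_point (e : forall m, 'I_m.+1) k l (x : 'I_k.+1 + 'I_l) :
    'I_k + 'I_l.+1 :=
  match x with
  | inl i => if unlift (e k) i is Some i' then inl i' else inr (e l)
  | inr j => inr (lift (e l) j)
  end.

Definition part_rot_down e k l (p : part k.+1 l) : part k l.+1 :=
  relabel (@rot_point e k l) p.

Definition part_rot_up e k l (p : part k l.+1) : part k.+1 l :=
  part_inv (part_rot_down e (part_inv p)).

Record partition_category (C : forall k l, {set part k l}) : Prop := {
  pcat_partition : forall k l p, p \in C k l -> finset.partition p [set: _]%SET;
  pcat_tensor : forall k l k' l' p q,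
    p \in C k l -> q \in C k' l' -> part_tensor p q \in C (k + k')%N (l + l')%N;
  pcat_comp : forall k l m p q,
    p \in C k l -> q \in C l m -> part_comp q p \in C k m;
  pcat_inv : forall k l p, p \in C k l -> part_inv p \in C l k;
  pcat_rot_down_left : forall k l p,
    p \in C k.+1 l -> part_rot_down (@ord0) p \in C k l.+1;
  pcat_rot_down_right : forall k l p,
    p \in C k.+1 l -> part_rot_down (@ord_max) p \in C k l.+1;
  pcat_rot_up_left : forall k l p,
    p \in C k l.+1 -> part_rot_up (@ord0) p \in C k.+1 l;
  pcat_rot_up_right : forall k l p,
    p \in C k l.+1 -> part_rot_up (@ord_max) p \in C k.+1 l;
  pcat_pair : forall k l, (k + l)%N = 2 -> [set [set: _]]%SET \in C k l
}.

Definition pi0 : part 3 3 :=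
  [set [set inl (inord 0); inl (inord 1); inr (inord 1); inr (inord 2)];
       [set inl (inord 2); inr (inord 0)]]%SET.

(** * Easy quantum groups *)

(* The basis e_(i_1) (x) ... (x) e_(i_k) of the k-th tensor power of C^n is
   indexed by [k.-tuple 'I_n]; linear maps between tensor powers and matrices
   u^(x)k are matrices over the enumeration of these multi-indices. *)
Section Easy.
Context {R : realType} (n : nat).

Definition tdim k := #|{: k.-tuple 'I_n}|.

Definition delta_part k l (p : part k l)
    (i : k.-tuple 'I_n) (j : l.-tuple 'I_n) : bool :=
  let label := fun x : 'I_k + 'I_l =>
    match x with inl r => tnth i r | inr r => tnth j r end in
  [forall B in p, forall x in B, forall y in B, label x == label y].

Definition Tpart k l (p : part k l) : 'M[R[i]]_(tdim l, tdim k) :=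
  \matrix_(j, i) (delta_part p (enum_val i) (enum_val j))%:R.

Definition tensor_power (A : cstarAlgType R) (u : 'M[A]_n) k :
    'M[A]_(tdim k) :=
  \matrix_(i, j) \prod_(r < k) u (tnth (enum_val i) r) (tnth (enum_val j) r).

Definition intertwiner (A : cstarAlgType R) (u : 'M[A]_n) k l
    (T : 'M[R[i]]_(tdim l, tdim k)) : Prop :=
  map_mx (in_alg A) T *m tensor_power u k
  = tensor_power u l *m map_mx (in_alg A) T.

Definition easy_quantum_group (A : cstarAlgType R) (u : 'M[A]_n)
    (C : forall k l, {set part k l}) : Prop :=
  [/\ orthogonal_cmqg u, partition_category C &
      forall k l (T : 'M[R[i]]_(tdim l, tdim k)),
        intertwiner u T <-> T \in <<[seq Tpart p | p <- enum (C k l)]>>%VS].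

End Easy.

(** * The free product of n copies of Z/2Z, as reduced words *)

Section FreeProduct.
Variable n : nat.
Implicit Types (i j : 'I_n) (w : seq 'I_n).

Definition reduced w : bool := sorted (fun i j => i != j) w.

Record z2free : predArgType :=
  Z2Free { z2word :> seq 'I_n; z2wordP : reduced z2word }.

HB.instance Definition _ := [isSub for z2word].
HB.instance Definition _ := [Choice of z2free by <:].

Definition z2cons i w : seq 'I_n :=
  if w is j :: w' then if i == j then w' else i :: w else [:: i].

Lemma z2cons_reduced i w : reduced w -> reduced (z2cons i w).
Proof.
case: w => [|j w] //= jw; case: eqVneq => [_|ij] /=; last by rewrite ij.
exact: path_sorted jw.
Qed.

Lemma z2consK i w : reduced w -> z2cons i (z2cons i w) = w.
Proof.
case: w => [|j w] /=; first by rewrite eqxx.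
case: eqVneq => [->|ij] jw /=; last by rewrite eqxx.
by case: w jw => [|k w] //= /andP[/negPf ->].
Qed.

Definition z2reduce w w' : seq 'I_n := foldr z2cons w' w.

Lemma z2reduce_reduced w w' : reduced w' -> reduced (z2reduce w w').
Proof. by move=> ?; elim: w => //= i w; apply: z2cons_reduced. Qed.

Lemma z2reduce_id w : reduced w -> z2reduce w [::] = w.
Proof.
elim: w => //= i w IH iw; rewrite (IH (path_sorted iw)).
by case: w iw {IH} => //= j w /andP[/negPf ->].
Qed.

Lemma z2reduce_cons i w w' : reduced w' ->
  z2reduce (z2cons i w) w' = z2cons i (z2reduce w w').
Proof.
move=> w'P; case: w => //= j w; case: eqVneq => //= <-.
by rewrite z2consK// z2reduce_reduced.
Qed.

Lemma z2reduceA w1 w2 w3 : reduced w3 ->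
  z2reduce (z2reduce w1 w2) w3 = z2reduce w1 (z2reduce w2 w3).
Proof. by move=> w3P; elim: w1 => //= i w1 IH; rewrite z2reduce_cons// IH. Qed.

Lemma z2reduce_rev w w' : reduced w' -> z2reduce (rev w) (z2reduce w w') = w'.
Proof.
move=> w'P; elim: w => //= i w IH.
by rewrite rev_cons /z2reduce foldr_rcons z2consK// z2reduce_reduced.
Qed.

Lemma reduced_rev w : reduced w -> reduced (rev w).
Proof.
rewrite /reduced rev_sorted.
by case: w => //= i w; rewrite (eq_path (e' := fun i j => i != j))// => ? ?; rewrite eq_sym.
Qed.

Definition z2mul (x y : z2free) : z2free :=
  Z2Free (z2reduce_reduced x (z2wordP y)).
Definition z2one : z2free := @Z2Free [::] isT.
Definition z2inv (x : z2free) : z2free := Z2Free (reduced_rev (z2wordP x)).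

Lemma z2mulA : associative z2mul.
Proof. by move=> x y z; apply: val_inj; rewrite /= z2reduceA ?z2wordP. Qed.
Lemma z2mul1 : left_id z2one z2mul.
Proof. by move=> x; apply: val_inj. Qed.
Lemma z2mulr1 : right_id z2one z2mul.
Proof. by move=> x; apply: val_inj; rewrite /= z2reduce_id ?z2wordP. Qed.
Lemma z2mulV : left_inverse z2one z2inv z2mul.
Proof.
move=> x; apply: val_inj => /=.
by rewrite -[X in z2reduce _ X](z2reduce_id (z2wordP x)) z2reduce_rev.
Qed.
Lemma z2invK : involutive z2inv.
Proof. by move=> x; apply: val_inj; rewrite /= revK. Qed.
Lemma z2mulrV : right_inverse z2one z2inv z2mul.
Proof. by move=> x; rewrite -{1}[x]z2invK z2mulV. Qed.

HB.instance Definition _ := isGroup.Build z2free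
  z2mulA z2mul1 z2mulr1 z2mulV z2mulrV.

Definition z2gen i : z2free := @Z2Free [:: i] isT.

(* The morphism extending a map from the generators to elements of G whose
   square is 1 (see [z2liftM], [z2lift_gen]). *)
Definition z2lift (G : groupType) (d : 'I_n -> G) (x : z2free) : G :=
  foldr (fun i g => d i * g)%g 1%g (z2word x).

Lemma z2liftM (G : groupType) (d : 'I_n -> G) :
  (forall i, d i * d i = 1)%g -> {morph z2lift d : x y / (x * y)%g}.
Proof.
move=> dd [w wP] [w' w'P]; rewrite /z2lift /= => {wP w'P}.
elim: w => /= [|i w IH]; first by rewrite mul1g.
rewrite -mulgA -{}IH; case: (z2reduce w w') => //= j v.
by case: eqVneq => //= <-; rewrite !mulgA dd mul1g.
Qed.

Lemma z2lift_gen (G : groupType) (d : 'I_n -> G) i : z2lift d (z2gen i) = d i.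
Proof. by rewrite /z2lift /= mulg1. Qed.

Lemma z2gen_sq i : (z2gen i * z2gen i = 1)%g.
Proof. by apply: val_inj; rewrite /= eqxx. Qed.

Definition z2sigma (phi : 'I_n -> 'I_n) : z2free -> z2free :=
  z2lift (fun k => z2gen (phi k)).

(* Gamma with its surjection [q] is the quotient of the free product by the
   normal subgroup N = ker q; the last clause is sigma_phi(N) <= N.  The
   generators of Gamma are [q (z2gen i)]. *)
Definition strongly_symmetric_reflection_group (Gamma : groupType)
    (q : z2free -> Gamma) : Prop :=
  [/\ {morph q : x y / (x * y)%g},
      (forall g, exists x, q x = g) &
      forall (phi : 'I_n -> 'I_n) x, q x = 1%g -> q (z2sigma phi x) = 1%g].

End FreeProduct.

(** * The C*-algebra C(S_n) *)

Definition csym (R : realType) n := {ffun 'S_n -> R[i]}.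

Section CSym.
Context (R : realType) (n : nat).
Local Notation csym := (csym R n).
Implicit Types f g : csym.

HB.instance Definition _ := GRing.Lmodule.on csym.
HB.instance Definition _ := GRing.PzRing.on csym.
HB.instance Definition _ := GRing.PzSemiRing_isNonZero.Build csym
  (@ffun1_nonzero _ _ (1%g : 'S_n)).

Lemma csymZE (c : R[i]) f s : (c *: f) s = c * f s.
Proof. by rewrite ffunE. Qed.

Lemma csym_scaleAl (c : R[i]) f g : c *: (f * g) = (c *: f) * g.
Proof. by apply/ffunP => s; rewrite !(csymZE, ffunE) mulrA. Qed.
HB.instance Definition _ := GRing.Lmodule_isLalgebra.Build R[i] csym csym_scaleAl.
Lemma csym_scaleAr (c : R[i]) f g : c *: (f * g) = f * (c *: g).
Proof. by apply/ffunP => s; rewrite !(csymZE, ffunE) mulrCA. Qed.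
HB.instance Definition _ := GRing.Lalgebra_isAlgebra.Build R[i] csym csym_scaleAr.

Definition csym_star f : csym := [ffun s => (f s)^*].
Definition csym_norm f : R := \big[Order.max/0]_(s : 'S_n) normc (f s).

Lemma csym_starK : involutive csym_star.
Proof. by move=> f; apply/ffunP => s; rewrite !ffunE conjCK. Qed.
Lemma csym_starD : {morph csym_star : f g / f + g}.
Proof. by move=> f g; apply/ffunP => s; rewrite !ffunE rmorphD. Qed.
Lemma csym_starZ (c : R[i]) f : csym_star (c *: f) = c^* *: csym_star f.
Proof. by apply/ffunP => s; rewrite !(csymZE, ffunE) rmorphM. Qed.
Lemma csym_starM f g : csym_star (f * g) = csym_star g * csym_star f.
Proof. by apply/ffunP => s; rewrite !ffunE rmorphM mulrC. Qed.

Lemma csym_norm_ge f s : normc (f s) <= csym_norm f.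
Proof. exact: le_bigmax. Qed.

Lemma normc_ge0 (x : R[i]) : 0 <= normc x.
Proof. by case: x => a b; rewrite sqrtr_ge0. Qed.

Lemma csym_norm_ge0 f : 0 <= csym_norm f.
Proof. exact: le_trans (normc_ge0 _) (csym_norm_ge f 1%g). Qed.

Lemma csym_norm_le f (c : R) :
  (forall s, normc (f s) <= c) -> csym_norm f <= c.
Proof.
by move=> fc; apply: bigmax_le => // ; apply: le_trans (fc 1%g); apply: normc_ge0.
Qed.

Lemma csym_norm_ex f : exists s, csym_norm f = normc (f s).
Proof.
exists [arg max_(s > (1%g : 'S_n)) normc (f s)]%O.
by apply: bigmax_eq_arg => // s _; apply: normc_ge0.
Qed.

Lemma csym_norm0_eq0 f : csym_norm f = 0 -> f = 0.
Proof.
move=> f0; apply/ffunP => s; rewrite ffunE; apply: eq0_normc.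
by apply/eqP; rewrite eq_le normc_ge0 andbT -f0 csym_norm_ge.
Qed.
Lemma ler_csym_normD f g : csym_norm (f + g) <= csym_norm f + csym_norm g.
Proof.
apply: csym_norm_le => s; rewrite ffunE (le_trans (le_normcD _ _))//.
by rewrite lerD ?csym_norm_ge.
Qed.
Lemma csym_normZ (c : R[i]) f : csym_norm (c *: f) = normc c * csym_norm f.
Proof.
apply/eqP; rewrite eq_le; apply/andP; split.
  apply: csym_norm_le => s; rewrite csymZE normcM.
  by rewrite ler_wpM2l ?normc_ge0 ?csym_norm_ge.
have [s ->] := csym_norm_ex f.
by rewrite -normcM; have := csym_norm_ge (c *: f) s; rewrite csymZE.
Qed.
Lemma ler_csym_normM f g : csym_norm (f * g) <= csym_norm f * csym_norm g.
Proof.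
apply: csym_norm_le => s; rewrite ffunE normcM.
by rewrite ler_pM ?normc_ge0 ?csym_norm_ge.
Qed.
Lemma normc_conj (x : R[i]) : normc x^* = normc x.
Proof. by case: x => a b; rewrite /= sqrrN. Qed.
Lemma csym_norm_star f : csym_norm (csym_star f * f) = csym_norm f ^+ 2.
Proof.
apply/eqP; rewrite eq_le expr2; apply/andP; split.
  apply: csym_norm_le => s; rewrite !ffunE normcM normc_conj.
  by rewrite ler_pM ?normc_ge0 ?csym_norm_ge.
have [s ->] := csym_norm_ex f.
rewrite -{1}(normc_conj (f s)) -normcM.
by have := csym_norm_ge (csym_star f * f) s; rewrite !ffunE.
Qed.
Lemma ler_ReIm_normc (x : R[i]) :
  (`|complex.Re x| <= normc x) * (`|complex.Im x| <= normc x).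
Proof.
case: x => a b /=; rewrite -!sqrtr_sqr.
by split; rewrite ler_wsqrtr// ?lerDl ?lerDr sqr_ge0.
Qed.

Lemma ler_normc_ReIm (x : R[i]) :
  normc x <= `|complex.Re x| + `|complex.Im x|.
Proof.
case: x => a b /=; rewrite -[leRHS]ger0_norm ?addr_ge0// -sqrtr_sqr.
rewrite ler_wsqrtr// sqrrD !real_normK ?num_real//.
by rewrite lerD2r lerDl mulrn_wge0// mulr_ge0.
Qed.

Lemma cauchy_seq_cvg (a : nat -> R) :
  (forall e : R, 0 < e -> \forall m & m' \near \oo, `|a m - a m'| < e) ->
  exists l : R, a @ \oo --> l.
Proof.
move=> ca; apply/cvg_ex; apply: cauchy_cvg; apply/cauchy_ballP => e e0.
have [[P Q] /= [P0 Q0] PQ] := ca e e0.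
exists (a @` P, a @` Q) => /=.
  by split; [apply: filterS P0|apply: filterS Q0] => x ?; exists x.
by move=> [_ _] /= [[x Px <-] [y Qy <-]]; apply: (PQ (x, y)).
Qed.

Lemma csym_complete (f : nat -> csym) :
  (forall e : R, 0 < e ->
     \forall m & m' \near \oo, csym_norm (f m - f m') < e) ->
  exists l : csym, csym_norm (f m - l) @[m --> \oo] --> (0 : R).
Proof.
move=> cf.
have cvgRe s : exists l : R, complex.Re (f m s) @[m --> \oo] --> l.
  apply: cauchy_seq_cvg => e /cf; apply: filterS => -[m m'] /=.
  apply: le_lt_trans; rewrite -raddfB.
  rewrite (le_trans (ler_ReIm_normc _).1)//.
  by have := csym_norm_ge (f m - f m') s; rewrite !ffunE.
have cvgIm s : exists l : R, complex.Im (f m s) @[m --> \oo] --> l.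
  apply: cauchy_seq_cvg => e /cf; apply: filterS => -[m m'] /=.
  apply: le_lt_trans; rewrite -raddfB.
  rewrite (le_trans (ler_ReIm_normc _).2)//.
  by have := csym_norm_ge (f m - f m') s; rewrite !ffunE.
have [a fa] := choice cvgRe; have [b fb] := choice cvgIm.
pose l : csym := [ffun s => (a s +i* b s)%C].
exists l; pose h m := \sum_(s : 'S_n)
  (`|complex.Re (f m s) - a s| + `|complex.Im (f m s) - b s|).
apply: (@squeeze_cvgr _ _ _ _ (cst 0) h) => //=.
- near=> m; rewrite csym_norm_ge0/=; apply: csym_norm_le => s.
  rewrite !ffunE /h (bigD1 s)//= -[leLHS]addr0 lerD//; last first.
    by apply: sumr_ge0 => *; rewrite addr_ge0.
  by rewrite (le_trans (ler_normc_ReIm _))// !raddfB.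
- exact: cvg_cst.
- rewrite [X in _ --> X](_ : _ = \sum_(s : 'S_n) 0); last by rewrite big1.
  apply: cvg_big => [|s _]; first exact: add_continuous.
  rewrite -[X in _ --> X]addr0.
  apply: cvgD; rewrite -[X in _ --> X](@normr0 R R); apply: cvg_norm.
    by rewrite -(subrr (a s)); apply: cvgB => //; apply: cvg_cst.
  by rewrite -(subrr (b s)); apply: cvgB => //; apply: cvg_cst.
Unshelve. all: by end_near. Qed.

HB.instance Definition _ := isCStar.Build R csym csym_starK csym_starD
  csym_starZ csym_starM csym_norm0_eq0 ler_csym_normD csym_normZ ler_csym_normM
  csym_norm_star csym_complete.

Definition perm_coord (i j : 'I_n) : csym := [ffun s : 'S_n => (s j == i)%:R].

End CSym.

(** * The compact matrix quantum group built from C*(Gamma) and C(S_n) *)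

Section Bowtie.
Context {R : realType}.

Definition unitary_rep (Gamma : groupType) (B : cstarAlgType R)
    (w : Gamma -> B) : Prop :=
  [/\ w 1%g = 1, (forall g h, w (g * h)%g = w g * w h) &
      forall g, star (w g) * w g = 1 /\ w g * star (w g) = 1].

Definition max_group_cstar (Gamma : groupType) (B : cstarAlgType R)
    (w : Gamma -> B) : Prop :=
  [/\ unitary_rep w, cstar_generates (range w) &
      forall (D : cstarAlgType R) (v : Gamma -> D), unitary_rep v ->
        exists F : {lrmorphism B -> D}, star_hom F /\ forall g, F (w g) = v g].

Definition cmqg_iso n (A B : cstarAlgType R) (u : 'M[A]_n) (v : 'M[B]_n) :
    Prop :=
  exists f : {lrmorphism A -> B},
    [/\ star_hom f, bijective f & forall i j, f (u i j) = v i j].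

Definition iso_bowtie n (A : cstarAlgType R) (u : 'M[A]_n) (Gamma : groupType)
    (q : z2free n -> Gamma) : Prop :=
  exists (B : cstarAlgType R) (w : Gamma -> B) (T : cstarAlgType R)
      (i1 : {lrmorphism B -> T}) (i2 : {lrmorphism csym R n -> T}),
    [/\ max_group_cstar w, is_tensor i1 i2 &
        cmqg_iso u
          (\matrix_(i, j) (i1 (w (q (z2gen i))) * i2 (perm_coord R i j)))].

End Bowtie.

(* Main.v *)
(* For the first part, pi_0 makes the squares p_ij = u_ij^2 central and the
   u_ij orthogonal along rows and columns, so that the p_ij are the coordinates
   of a magic unitary with commuting entries.  The row sums s_i = sum_j u_ij are
   then self-adjoint unitaries with u_ij = s_i p_ij, and the products P_t of the
   p_(t(j) j) are central projections of sum 1, indexed by the permutations t.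
   Gamma is the group generated by the s_i.  A relation s_w P_1 = P_1 is
   transported by the comultiplication to a fixed vector of a tensor power of u;
   easiness then yields a partition p in C(0, m) compatible with w, and since p
   is also compatible with phi(w) for every map phi, s_(phi(w)) = 1.  This gives
   the strong symmetry of Gamma, the nonvanishing of all P_t, and, as group-like
   elements are independent, the independence of the g P_t.  The assignment
   u_ij -> u_(g_i) p_ij is thus well defined on the *-algebra generated by the
   u_ij, and maximality extends it to an isomorphism.

   Conversely, for a strongly symmetric Gamma let C consist of the partitions p
   such that all labellings constant on the blocks of p have equal upper and
   lower words in Gamma.  A matrix M intertwines the tensor powers of
   (u_(g_i) p_ij) iff it is S_n-invariant and supported on pairs of multi-indices
   with equal words, and such matrices are combinations of the T_p.

   The existence of C*(Gamma) with injective u, of spatial tensor products, and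
   of slice maps rests on positivity, the Gelfand-Naimark-Segal construction and
   completions of pre-Hilbert spaces. *)
Require Import Defs.
From HB Require Import structures.
From mathcomp Require Import all_boot all_order all_algebra all_fingroup.
From mathcomp Require Import sesquilinear.
From mathcomp Require Import all_classical all_reals.
From mathcomp Require Import topology normedtype sequences.
From mathcomp.real_closed Require Import complex.
From mathcomp Require Import ring lra.

Set Implicit Arguments.
Unset Strict Implicit.
Unset Printing Implicit Defensive.

Import Order.TTheory GRing.Theory Num.Theory.
Import numFieldNormedType.Exports.
Import ComplexField.Normc.

Local Open Scope classical_set_scope.
Local Open Scope ring_scope.

(** * Convergence in C*-algebras *)

(** Two obstacles shape the proof. The tensor product is known only through its spatial norm, so an
    equation in it can be exploited only by slicing with functionals that come from Hilbert space
    representations. GNS supplies enough of them, which is why Hahn-Banach and the positivity of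
    [star x * x], obtained here by norm estimates instead of spectra, come so early. Secondly, no
    counit is used: passing from a to a P_1 takes its place. That P_1 is nonzero follows because the
    permutations t with P_t nonzero form a nonempty set closed under products in a finite group. On
    the block P_t the matrix u is monomial, with s_i at the places t j = i, so computations in A and
    in A (x) A are done block by block. Gamma is taken inside A, hence its relations are equations
    of A. What is unknown is the norm on its span: the map out of A is therefore built as an
    algebraic graph and extended by maximality, whereas its inverse comes from the universal
    property of C*(Gamma). Conversely, the intertwiners of the constructed quantum group can be read
    off coefficientwise because the unitaries of distinct group elements are independent. *)

Section SeminormConvergence.
Context {R : realType} {V : zmodType} (N : V -> R).

(** Only a seminorm is assumed, so that the same lemmas serve C*-norms, the modulus on [R[i]],
    operator norms and the degenerate norms of pre-inner products. *)
Definition ncvg (x : nat -> V) (l : V) := forall e : R, 0 < e ->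
  exists K, forall m, (K <= m)%N -> N (x m - l) < e.
Definition ncauchy (x : nat -> V) := forall e : R, 0 < e ->
  exists K, forall m m', (K <= m)%N -> (K <= m')%N -> N (x m - x m') < e.

Hypothesis N0 : N 0 = 0.
Hypothesis ND : forall x y, N (x + y) <= N x + N y.
Hypothesis NN : forall x, N (- x) = N x.

Lemma nseminorm_ge0 x : 0 <= N x.
Proof. have := ND x (- x); rewrite subrr N0 NN; lra. Qed.

Lemma nseminormB x y : N (x - y) = N (y - x).
Proof. by rewrite -NN opprB. Qed.

Lemma nseminorm_tri x y z : N (x - z) <= N (x - y) + N (y - z).
Proof. by rewrite -{1}(subrK y x) -addrA ND. Qed.

Lemma nseminorm_lt2 x y z (e : R) :
  N (x - y) < e / 2 -> N (y - z) < e / 2 -> N (x - z) < e.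
Proof. by have := nseminorm_tri x y z; lra. Qed.

Lemma nseminorm_lt3 x y z w (e : R) : N (x - y) < e / 3 -> N (y - z) < e / 3 ->
  N (z - w) < e / 3 -> N (x - w) < e.
Proof. by have := nseminorm_tri x y w; have := nseminorm_tri y z w; lra. Qed.

Lemma ncvg_cst l : ncvg (fun=> l) l.
Proof. by move=> e e0; exists 0%N => m _; rewrite subrr N0. Qed.

Lemma ncvgD x y l l' : ncvg x l -> ncvg y l' ->
  ncvg (fun m => x m + y m) (l + l').
Proof.
move=> xl yl e e0; have [K HK] := xl (e / 2) ltac:(lra).
have [K' HK'] := yl (e / 2) ltac:(lra).
exists (maxn K K') => m; rewrite geq_max => /andP[/HK ? /HK' ?].
rewrite (_ : _ - _ = (x m - l) + (y m - l')); last by rewrite opprD addrACA.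
by apply: le_lt_trans (ND _ _) _; lra.
Qed.

Lemma ncvg_uniq0 x l l' : ncvg x l -> ncvg x l' -> N (l - l') = 0.
Proof.
move=> xl xl'; apply/eqP; rewrite eq_le nseminorm_ge0 andbT leNgt.
apply/negP => lt0; have [K HK] := xl (N (l - l') / 2) ltac:(lra).
have [K' HK'] := xl' (N (l - l') / 2) ltac:(lra).
have := HK _ (leq_maxl K K'); have := HK' _ (leq_maxr K K').
set m := maxn _ _ => h1 h2; have := ND (l - x m) (x m - l').
by rewrite addrA subrK (nseminormB l (x m)); lra.
Qed.

Lemma ncvg_cauchy x l : ncvg x l -> ncauchy x.
Proof.
move=> xl e e0; have [K HK] := xl (e / 2) ltac:(lra).
exists K => m m' /HK h /HK h'.
rewrite (_ : _ - _ = (x m - l) - (x m' - l)); last by rewrite opprB addrA subrK.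
by apply: le_lt_trans (ND _ _) _; rewrite NN; lra.
Qed.

Lemma ncauchy_bounded x : ncauchy x -> exists2 M : R, 0 <= M & forall m, N (x m) <= M.
Proof.
move=> /(_ 1 ltr01)[K HK].
pose M := N (x K) + 1 + \sum_(i < K) N (x i); exists M.
  by rewrite !addr_ge0// ?nseminorm_ge0// sumr_ge0// => i _; rewrite nseminorm_ge0.
move=> m; have [mK|Km] := ltnP m K.
  rewrite /M (bigD1 (Ordinal mK))//=.
  have : 0 <= \sum_(i < K | i != Ordinal mK) N (x i).
    by rewrite sumr_ge0// => i _; rewrite nseminorm_ge0.
  by have := nseminorm_ge0 (x K); lra.
have : 0 <= \sum_(i < K) N (x i).
  by rewrite sumr_ge0// => i _; rewrite nseminorm_ge0.
have := HK _ _ Km (leqnn K); rewrite /M.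
have := ND (x m - x K) (x K); rewrite subrK; lra.
Qed.

Lemma ncvg_bounded x l : ncvg x l -> exists2 M : R, 0 <= M & forall m, N (x m) <= M.
Proof. by move=> /ncvg_cauchy/ncauchy_bounded. Qed.

Lemma ncvg_norm_le x l (c : R) : ncvg x l -> (forall m, N (x m) <= c) -> N l <= c.
Proof.
move=> xl xc; apply/ler_addgt0Pr => e /xl[K /(_ _ (leqnn K))].
by have := ND (l - x K) (x K); rewrite subrK nseminormB; have := xc K; lra.
Qed.

End SeminormConvergence.

Lemma ncvg_comp (R : realType) (V W : zmodType) (N : V -> R) (N' : W -> R)
    (f : V -> W) (c : R) x l : 0 <= c ->
  (forall y, N' (f y - f l) <= c * N (y - l)) -> ncvg N x l ->
  ncvg N' (fun m => f (x m)) (f l).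
Proof.
move=> c0 fc xl e e0; have [|K HK] := xl (e / (c + 1)).
  by rewrite divr_gt0//; lra.
exists K => m /HK; rewrite ltr_pdivlMr; last lra.
by have := fc (x m) => h1 h2; nra.
Qed.

Lemma invn_small (R : realType) (e : R) : 0 < e ->
  exists K : nat, forall m, (K <= m)%N -> m.+1%:R^-1 < e.
Proof.
move=> e0; exists (Num.bound e^-1) => m Km.
rewrite -[ltRHS]invrK ltf_pV2 ?posrE ?invr_gt0//.
apply: lt_le_trans (archi_boundP _) _; first by rewrite invr_ge0 ltW.
by rewrite ler_nat ltnW.
Qed.

(** If the claim failed, jumps of size [e] could be chained until the bound [M] is exceeded. *)
Lemma nondecreasing_ncauchy (R : realType) (b : nat -> R) (M : R) :
  (forall n, b n <= b n.+1) -> (forall n, b n <= M) ->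
  forall e : R, 0 < e -> exists K, forall m, (K <= m)%N -> b m - b K < e.
Proof.
move=> bS bM e e0; apply: contrapT => /forallNP H.
have {}H K : exists2 m, (K <= m)%N & b K + e <= b m.
  have /existsNP[m /not_implyP[Km /negP]] := H K.
  by rewrite -leNgt => ?; exists m => //; lra.
have large k : exists m, b 0%N + e *+ k <= b m.
  elim: k => [|k [m IH]]; first by exists 0%N; rewrite mulr0n addr0.
  by have [m' _ h] := H m; exists m'; rewrite mulrSr; lra.
have [k hk] : exists k : nat, (M - b 0%N) / e < k%:R.
  exists (Num.bound `|(M - b 0%N) / e|).
  by apply: le_lt_trans (ler_norm _) _; apply: archi_boundP.
have [m] := large k; have := bM m; move: hk.
by rewrite ltr_pdivrMr// -mulr_natl; lra.
Qed.

Section CStarBasics.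
Context {R : realType} {A : cstarAlgType R}.
Implicit Types (x y z : A) (r s t : R).

Lemma normc_real r : normc (r%:C)%C = `|r|.
Proof. by rewrite /= expr0n addr0 sqrtr_sqr. Qed.

Lemma conjC_rc r : ((r%:C)%C : R[i])^* = (r%:C)%C.
Proof. by rewrite -[LHS]/(conjc _) /= oppr0. Qed.

Lemma cnorm0 : cnorm (0 : A) = 0.
Proof. by rewrite -(scale0r (0 : A)) cnormZ (normc_real 0) normr0 mul0r. Qed.

Lemma cnormN x : cnorm (- x) = cnorm x.
Proof.
by rewrite -scaleN1r cnormZ normcN -(rmorph1 (real_complex R)) normc_real normr1 mul1r.
Qed.

Lemma cnorm_ge0 x : 0 <= cnorm x.
Proof. exact: (nseminorm_ge0 cnorm0 (@ler_cnormD R A) cnormN). Qed.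

Hint Extern 0 (is_true (0 <= cnorm _)) => solve [apply: cnorm_ge0] : core.

Lemma cnormB x y : cnorm (x - y) = cnorm (y - x).
Proof. exact: nseminormB cnormN _ _. Qed.

Lemma cnorm_sum (I : Type) (q : seq I) (P : pred I) (F : I -> A) :
  cnorm (\sum_(i <- q | P i) F i) <= \sum_(i <- q | P i) cnorm (F i).
Proof.
elim/big_ind2: _ => [|a b c d ab cd|//]; first by rewrite cnorm0.
by apply: le_trans (ler_cnormD _ _) _; rewrite lerD.
Qed.

Lemma cnorm_le0 x : cnorm x <= 0 -> x = 0.
Proof. by move=> x0; apply: cnorm0_eq0; apply: le_anti; rewrite x0 cnorm_ge0. Qed.

Lemma cnorm_starE x : cnorm (star x) = cnorm x.
Proof.
have le y : cnorm y <= cnorm (star y).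
  have [->|y0] := eqVneq y 0; first by rewrite cnorm0.
  have ny : 0 < cnorm y.
    by rewrite lt_neqAle eq_sym cnorm_ge0 andbT; apply: contra y0 => /eqP/cnorm0_eq0->.
  by rewrite -(ler_pM2r ny) -expr2 -cnorm_star ler_cnormM.
by apply: le_anti; rewrite le andbT; have := le (star x); rewrite starK.
Qed.

Lemma star0 : star (0 : A) = 0.
Proof. by apply: (@addrI _ (star 0)); rewrite -starD !addr0. Qed.
Lemma starN x : star (- x) = - star x.
Proof. by apply: (@addrI _ (star x)); rewrite -starD !subrr star0. Qed.
Lemma starB x y : star (x - y) = star x - star y.
Proof. by rewrite starD starN. Qed.
Lemma star1 : star (1 : A) = 1.
Proof. by rewrite -{2}[1]starK -[star 1 in RHS]mulr1 starM starK mulr1. Qed.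
Lemma star_sum (I : Type) (q : seq I) (P : pred I) (F : I -> A) :
  star (\sum_(i <- q | P i) F i) = \sum_(i <- q | P i) star (F i).
Proof. exact: (big_morph _ starD star0). Qed.

Lemma cnorm1 : cnorm (1 : A) = 1.
Proof.
have := cnorm_star (1 : A); rewrite star1 mul1r => /eqP.
rewrite expr2 -subr_eq0 -{1}[cnorm _]mulr1 -mulrBr mulf_eq0 => /orP[/eqP/cnorm0_eq0|].
  by move/eqP; rewrite oner_eq0.
by rewrite subr_eq0 => /eqP <-.
Qed.

(** Real scalars live inside A, so that order relations become positivity of [rs t - h], and
    expressions in one element become values of polynomials. *)
Definition rs r : A := (r%:C)%C%:A.

Lemma rsE r x : rs r * x = (r%:C)%C *: x. Proof. by rewrite mulr_algl. Qed.
Lemma rs_comm r x : x * rs r = rs r * x.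
Proof. by rewrite mulr_algl mulr_algr. Qed.
Lemma rsD r s : rs (r + s) = rs r + rs s.
Proof. by rewrite /rs rmorphD scalerDl. Qed.
Lemma rsM r s : rs (r * s) = rs r * rs s.
Proof. by rewrite rsE scalerA -rmorphM. Qed.
Lemma rs0 : rs 0 = 0. Proof. by rewrite /rs scale0r. Qed.
Lemma rs1 : rs 1 = 1. Proof. by rewrite /rs scale1r. Qed.
Lemma rsN r : rs (- r) = - rs r. Proof. by rewrite /rs rmorphN scaleNr. Qed.
Lemma rsB r s : rs (r - s) = rs r - rs s. Proof. by rewrite rsD rsN. Qed.
Lemma cnorm_rsM r x : cnorm (rs r * x) = `|r| * cnorm x.
Proof. by rewrite rsE cnormZ normc_real. Qed.
Lemma cnorm_rs r : cnorm (rs r) = `|r|.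
Proof. by rewrite -[rs r]mulr1 cnorm_rsM cnorm1 mulr1. Qed.
Lemma star_rsM r x : star (rs r * x) = rs r * star x.
Proof. by rewrite !rsE starZ conjC_rc. Qed.
Lemma star_rs r : star (rs r) = rs r.
Proof. by rewrite -[rs r]mulr1 star_rsM star1. Qed.

Definition cvgC := ncvg (@cnorm R A).
Local Notation "u --> l" := (cvgC u l).

Lemma cvgC_cst l : (fun=> l) --> l. Proof. exact: ncvg_cst cnorm0 _. Qed.
Lemma cvgCD u v l l' : u --> l -> v --> l' -> (fun m => u m + v m) --> (l + l').
Proof. exact: (ncvgD (@ler_cnormD R A)). Qed.
Lemma cvgC_uniq u l l' : u --> l -> u --> l' -> l = l'.
Proof.
move=> ul ul'; apply/eqP; rewrite -subr_eq0; apply/eqP/cnorm0_eq0.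
exact: (ncvg_uniq0 cnorm0 (@ler_cnormD R A) cnormN ul ul').
Qed.
Lemma cvgC_star u l : u --> l -> (fun m => star (u m)) --> star l.
Proof. by apply: ncvg_comp ler01 _ => y; rewrite -starB cnorm_starE mul1r. Qed.
Lemma cvgCMl x u l : u --> l -> (fun m => x * u m) --> (x * l).
Proof.
apply: (ncvg_comp (f := fun v => x * v) (cnorm_ge0 x)) => y.
by rewrite -mulrBr ler_cnormM.
Qed.
Lemma cvgCMr x u l : u --> l -> (fun m => u m * x) --> (l * x).
Proof.
apply: (ncvg_comp (f := fun v => v * x) (cnorm_ge0 x)) => y.
by rewrite -mulrBl mulrC ler_cnormM.
Qed.
Lemma cvgCZ (c : R[i]) u l : u --> l -> (fun m => c *: u m) --> (c *: l).
Proof.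
move=> ul; rewrite -[c *: l]mulr_algl.
by under eq_fun do rewrite -mulr_algl; apply: cvgCMl.
Qed.
Lemma cvgCM u v l l' : u --> l -> v --> l' -> (fun m => u m * v m) --> (l * l').
Proof.
move=> ul vl; have [M M0 uM] := ncvg_bounded cnorm0 (@ler_cnormD R A) cnormN ul.
have uvl : (fun m => u m * (v m - l')) --> 0.
  move=> e e0; have [|K HK] := vl (e / (M + 1)); first by rewrite divr_gt0//; lra.
  exists K => m /HK; rewrite subr0 ltr_pdivlMr; last lra.
  have := ler_cnormM (u m) (v m - l'); have := uM m.
  by have := cnorm_ge0 (v m - l'); have := cnorm_ge0 (u m); nra.
have := cvgCD uvl (cvgCMr l' ul); rewrite add0r; congr (_ --> _).
by apply: funext => m; rewrite mulrBr subrK.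
Qed.

Lemma ncauchyC_cvg (u : nat -> A) : ncauchy (@cnorm R A) u -> exists l, u --> l.
Proof.
move=> cu; have [e e0|l ul] := cnorm_complete u.
  have [K HK] := cu e e0; exists ([set m | (K <= m)%N], [set m | (K <= m)%N]) => /=.
    by split; exists K.
  by move=> [m m'] [/= ? ?]; apply: HK.
exists l => e e0; move/cvgrPdist_lt: ul => /(_ e e0)[K _ HK]; exists K => m Km.
by have := HK m Km; rewrite /= sub0r normrN ger0_norm.
Qed.

Lemma cstar_dense_cvg (S : set A) : cstar_dense S -> forall x,
  exists2 u, (forall m, S (u m)) & u --> x.
Proof.
move=> dS x; have /choice[u Hu] : forall m : nat, exists y, S y /\ cnorm (x - y) < m.+1%:R^-1.
  by move=> m; have [|y] := dS x m.+1%:R^-1; [rewrite invr_gt0 | exists y].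
exists u => [m|e e0]; first exact: (Hu m).1.
have [K HK] := invn_small e0; exists K => m Km; rewrite cnormB.
by apply: lt_trans (Hu m).2 _; apply: HK.
Qed.

End CStarBasics.
#[export] Hint Extern 0 (is_true (0 <= cnorm _)) => solve [apply: cnorm_ge0] : core.

(** * Positive elements and states *)

Section Positivity.
Context {R : realType} {A : cstarAlgType R}.
Implicit Types (x y z h k : A) (r s t : R).
Local Notation "u --> l" := (cvgC u l).

Definition sa x := star x = x.

Lemma saD x y : sa x -> sa y -> sa (x + y).
Proof. by rewrite /sa starD => -> ->. Qed.
Lemma saN x : sa x -> sa (- x). Proof. by rewrite /sa starN => ->. Qed.
Lemma saB x y : sa x -> sa y -> sa (x - y).
Proof. by move=> ? /saN; apply: saD. Qed.
Lemma sa_rs r : sa (rs r). Proof. exact: star_rs. Qed.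
Lemma sa_rsM r x : sa x -> sa (rs r * x).
Proof. by rewrite /sa star_rsM => ->. Qed.
Lemma sa_sq x : sa x -> sa (x * x). Proof. by rewrite /sa starM => ->. Qed.
Lemma saM x y : sa x -> sa y -> x * y = y * x -> sa (x * y).
Proof. by rewrite /sa starM => -> ->. Qed.
Lemma sa_sM x : sa (star x * x). Proof. by rewrite /sa starM starK. Qed.

Lemma cnorm_sa_sq x : sa x -> cnorm (x * x) = cnorm x ^+ 2.
Proof. by move=> sx; rewrite -cnorm_star sx. Qed.

Lemma sa_sq_eq0 x : sa x -> x * x = 0 -> x = 0.
Proof.
move=> /cnorm_sa_sq + x0; rewrite x0 cnorm0 => /esym/eqP.
by rewrite expf_eq0 => /eqP/cnorm0_eq0.
Qed.

Lemma sa_half x y : rs 2 * x = y -> x = rs 2^-1 * y.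
Proof. by move=> <-; rewrite mulrA -rsM mulVf ?pnatr_eq0// rs1 mul1r. Qed.

Lemma rs2 x : rs 2 * x = x + x.
Proof. by rewrite (natrD _ 1 1) rsD rs1 mulrDl !mul1r. Qed.

(* The scalar iteration b' = (1 + b^2) / 2 from 0 increases to 1 and dominates
   the iteration v' = (y + v^2) / 2, whose limit v satisfies (1 - v)^2 = 1 - y. *)
Fixpoint sqrt_iter y n := if n is n'.+1
  then rs 2^-1 * (y + sqrt_iter y n' * sqrt_iter y n') else 0.
Fixpoint sqrt_bound n : R := if n is n'.+1
  then 2^-1 * (1 + sqrt_bound n' * sqrt_bound n') else 0.

Lemma sqrt_bound_itv n : 0 <= sqrt_bound n <= 1.
Proof. by elim: n => [|n /andP[? ?]]/=; apply/andP; split; nra. Qed.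

Lemma sqrt_bound_incr n : sqrt_bound n <= sqrt_bound n.+1.
Proof. have /andP[? ?] := sqrt_bound_itv n => /=; nra. Qed.

Lemma sqrt_iter_cauchy y : cnorm y <= 1 ->
  (forall n, cnorm (sqrt_iter y n) <= sqrt_bound n) /\
  ncauchy (@cnorm R A) (sqrt_iter y).
Proof.
move=> y1; have bnd n : cnorm (sqrt_iter y n) <= sqrt_bound n.
  elim: n => [|n IH] /=; first by rewrite cnorm0.
  rewrite cnorm_rsM ger0_norm ?invr_ge0//.
  have := ler_cnormD y (sqrt_iter y n * sqrt_iter y n).
  have := ler_cnormM (sqrt_iter y n) (sqrt_iter y n).
  by have := cnorm_ge0 (sqrt_iter y n); nra.
have step n : cnorm (sqrt_iter y n.+1 - sqrt_iter y n) <=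
    sqrt_bound n.+1 - sqrt_bound n.
  elim: n => [|n IH].
    rewrite /= !mul0r subr0 !addr0 mulr1 subr0 cnorm_rsM ger0_norm ?invr_ge0//; lra.
  rewrite [in leLHS]/= -/(sqrt_iter y n.+1) -mulrBr opprD addrACA subrr add0r.
  (* A difference of squares without commutativity: a a - b b = a (a - b) + (a - b) b. Each factor
     is dominated by its scalar counterpart. *)
  rewrite (_ : _ - _ = sqrt_iter y n.+1 * (sqrt_iter y n.+1 - sqrt_iter y n)
      + (sqrt_iter y n.+1 - sqrt_iter y n) * sqrt_iter y n); last first.
    by rewrite mulrBr mulrBl addrA subrK.
  have -> : sqrt_bound n.+2 - sqrt_bound n.+1 =
      2^-1 * (sqrt_bound n.+1 ^+ 2 - sqrt_bound n ^+ 2) by rewrite /=; ring.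
  rewrite cnorm_rsM ger0_norm ?invr_ge0//.
  set a := sqrt_iter y n.+1 in IH *; set b := sqrt_iter y n in IH *.
  have := ler_cnormD (a * (a - b)) ((a - b) * b).
  have := ler_cnormM a (a - b); have := ler_cnormM (a - b) b.
  have := bnd n.+1; have := bnd n; rewrite -/a -/b.
  have := sqrt_bound_incr n; have /andP[] := sqrt_bound_itv n.
  have := cnorm_ge0 a; have := cnorm_ge0 b; have := cnorm_ge0 (a - b); move: IH.
  set p := cnorm a; set q := cnorm b; set d := cnorm (a - b).
  set sn := sqrt_bound n; set sn1 := sqrt_bound n.+1.
  move=> h1 h2 h3 h4 h5 h6 h7 h8 h9 h10 h11 h12.
  have h13 : p * d <= sn1 * (sn1 - sn) by apply: ler_pM.
  have h14 : d * q <= (sn1 - sn) * sn by apply: ler_pM.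
  lra.
have steps n m : (n <= m)%N ->
    cnorm (sqrt_iter y m - sqrt_iter y n) <= sqrt_bound m - sqrt_bound n.
  elim: m => [|m IH]; first by rewrite leqn0 => /eqP->; rewrite subrr cnorm0 subrr.
  rewrite leq_eqVlt => /orP[/eqP->|/IH h]; first by rewrite subrr cnorm0 subrr.
  have := ler_cnormD (sqrt_iter y m.+1 - sqrt_iter y m) (sqrt_iter y m - sqrt_iter y n).
  by rewrite addrA subrK; have := step m; lra.
split=> // e e0.
have b1 p : sqrt_bound p <= 1 by have /andP[] := sqrt_bound_itv p.
have [K HK] := nondecreasing_ncauchy sqrt_bound_incr b1 (e := e / 2) ltac:(lra).
exists K => m m' Km Km'; have := steps _ _ Km; have := steps _ _ Km'.
have := HK _ Km; have := HK _ Km'.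
have := ler_cnormD (sqrt_iter y m - sqrt_iter y K) (sqrt_iter y K - sqrt_iter y m').
by rewrite addrA subrK (cnormB (sqrt_iter y K)); lra.
Qed.

(** The iterates are polynomials in [y] with real coefficients, so their limit [v] is self-adjoint
    and commutes with whatever commutes with [y]; the limit equation y = 2 v - v v says that [1 - v]
    is a square root of [1 - y]. *)
Lemma sqrt_exists y : sa y -> cnorm y <= 1 -> exists v,
  [/\ sa v, cnorm v <= 1, (1 - v) * (1 - v) = 1 - y &
      forall z, z * y = y * z -> z * v = v * z].
Proof.
move=> sy y1; have [bnd cauchy] := sqrt_iter_cauchy y1.
have [v Hv] := ncauchyC_cvg cauchy.
have fix_v : v = rs 2^-1 * (y + v * v).
  apply: (@cvgC_uniq _ _ (fun m => sqrt_iter y m.+1)).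
    by move=> e /Hv[K HK]; exists K => m Km; apply: HK; apply: leqW.
  by apply: cvgCMl; apply: cvgCD; [exact: cvgC_cst | exact: cvgCM].
exists v; split.
- apply: (cvgC_uniq (cvgC_star Hv)); rewrite (_ : (fun m => _) = sqrt_iter y)//.
  apply: funext; elim=> [|m IH] /=; first exact: star0.
  by rewrite star_rsM starD starM IH sy.
- apply: (ncvg_norm_le (@ler_cnormD R A) (@cnormN R A) Hv) => m.
  by apply: le_trans (bnd m) _; have /andP[] := sqrt_bound_itv m.
- have /(congr1 (fun w => rs 2 * w)) := fix_v.
  rewrite mulrA -rsM divff ?pnatr_eq0// rs1 mul1r rs2 => e.
  have -> : y = v + v - v * v by rewrite e addrK.
  rewrite mulrBl mul1r mulrBr mulr1 opprB -[1 - v + _]addrA opprB; congr (_ + _).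
  by rewrite opprD addrCA.
- move=> z zy; apply: cvgC_uniq (cvgCMl z Hv) _.
  rewrite (_ : (fun m => _) = (fun m => sqrt_iter y m * z)); first exact: cvgCMr.
  apply: funext; elim=> [|m IH] /=; first by rewrite mulr0 mul0r.
  rewrite mulrA rs_comm -!mulrA; congr (_ * _); rewrite mulrDr mulrDl zy; congr (_ + _).
  by rewrite mulrA IH -mulrA IH mulrA.
Qed.

(** Positivity without spectra: a self-adjoint [h] has its spectrum in the nonnegative reals iff its
    distance to some scalar [t] is at most [t]. In this form sums of positive elements are positive
    by the triangle inequality. *)
Definition pos h := sa h /\ exists t, cnorm (rs t - h) <= t.

Lemma pos_sa h : pos h -> sa h. Proof. by case. Qed.

Lemma posD h k : pos h -> pos k -> pos (h + k).
Proof.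
move=> [sh [t ht]] [sk [s ks]]; split; first exact: saD.
exists (t + s); rewrite rsD opprD addrACA.
by apply: le_trans (ler_cnormD _ _) _; rewrite lerD.
Qed.

Lemma pos_rsM r h : 0 <= r -> pos h -> pos (rs r * h).
Proof.
move=> r0 [sh [t ht]]; split; first exact: sa_rsM.
by exists (r * t); rewrite rsM -mulrBr cnorm_rsM ger0_norm// ler_wpM2l.
Qed.

Lemma pos_rs r : 0 <= r -> pos (rs r).
Proof. by move=> r0; split; [exact: sa_rs | exists r; rewrite subrr cnorm0]. Qed.

Lemma pos_norm_sub h : sa h -> pos (rs (cnorm h) - h).
Proof.
move=> sh; split; first by apply: saB; first exact: sa_rs.
by exists (cnorm h); rewrite opprB addrC subrK.
Qed.

Lemma pos_rs_ge0 r : pos (rs r) -> 0 <= r.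
Proof. by move=> [_ [t]]; rewrite -rsB cnorm_rs ler_norml => /andP[]; lra. Qed.

(** Rescaling gives h = t (1 - y) with y of norm at most 1, and [sqrt_exists] turns this into the
    square of sqrt t (1 - v). For t <= 0 the bound leaves only h = 0. *)
Lemma pos_sqrt h : pos h -> exists k,
  [/\ pos k, h = k * k & forall z, z * h = h * z -> z * k = k * z].
Proof.
move=> [sh [t ht]]; have := cnorm_ge0 (rs t - h).
have [t0|t0 _] := leP t 0.
  move=> ?; have t00 : t = 0 by lra.
  have -> : h = 0 by apply: cnorm_le0; rewrite -cnormN -sub0r -rs0 -t00; lra.
  exists 0; split; [|by rewrite mulr0|by move=> z; rewrite mul0r mulr0].
  by rewrite -[0]rs0; apply: pos_rs.
pose y := 1 - rs t^-1 * h.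
have sy : sa y by apply: saB; [rewrite -rs1; exact: sa_rs|exact: sa_rsM].
have yE : y = rs t^-1 * (rs t - h) by rewrite mulrBr -rsM mulVf ?lt0r_neq0// rs1.
have y1 : cnorm y <= 1.
  by rewrite yE cnorm_rsM ger0_norm ?invr_ge0 ?(ltW t0)// ler_pdivrMl// mulr1.
have [v [sv v1 vv vC]] := sqrt_exists sy y1.
have sqt : Num.sqrt t * Num.sqrt t = t by rewrite -expr2 sqr_sqrtr// ltW.
exists (rs (Num.sqrt t) * (1 - v)); split.
- split; first by apply: sa_rsM; apply: saB; first by rewrite /sa star1.
  exists (Num.sqrt t); rewrite mulrBr mulr1 opprB addrC subrK cnorm_rsM.
  by rewrite ger0_norm ?sqrtr_ge0// ler_piMr ?sqrtr_ge0.
- rewrite -mulrA [(1 - v) * _]mulrA rs_comm -!mulrA vv mulrA -rsM sqt /y.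
  by rewrite opprB addrC subrK mulrA -rsM divff ?lt0r_neq0// rs1 mul1r.
- move=> z zh; rewrite mulrA rs_comm -!mulrA; congr (_ * _).
  rewrite mulrBr mulrBl mulr1 mul1r vC// /y mulrBr mulrBl mulr1 mul1r.
  by rewrite mulrA rs_comm -!mulrA zh.
Qed.

(** Commutation makes x x + y y equal to [star w * w] for w = x + i y, and x is half of
    [star w + w]. *)
Lemma sq_norm_le x y : sa x -> sa y -> x * y = y * x ->
  cnorm (x * x) <= cnorm (x * x + y * y).
Proof.
move=> sx sy xy; pose i : R[i] := ('i)%C; pose w := x + i *: y.
have ci : i^* = - i by rewrite -[LHS]/(conjc _)/=; apply/eqP; rewrite eq_complex/= oppr0 !eqxx.
have ii : i * i = -1 by rewrite -expr2; exact: sqr_i.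
have sw : star w = x - i *: y by rewrite starD starZ sx sy ci scaleNr.
have -> : x * x + y * y = star w * w.
  rewrite sw mulrDr !mulrBl -!scalerAl -!scalerAr xy scalerA ii scaleN1r opprK.
  by rewrite addrA subrK.
rewrite cnorm_star cnorm_sa_sq// ler_pXn2r ?nnegrE//.
have -> : x = rs 2^-1 * (star w + w).
  by apply: sa_half; rewrite rs2 sw addrACA [- _ + _]addrC subrr addr0.
rewrite cnorm_rsM ger0_norm ?invr_ge0//.
by have := ler_cnormD (star w) w; rewrite cnorm_starE; lra.
Qed.

(** After scaling to k' of norm at most 1, [1 - k' * k'] is a square (1 - v) (1 - v). It and k' k'
    are commuting squares of sum 1, so [sq_norm_le] bounds its norm by 1. *)
Lemma sq_pos_bound k t : sa k -> cnorm (k * k) <= t -> cnorm (rs t - k * k) <= t.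
Proof.
move=> sk kt; have t0 : 0 <= t by apply: le_trans kt; apply: cnorm_ge0.
have [t00|tn0] := eqVneq t 0.
  by rewrite t00 rs0 sub0r cnormN -t00.
have tp : 0 < t by rewrite lt_neqAle eq_sym tn0.
have sqt : (Num.sqrt t)^-1 * (Num.sqrt t)^-1 = t^-1.
  by rewrite -invfM -expr2 sqr_sqrtr.
pose k' := rs (Num.sqrt t)^-1 * k.
have k'k' : k' * k' = rs t^-1 * (k * k).
  by rewrite /k' -mulrA [k * (_ * _)]mulrA rs_comm -!mulrA mulrA -rsM sqt.
have sk' : sa k' by apply: sa_rsM.
have [|v [sv _ vv vC]] := sqrt_exists (sa_sq sk').
  by rewrite k'k' cnorm_rsM ger0_norm ?invr_ge0// ler_pdivrMl// mulr1.
have k'v : k' * v = v * k' by apply: vC; rewrite mulrA.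
have := @sq_norm_le (1 - v) k' _ sk' _; rewrite vv subrK cnorm1.
move=> H; have {}H : cnorm (1 - k' * k') <= 1.
  apply: H; first by apply: saB; first by rewrite /sa star1.
  by rewrite mulrBl mulrBr mul1r mulr1 k'v.
have -> : rs t - k * k = rs t * (1 - k' * k').
  by rewrite k'k' mulrBr mulr1 (mulrA (rs t)) -rsM divff// rs1 mul1r.
by rewrite cnorm_rsM ger0_norm// ler_piMr.
Qed.

Lemma sq_pos k : sa k -> pos (k * k).
Proof.
move=> sk; split; first exact: sa_sq.
by exists (cnorm (k * k)); apply: sq_pos_bound.
Qed.

(** Both [h] and [rs t - h] are squares of commuting self-adjoint elements, and they add up to the
    scalar [t]. *)
Lemma pos_le_norm h t : pos h -> pos (rs t - h) -> cnorm h <= t.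
Proof.
move=> ph pth; have t0 : 0 <= t.
  by apply: pos_rs_ge0; have := posD ph pth; rewrite addrC subrK.
have [k [[sk _] hk _]] := pos_sqrt ph; have [s [[ss _] hs sC]] := pos_sqrt pth.
have ks : k * s = s * k.
  by apply: sC; rewrite mulrBr mulrBl rs_comm hk mulrA.
have := sq_norm_le sk ss ks.
by rewrite -hs -hk addrC subrK cnorm_rs ger0_norm.
Qed.

Lemma pos_norm_mono h k : pos h -> pos (k - h) -> cnorm h <= cnorm k.
Proof.
move=> ph pkh; apply: pos_le_norm => //.
have sk : sa k by have := saD (pos_sa ph) (pos_sa pkh); rewrite addrC subrK.
by have := posD (pos_norm_sub sk) pkh; rewrite addrA subrK.
Qed.

Lemma cnorm_mul_star y : cnorm (y * star y) = cnorm y ^+ 2.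
Proof. by rewrite -{1}[y]starK cnorm_star cnorm_starE. Qed.

(* On [0, s], 4 s^3 - 27 t (s - t)^2 = (3 t - s)^2 (4 s - 3 t). *)
Lemma pos_cubic_le p s : 0 <= s -> pos p -> cnorm p <= s ->
  27 * cnorm ((rs s - p) * p * (rs s - p)) <= 4 * s ^+ 3.
Proof.
move=> s0 pp np; have sp := pos_sa pp.
(* The identities needed concern polynomials in [p]; they are pulled back along [horner_alg p] to a
   commutative ring, where [ring] decides them. *)
have hX : horner_alg p 'X = p by rewrite horner_algX.
have hS c : horner_alg p ((c%:C)%C%:P) = rs c by rewrite horner_algC.
have : pos (rs (4 * s ^+ 3) - rs 27 * ((rs s - p) * p * (rs s - p))).
  (* The factor 4 s - 3 p is positive because p has norm at most s; with its square root [r] the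
     whole difference becomes the square of (3 p - s) r. *)
  have p' : pos (rs (4 * s) - rs 3 * p).
    have h : 0 <= 4 * s - 3 * cnorm p by lra.
    have := posD (pos_rsM (r := 3) ltac:(lra) (pos_norm_sub sp)) (pos_rs h).
    by rewrite mulrBr -rsM addrAC -rsD [3 * _ + _]addrC subrK.
  have [r [[sr _] hr rC]] := pos_sqrt p'.
  have pr : (rs 3 * p - rs s) * r = r * (rs 3 * p - rs s).
    by apply: rC; rewrite -hX -!hS -!(rmorphM, rmorphB) mulrC.
  have s3p : sa (rs 3 * p - rs s) by apply: saB; [exact: sa_rsM | exact: sa_rs].
  have := sq_pos (saM s3p sr pr).
  rewrite -[_ * r * _]mulrA [r * (_ * r)]mulrA -pr -!mulrA -hr mulrA.
  congr pos; rewrite -hX -!hS -!(rmorphM, rmorphB); congr (horner_alg p _).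
  by rewrite !(rmorphM, rmorphXn, rmorph_nat)/=; ring.
move=> H; suff pp' : pos (rs 27 * ((rs s - p) * p * (rs s - p))).
  by have := pos_le_norm pp' H; rewrite cnorm_rsM ger0_norm.
have [r [[sr _] hr rC]] := pos_sqrt pp.
have sB : sa (rs s - p) by apply: saB => //; apply: sa_rs.
have pr : (rs s - p) * r = r * (rs s - p).
  by rewrite mulrBr mulrBl rs_comm hr mulrA.
apply: pos_rsM => //; have := sq_pos (saM sB sr pr).
by rewrite {2}pr -mulrA [r * (r * _)]mulrA -hr mulrA.
Qed.

(** The difference (s + g) g (s + g) - s^2 g = 2 s g^2 + g^3 is positive, and the norm is monotone
    on positive elements. *)
Lemma pos_cubic_ge g s : 0 <= s -> pos g ->
  s ^+ 2 * cnorm g <= cnorm ((rs s + g) * g * (rs s + g)).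
Proof.
move=> s0 pg; have sg := pos_sa pg.
have -> : s ^+ 2 * cnorm g = cnorm (rs (s ^+ 2) * g).
  by rewrite cnorm_rsM ger0_norm ?exprn_ge0.
apply: pos_norm_mono; first by apply: pos_rsM; rewrite ?exprn_ge0.
have [r [[sr _] hr rC]] := pos_sqrt pg.
have rg : r * g = g * r by rewrite hr mulrA.
have := posD (pos_rsM (r := 2 * s) ltac:(lra) (sq_pos sg)) (sq_pos (saM sr sg rg)).
rewrite {1}rg -[g * r * _]mulrA [r * (r * _)]mulrA -hr; congr pos.
have hX : horner_alg g 'X = g by rewrite horner_algX.
have hS c : horner_alg g ((c%:C)%C%:P) = rs c by rewrite horner_algC.
rewrite -hX -!hS -!(rmorphM, rmorphB, rmorphD); congr (horner_alg g _).
by rewrite !(rmorphM, rmorphXn, rmorph_nat)/=; ring.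
Qed.

(** With s the squared norm of y and W = (s - p) y = y (s + g), the elements [W * star W] and
    [star W * W] have the same norm. The first is (s - p) p (s - p), of norm at most 4 s^3 / 27; the
    second is - (s + g) g (s + g), of norm at least s^3. Hence s = 0. This replaces the usual
    comparison of the spectra of [y * star y] and [star y * y]. *)
Lemma pos_antisym_star y : pos (- (star y * y)) -> pos (y * star y) -> y = 0.
Proof.
set g := - _; set p := y * star y => pg pp.
pose s := cnorm y ^+ 2.
have np : cnorm p = s by exact: cnorm_mul_star.
have ng : cnorm g = s by rewrite cnormN cnorm_star.
have s0 : 0 <= s by rewrite exprn_ge0.
have py : p * y = - (y * g) by rewrite /p /g mulrN opprK mulrA.
have eqn : (rs s - p) * y = y * (rs s + g).
  by rewrite mulrBl py opprK -rs_comm mulrDr.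
have sp := pos_sa pp; have sg := pos_sa pg.
have n1 : cnorm ((rs s - p) * p * (rs s - p)) = cnorm ((rs s + g) * g * (rs s + g)).
  pose W := (rs s - p) * y.
  have -> : (rs s - p) * p * (rs s - p) = W * star W.
    by rewrite /W starM starB star_rs sp !mulrA.
  rewrite cnorm_mul_star -cnorm_star /W eqn starM starD star_rs sg.
  by rewrite mulrA -[_ * star y * y]mulrA -[star y * y]opprK -/g mulrN mulNr cnormN.
have := pos_cubic_ge s0 pg; have := pos_cubic_le s0 pp; rewrite np lexx ng n1.
move=> /(_ isT) H H2.
have s3 : s ^+ 3 <= 0 by move: H H2; rewrite !exprS expr0 mulr1; lra.
have : s ^+ 3 == 0 by apply/eqP/le_anti; rewrite s3 exprn_ge0.
by rewrite !expf_eq0 => /eqP/cnorm0_eq0.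
Qed.

(** Let a be the square root of h h, so that k = a - h is twice the negative part of h, and put y =
    x k. Then [star y * y] = k h k = - a k k is minus the square of b k, where b b = a. The squares
    of [c] and [d], the doubled real and imaginary parts of y, express [y * star y] as a sum of
    positive terms. So y = 0 by [pos_antisym_star], which forces k = 0 and h = a. *)
Theorem pos_star_mul x : pos (star x * x).
Proof.
set h := star x * x; have sh : sa h by apply: sa_sM.
have [a [pa ha aC]] := pos_sqrt (sq_pos sh).
have sa_a := pos_sa pa.
have hC : h * a = a * h by apply: aC; rewrite mulrA.
pose k := a - h; have sk : sa k by apply: saB.
have ak : a * k = k * a by rewrite /k mulrBr mulrBl hC.
have kk : k * k = rs 2 * (a * k).
  by rewrite /k rs2 !(mulrBr, mulrBl) -ha hC opprB.
have [b [[sb _] hb bC]] := pos_sqrt pa.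
have kb : k * b = b * k by apply: bC.
have bkbk : b * k * (b * k) = a * k * k by rewrite -mulrA [k * _]mulrA kb hb !mulrA.
have khk : k * h * k = - (b * k * (b * k)).
  have -> : h = a - k by rewrite /k opprB addrC subrK.
  rewrite (mulrBr k a k) (mulrBl k (k * a)) -ak kk bkbk rs2 (mulrDl (a * k)) opprD.
  by rewrite addrA subrr add0r.
pose y := x * k.
have yy : star y * y = - (b * k * (b * k)).
  by rewrite -khk /y starM sk -!mulrA (mulrA (star x)).
have pbk : pos (b * k * (b * k)) by apply: sq_pos; apply: saM.
have pyy : pos (y * star y).
  pose i : R[i] := ('i)%C; pose c := y + star y; pose d := - i *: (y - star y) : A.
  have sc : sa c by rewrite /sa starD starK addrC.
  have ci : (- i)^* = i.
    by rewrite -[LHS]/(conjc _)/=; apply/eqP; rewrite eq_complex/= oppr0 opprK !eqxx.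
  have ii : (- i) * (- i) = -1 by rewrite mulrNN -expr2; exact: sqr_i.
  have sd : sa d by rewrite /sa /d starZ ci starB starK scaleNr -scalerN opprB.
  have := posD (posD (sq_pos sc) (sq_pos sd)) (pos_rsM (r := 2) ltac:(lra) pbk).
  move=> /(pos_rsM (r := 2^-1) ltac:(lra)); congr pos; symmetry; apply: sa_half.
  have dd : d * d = - ((y - star y) * (y - star y)).
    by rewrite /d -scalerAl -scalerAr scalerA ii scaleN1r.
  have cd : c * c + d * d = rs 2 * (y * star y) + rs 2 * (star y * y).
    rewrite dd /c (mulrDl y) (mulrBl (y - star y)) opprB [_ - y * _]addrC addrACA.
    rewrite -(mulrBr y) -(mulrDr (star y)) !rs2 -(mulrDr y) -(mulrDr (star y)); congr (y * _ + star y * _).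
      by rewrite opprB addrC addrA subrK.
    by rewrite addrACA subrr addr0.
  by rewrite cd -addrA -mulrDr yy addNr mulr0 addr0.
have y0 : y = 0 by apply: pos_antisym_star; rewrite ?yy ?opprK.
have bk0 : b * k = 0.
  by apply: sa_sq_eq0; [exact: saM | rewrite -[LHS]opprK -yy y0 mulr0 oppr0].
have k0 : k = 0 by apply: sa_sq_eq0 => //; rewrite kk hb -mulrA bk0 !mulr0.
by have /eqP := k0; rewrite /k subr_eq0 => /eqP <-.
Qed.
End Positivity.

(** * The Hahn-Banach theorem for real functionals on a complex vector space *)

Section HahnBanach.
Context {R : realType} {V : lmodType R[i]} (p : V -> R) (v0 : V).
Local Notation "r *r: x" := ((r%:C)%C *: x) (at level 40).
Hypothesis pD : forall x y, p (x + y) <= p x + p y.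
Hypothesis pZ : forall r x, 0 <= r -> p (r *r: x) = r * p x.

Let p0 : p 0 = 0.
Proof. by rewrite -(scale0r (0 : V)) (@pZ 0)// mul0r. Qed.

(** Partial functionals are kept as graphs; domination by the sublinear [p], used at the vector 0,
    makes such a graph single-valued. *)
Definition dominated_graph (G : set (V * R)) :=
  (forall r x y a b, G (x, a) -> G (y, b) -> G (r *r: x + y, r * a + b)) /\
  (forall x a, G (x, a) -> a <= p x).

Let G0 : set (V * R) := [set xa | exists r, xa = (r *r: v0, r * p v0)].

Let G0_dominated : dominated_graph G0.
Proof.
split=> [r x y a b [s [-> ->]] [t [-> ->]]|x a [r [-> ->]]].
  exists (r * s + t); congr (_, _); last by ring.
  by rewrite scalerA -rmorphM -scalerDl -rmorphD.
have [r0|r0] := leP 0 r; first by rewrite pZ.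
have := pD (r *r: v0) ((- r) *r: v0).
rewrite -scalerDl -rmorphD subrr scale0r p0 [p ((- r) *r: _)]pZ; lra.
Qed.

Lemma dominated_graph_fun G x a b : dominated_graph G ->
  G (x, a) -> G (x, b) -> a = b.
Proof.
move=> [lG dG]; have H c d : G (x, c) -> G (x, d) -> c <= d.
  move=> xc xd; have := lG (-1) _ _ _ _ xd xc.
  by rewrite rmorphN rmorph1 scaleN1r addNr => /dG; rewrite p0; lra.
by move=> xa xb; apply: le_anti; rewrite !H.
Qed.

(** Sublinearity gives a - p (x - x0) <= p (y + x0) - b on the graph, so a value at [x0] fits in
    between; the supremum of the left sides is taken. *)
Let dominated_extend G x0 : dominated_graph G -> G (0, 0) ->
  exists c, dominated_graph
    [set xa | exists x a r, G (x, a) /\ xa = (x + r *r: x0, a + r * c)].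
Proof.
move=> [lG dG] G00; pose S := [set s | exists x a, G (x, a) /\ s = a - p (x - x0)].
have SU y b : G (y, b) -> ubound S (p (y + x0) - b).
  move=> yb _ [x [a [xa ->]]]; have := lG 1 _ _ _ _ xa yb.
  rewrite rmorph1 scale1r mul1r => /dG; have := pD (x - x0) (y + x0).
  by rewrite addrACA addNr addr0; lra.
have hS : has_sup S.
  split; first by exists (0 - p (0 - x0)), 0, 0.
  by exists (p (0 + x0) - 0); apply: SU.
have cub x a : G (x, a) -> a - p (x - x0) <= sup S.
  by move=> xa; apply: (sup_upper_bound hS); exists x, a.
have clb y b : G (y, b) -> sup S <= p (y + x0) - b.
  by move=> yb; apply: ge_sup; [case: hS | exact: SU].
exists (sup S); split=> [r _ _ _ _ [x [a [s [xa [-> ->]]]]] [y [b [t [yb [-> ->]]]]]|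
    _ _ [x [a [r [xa [-> ->]]]]]].
  exists (r *r: x + y), (r * a + b), (r * s + t); split; first exact: lG.
  congr (_, _); last by ring.
  by rewrite scalerDr scalerA -rmorphM addrACA -scalerDl -rmorphD.
have sc s : G (s *r: x, s * a) by have := lG s _ _ _ _ xa G00; rewrite !addr0.
have [r0|r0|->] := ltgtP r 0; last first.
- by rewrite scale0r mul0r !addr0 dG.
- have := clb _ _ (sc r^-1).
  have -> : r^-1 *r: x + x0 = r^-1 *r: (x + r *r: x0).
    by rewrite scalerDr scalerA -rmorphM mulVf ?gt_eqF// rmorph1 scale1r.
  rewrite pZ ?invr_ge0 ?(ltW r0) ?(ltW nr0)// -mulrBr => h.
  have := ler_wpM2l (ltW r0) h; rewrite mulrA mulfV ?gt_eqF// mul1r; lra.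
- have nr0 : 0 < - r by lra.
  have := cub _ _ (sc (- r)^-1).
  have -> : (- r)^-1 *r: x - x0 = (- r)^-1 *r: (x + r *r: x0).
    have e : (- r)^-1 * r = -1 by rewrite invrN mulNr mulVf ?lt_eqF.
    by rewrite scalerDr scalerA -rmorphM e rmorphN rmorph1 scaleN1r.
  rewrite pZ ?invr_ge0 ?(ltW r0) ?(ltW nr0)// -mulrBr => h.
  have := ler_wpM2l (ltW nr0) h; rewrite mulrA mulfV ?gt_eqF// mul1r; lra.
Qed.

Theorem hahn_banach : exists f : V -> R,
  [/\ forall x y, f (x + y) = f x + f y, forall r x, f (r *r: x) = r * f x,
      forall x, f x <= p x & f v0 = p v0].
Proof.
(* The property is imposed on the union with [G0], so that the empty chain is no exception and the
   members of a chain need not contain [G0]. *)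
have [|A [[lA dA] maxA]] :=
    @Zorn_bigcup _ [set G | dominated_graph (G `|` G0)].
  move=> F FP Ftot.
  have both X Y xa yb : F X -> F Y -> (X `|` G0) xa -> (Y `|` G0) yb ->
      exists2 Z, F Z & (Z `|` G0) xa /\ (Z `|` G0) yb.
    move=> FX FY xX yY; have [XY|YX] := Ftot _ _ FX FY.
      by exists Y => //; split=> //; case: xX; [left; apply: XY|right].
    by exists X => //; split=> //; case: yY; [left; apply: YX|right].
  have memU Z xa : F Z -> (Z `|` G0) xa -> ((\bigcup_(X in F) X) `|` G0) xa.
    by move=> FZ [?|?]; [left; exists Z|right].
  have one xa : ((\bigcup_(X in F) X) `|` G0) xa -> G0 xa \/
      exists2 Z, F Z & (Z `|` G0) xa.
    by case=> [[Z FZ Zx]|]; [right; exists Z => //; left|left].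
  split=> [r x y a b xa yb|x a].
    have [x0|[X FX Xx]] := one _ xa; have [y0|[Y FY Yy]] := one _ yb.
    - by right; apply: G0_dominated.1.
    - by apply: (memU _ _ FY); apply: (FP _ FY).1 => //; right.
    - by apply: (memU _ _ FX); apply: (FP _ FX).1 => //; right.
    - have [Z FZ [Zx Zy]] := both _ _ _ _ FX FY Xx Yy.
      by apply: (memU _ _ FZ); apply: (FP _ FZ).1.
  move=> /one[|[X FX]]; first exact: G0_dominated.2.
  exact: (FP _ FX).2.
set G := A `|` G0 in lA dA; have dG : dominated_graph G by [].
have G00 : G (0, 0) by right; exists 0; rewrite scale0r mul0r.
have total x0 : exists a, G (x0, a).
  apply: contrapT => /forallNP nx0; have [c dc] := dominated_extend x0 dG G00.
  set G' := [set _ | _] in dc.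
  have GG' : G `<=` G'.
    by move=> [x a] xa; exists x, a, 0; rewrite scale0r mul0r !addr0.
  have G'x0 : G' (x0, c) by exists 0, 0, 1; rewrite rmorph1 scale1r mul1r !add0r.
  apply: (maxA G'); first split.
  - by move=> xa Axa; apply: GG'; left.
  - by move=> /(_ _ G'x0) h; apply: (nx0 c); left.
  - by rewrite /= (_ : _ `|` _ = G')//; apply/setUidl => xa xa0; apply: GG'; right.
have [f Hf] := choice total; exists f; split=> [x y|r x|x|].
- apply: (dominated_graph_fun dG (Hf _)).
  by have := lA 1 _ _ _ _ (Hf x) (Hf y); rewrite rmorph1 scale1r mul1r.
- apply: (dominated_graph_fun dG (Hf _)).
  by have := lA r _ _ _ _ (Hf x) G00; rewrite !addr0.
- exact: dA.
- apply: (dominated_graph_fun dG (Hf _)); right.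
  by exists 1; rewrite rmorph1 scale1r mul1r.
Qed.

End HahnBanach.

(** * States that attain the norm of a given element *)

Section States.
Context {R : realType} {A : cstarAlgType R}.
Implicit Types (x y h : A) (r t : R).

Definition re x := rs 2^-1 * (x + star x).
Definition pos_above x := [set t | pos (rs t - re x)].
(** The top of the spectrum of the real part of x. A real functional below it is nonnegative on
    every positive [h], because [max_spec (- h) <= 0]. *)
Definition max_spec x : R := inf (pos_above x).

Lemma re_sa x : sa x -> re x = x.
Proof. by move=> sx; rewrite /re sx -rs2 mulrA -rsM mulVf ?pnatr_eq0// rs1 mul1r. Qed.
Lemma sa_re x : sa (re x).
Proof. by apply: sa_rsM; rewrite /sa starD starK addrC. Qed.
Lemma reD x y : re (x + y) = re x + re y.
Proof. by rewrite /re starD addrACA mulrDr. Qed.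
Lemma re_rsM r x : re (rs r * x) = rs r * re x.
Proof. by rewrite /re star_rsM -mulrDr !mulrA -!rsM mulrC. Qed.

Lemma pos_above_has_inf x : has_inf (pos_above x).
Proof.
split; first by exists (cnorm (re x)); apply: pos_norm_sub; exact: sa_re.
exists (- cnorm (re x)) => t /= pt.
have sr := sa_re x; have := posD pt (pos_norm_sub (saN sr)).
by rewrite opprK addrACA addNr addr0 -rsD cnormN => /pos_rs_ge0; lra.
Qed.

Lemma max_spec_le x t : pos (rs t - re x) -> max_spec x <= t.
Proof. by move=> pt; apply: (inf_lbound (pos_above_has_inf x).2). Qed.

Lemma max_spec_ge x c : (forall t, pos (rs t - re x) -> c <= t) -> c <= max_spec x.
Proof. by move=> H; apply: lb_le_inf; [case: (pos_above_has_inf x) | exact: H]. Qed.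

Lemma max_specD x y : max_spec (x + y) <= max_spec x + max_spec y.
Proof.
rewrite -lerBlDr; apply: max_spec_ge => t pt.
rewrite lerBlDr [t + _]addrC -lerBlDr; apply: max_spec_ge => s ps.
by rewrite lerBlDr; apply: max_spec_le; rewrite reD [s + t]addrC rsD opprD addrACA; apply: posD.
Qed.

Lemma max_specZ r x : 0 <= r -> max_spec ((r%:C)%C *: x) = r * max_spec x.
Proof.
rewrite le_eqVlt => /orP[/eqP<-|r0].
  rewrite mul0r scale0r; have r0 : re 0 = 0 :> A by rewrite re_sa// /sa star0.
  apply: le_anti; rewrite max_spec_le ?r0 ?subr0; last exact: pos_rs.
  by apply: max_spec_ge => t; rewrite r0 subr0; apply: pos_rs_ge0.
have le s z : 0 < s -> max_spec ((s%:C)%C *: z) <= s * max_spec z.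
  move=> s0; rewrite -ler_pdivrMl//; apply: max_spec_ge => t pt.
  rewrite ler_pdivrMl//; apply: max_spec_le.
  by rewrite -rsE re_rsM rsM -mulrBr; apply: pos_rsM => //; apply: ltW.
apply: le_anti; rewrite le//= -ler_pdivlMl//.
have ri : 0 < r^-1 by rewrite invr_gt0.
have := le r^-1 ((r%:C)%C *: x) ri.
by rewrite scalerA -rmorphM mulVf ?gt_eqF// rmorph1 scale1r.
Qed.

Lemma max_spec_pos h : pos h -> max_spec h = cnorm h.
Proof.
move=> ph; have sh := pos_sa ph; apply: le_anti; rewrite max_spec_le/=; last first.
  by rewrite re_sa//; apply: pos_norm_sub.
by apply: max_spec_ge => t; rewrite re_sa// => /(pos_le_norm ph).
Qed.

(** Hahn-Banach is applied to [max_spec] at [star a * a], where it equals the norm. Domination makes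
    [f] positive, unital and blind to imaginary parts, and f x - i f (i x) is its complex-linear
    form. *)
Theorem state_exists (a : A) : exists phi : A -> R[i],
  [/\ forall (c : R[i]) x y, phi (c *: x + y) = c * phi x + phi y,
      forall x, 0 <= phi (star x * x),
      forall x, phi (star x) = (phi x)^*,
      phi 1 = 1 & phi (star a * a) = ((cnorm a ^+ 2)%:C)%C].
Proof.
have [f [fD fZ fle fa]] := hahn_banach (star a * a) max_specD max_specZ.
have pos0 : pos (0 : A) by rewrite -[0]rs0; apply: pos_rs.
have f0 : f 0 = 0 by have := fD 0 0; rewrite addr0; lra.
have fN x : f (- x) = - f x.
  by apply: (@addrI _ (f x)); rewrite -fD !subrr.
have f_pos h : pos h -> 0 <= f h.
  move=> ph; have := fle (- h); rewrite fN.
  have := @max_spec_le (- h) 0; rewrite re_sa; last exact: saN (pos_sa ph).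
  by rewrite rs0 add0r opprK => /(_ ph); lra.
have f_re x : f x = f (re x).
  have rx : re (x - re x) = 0.
    have e : re (- re x) = - re x by apply: re_sa; apply: saN; apply: sa_re.
    by rewrite reD e subrr.
  have rx' : re (- (x - re x)) = 0 by rewrite -mulN1r -[in LHS]rs1 -rsN re_rsM rx mulr0.
  have := fle (x - re x); have := fle (- (x - re x)).
  have := @max_spec_le (x - re x) 0; have := @max_spec_le (- (x - re x)) 0.
  rewrite rx rx' rs0 subr0 => /(_ pos0) h1 /(_ pos0) h2.
  by rewrite fN fD fN; lra.
pose i : R[i] := ('i)%C.
have ii : i * i = -1 by rewrite -expr2; exact: sqr_i.
have ci : i^* = - i by rewrite -[LHS]/(conjc _)/=; apply/eqP; rewrite eq_complex/= oppr0 !eqxx.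
have fs x : f (star x) = f x by rewrite f_re [RHS]f_re /re starK addrC.
pose phi x := (f x +i* (- f (i *: x)))%C; exists phi; split.
- move=> c x y.
  have phiD u v : phi (u + v) = phi u + phi v.
    by rewrite /phi scalerDr !fD opprD; apply/eqP; rewrite eq_complex /= !eqxx.
  have phiR r u : phi ((r%:C)%C *: u) = (r%:C)%C * phi u.
    rewrite /phi [i *: _]scalerA mulrC -scalerA !fZ -mulrN.
    by apply/eqP; rewrite eq_complex /= !mul0r subr0 addr0 !eqxx.
  have phii u : phi (i *: u) = i * phi u.
    rewrite /phi scalerA ii scaleN1r fN opprK.
    by apply/eqP; rewrite eq_complex /= !mul0r !mul1r !add0r opprK !eqxx.
  rewrite phiD; congr (_ + _); rewrite [c]complexE scalerDl phiD -scalerA phii phiR phiR.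
  by rewrite mulrDl mulrA.
- move=> x; have sx := sa_sM x; rewrite /phi.
  have -> : f (i *: (star x * x)) = 0.
    by rewrite f_re /re starZ ci sx scaleNr subrr mulr0.
  by rewrite oppr0 (_ : (_ +i* _)%C = ((f (star x * x))%:C)%C)// lecR f_pos//; apply: pos_star_mul.
- move=> x; rewrite /phi fs -[RHS]/(conjc _)/= opprK.
  have -> : i *: star x = - star (i *: x) by rewrite starZ ci scaleNr opprK.
  by rewrite fN opprK fs.
- have p1 : pos (1 : A) by rewrite -rs1; apply: pos_rs.
  have s1 := pos_sa p1.
  have f1 : f 1 = 1.
    have := fle 1; rewrite max_spec_pos// cnorm1; have := fle (-1); rewrite fN.
    have := @max_spec_le (-1) (-1); rewrite re_sa ?rsN ?rs1 ?subrr; last exact: saN.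
    by move=> /(_ pos0); lra.
  rewrite /phi f1; have -> : f (i *: 1) = 0.
    by rewrite f_re /re starZ ci s1 scaleNr subrr mulr0.
  by rewrite oppr0.
- have sx := sa_sM a; rewrite /phi fa max_spec_pos ?cnorm_star; last exact: pos_star_mul.
  have -> : f (i *: (star a * a)) = 0.
    by rewrite f_re /re starZ ci sx scaleNr subrr mulr0.
  by rewrite oppr0.
Qed.

End States.

(** * Hilbert space completion *)

Section ComplexFacts.
Context {R : realType}.
Implicit Types (c d : R[i]).

Lemma ge0_complex c : 0 <= c -> c = ((complex.Re c)%:C)%C /\ 0 <= complex.Re c.
Proof. by case: c => a b; rewrite lecE /= => /andP[/eqP-> ?]. Qed.

Lemma Re_ge0 c : 0 <= c -> 0 <= complex.Re c.
Proof. by move=> /ge0_complex[]. Qed.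

Lemma rcM (a b : R) : ((a * b)%:C)%C = (a%:C)%C * (b%:C)%C :> R[i].
Proof. exact: rmorphM. Qed.
Lemma rcD (a b : R) : ((a + b)%:C)%C = (a%:C)%C + (b%:C)%C :> R[i].
Proof. exact: rmorphD. Qed.
Lemma rcB (a b : R) : ((a - b)%:C)%C = (a%:C)%C - (b%:C)%C :> R[i].
Proof. exact: rmorphB. Qed.
Lemma conjCM c d : (c * d)^* = c^* * d^*. Proof. exact: rmorphM. Qed.
Lemma conjCD c d : (c + d)^* = c^* + d^*. Proof. exact: rmorphD. Qed.
Lemma conjCN c : (- c)^* = - c^*. Proof. exact: rmorphN. Qed.

Lemma mulc_conj c : c * c^* = ((normc c ^+ 2)%:C)%C.
Proof.
case: c => a b; rewrite -[_^*]/(conjc _) /= sqr_sqrtr ?addr_ge0 ?sqr_ge0//.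
by apply/eqP; rewrite eq_complex /= mulrN opprK -!expr2 eqxx mulrN mulrC addNr eqxx.
Qed.

Lemma normc_le_Re c : complex.Re c <= normc c.
Proof. exact: le_trans (ler_norm _) (ler_ReIm_normc c).1. Qed.

Lemma cvgc_cauchy (x : nat -> R[i]) : ncauchy (@normc R) x ->
  exists l, ncvg (@normc R) x l.
Proof.
move=> cx; have H (f : {additive R[i] -> R}) : (forall c, `|f c| <= normc c) ->
    exists l : R, ncvg (@Num.norm _ R) (f \o x) l.
  move=> fle; have [e e0|l xl] := @cauchy_seq_cvg R (f \o x).
    have [K HK] := cx e e0; exists ([set m | (K <= m)%N], [set m | (K <= m)%N]) => /=.
      by split; exists K.
    move=> [m m'] [/= ? ?]; rewrite -raddfB.
    by apply: le_lt_trans (fle _) _; apply: HK.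
  exists l => e e0; move/cvgrPdist_lt: xl => /(_ e e0)[K _ HK]; exists K => m Km.
  by have := HK m Km; rewrite /= distrC.
have [a ha] := H (@complex.Re R) (fun c => (ler_ReIm_normc c).1).
have [b hb] := H (@complex.Im R) (fun c => (ler_ReIm_normc c).2).
exists (a +i* b)%C => e e0; have [K HK] := ha (e / 2) ltac:(lra).
have [K' HK'] := hb (e / 2) ltac:(lra).
exists (maxn K K') => m; rewrite geq_max => /andP[/HK h1 /HK' h2].
apply: le_lt_trans (ler_normc_ReIm _) _; rewrite !raddfB /=.
by move: h1 h2 => /=; lra.
Qed.

Definition cvgc := ncvg (@normc R).
Let n0 : normc (0 : R[i]) = 0. Proof. exact: normc0. Qed.

Lemma cvgc_cst c : cvgc (fun=> c) c. Proof. exact: ncvg_cst n0 _. Qed.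
Lemma cvgcD x y c d : cvgc x c -> cvgc y d -> cvgc (fun m => x m + y m) (c + d).
Proof. exact: (ncvgD (@le_normcD R)). Qed.
Lemma cvgcM x c d : cvgc x c -> cvgc (fun m => d * x m) (d * c).
Proof.
apply: (ncvg_comp (f := fun v => d * v) (normc_ge0 d)) => y.
by rewrite -mulrBr normcM.
Qed.
Lemma cvgc_conj x c : cvgc x c -> cvgc (fun m => (x m)^*) (c^*).
Proof.
by apply: (ncvg_comp ler01) => y; rewrite -rmorphB normc_conj mul1r.
Qed.
Lemma cvgc_uniq x c d : cvgc x c -> cvgc x d -> c = d.
Proof.
move=> xc xd; apply/eqP; rewrite -subr_eq0; apply/eqP/eq0_normc.
exact: (ncvg_uniq0 n0 (@le_normcD R) (@normcN R) xc xd).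
Qed.
Lemma cvgc_near (x y : nat -> R[i]) c : cvgc x c -> cvgc (fun m => y m - x m) 0 -> cvgc y c.
Proof.
move=> xc yx; have := cvgcD yx xc; rewrite add0r; congr ncvg.
by apply: funext => m; rewrite subrK.
Qed.
Lemma cvgc_ge0 x c : cvgc x c -> (forall m, 0 <= x m) -> 0 <= c.
Proof.
case: c => a b xc x0; rewrite lecE /=; apply/andP; split.
  rewrite -normr_le0; apply/ler_addgt0Pr => e /xc[K /(_ _ (leqnn K))].
  have [xr _] := ge0_complex (x0 K); rewrite xr; have := (ler_ReIm_normc ((complex.Re (x K))%:C%C - (a +i* b)%C)).2.
  by rewrite /= sub0r normrN add0r; lra.
rewrite leNgt; apply/negP => a0; have [K /(_ _ (leqnn K))] := xc (- a) ltac:(lra).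
have := Re_ge0 (x0 K); have := normc_le_Re (x K - (a +i* b)%C).
by rewrite raddfB /=; lra.
Qed.
End ComplexFacts.

Section SemiInnerProduct.
Context {R : realType} {E : lmodType R[i]} (g : E -> E -> R[i]).
Implicit Types x y z : E.

Definition semi_ip := [/\ forall c x y z, g (c *: x + y) z = c * g x z + g y z,
  forall x y, g y x = (g x y)^* & forall x, 0 <= g x x].

Definition ipnorm x : R := Num.sqrt (complex.Re (g x x)).

Hypothesis gP : semi_ip.
Let gL := let: And3 h _ _ := gP in h.
Let gH := let: And3 _ h _ := gP in h.
Let g0 := let: And3 _ _ h := gP in h.

Lemma ipDl x y z : g (x + y) z = g x z + g y z.
Proof. by rewrite -{1}[x]scale1r gL mul1r. Qed.
Lemma ip0l z : g 0 z = 0.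
Proof. by apply: (@addrI _ (g 0 z)); rewrite -ipDl !addr0. Qed.
Lemma ipZl c x z : g (c *: x) z = c * g x z.
Proof. by rewrite -[c *: x]addr0 gL ip0l addr0. Qed.
Lemma ipNl x z : g (- x) z = - g x z.
Proof. by rewrite -scaleN1r ipZl mulN1r. Qed.
Lemma ipBl x y z : g (x - y) z = g x z - g y z.
Proof. by rewrite ipDl ipNl. Qed.
Lemma ipDr x y z : g z (x + y) = g z x + g z y.
Proof. by rewrite [LHS]gH ipDl conjCD [g z x]gH [g z y]gH. Qed.
Lemma ip0r z : g z 0 = 0. Proof. by rewrite gH ip0l rmorph0. Qed.
Lemma ipZr c x z : g z (c *: x) = c^* * g z x.
Proof. by rewrite [LHS]gH ipZl conjCM [g z x]gH. Qed.
Lemma ipNr x z : g z (- x) = - g z x.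
Proof. by rewrite [LHS]gH ipNl conjCN [g z x]gH. Qed.
Lemma ipBr x y z : g z (x - y) = g z x - g z y.
Proof. by rewrite ipDr ipNr. Qed.

Lemma ipnormE x : g x x = ((ipnorm x ^+ 2)%:C)%C.
Proof.
by have [e r0] := ge0_complex (g0 x); rewrite [LHS]e sqr_sqrtr.
Qed.
Lemma ipnorm_ge0 x : 0 <= ipnorm x. Proof. exact: sqrtr_ge0. Qed.

(** Positivity of the form at x - t <x, y> y for real t, with t = 1 / |y|^2. The form may be
    degenerate, so |y| = 0 is a separate case. *)
Lemma ip_cauchy_schwarz x y : normc (g x y) <= ipnorm x * ipnorm y.
Proof.
have key (t : R) : 0 <= ipnorm x ^+ 2 - 2 * t * normc (g x y) ^+ 2
    + t ^+ 2 * normc (g x y) ^+ 2 * ipnorm y ^+ 2.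
  have := g0 (x - ((t%:C)%C * g x y) *: y); rewrite ipBl !ipBr !ipZl !ipZr.
  rewrite [g y x]gH conjCM conjC_rc !ipnormE.
  have -> : (t%:C)%C * (g x y)^* * g x y = ((t * normc (g x y) ^+ 2)%:C)%C.
    by rewrite rcM -mulc_conj -mulrA (mulrC _^*).
  have -> : (t%:C)%C * g x y * (g x y)^* = ((t * normc (g x y) ^+ 2)%:C)%C.
    by rewrite rcM -mulc_conj mulrA.
  have -> : (t%:C)%C * g x y * ((t%:C)%C * (g x y)^* * ((ipnorm y ^+ 2)%:C)%C) =
      ((t ^+ 2 * normc (g x y) ^+ 2 * ipnorm y ^+ 2)%:C)%C.
    by rewrite 2!rcM -mulc_conj [t ^+ 2]expr2 rcM; ring.
  rewrite -!rcB ler0c; lra.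
have [y0|y0] := eqVneq (ipnorm y) 0; last first.
  have yp : 0 < ipnorm y by rewrite lt_neqAle eq_sym y0 ipnorm_ge0.
  have := key (ipnorm y ^- 2).
  have -> : (ipnorm y ^- 2) ^+ 2 * normc (g x y) ^+ 2 * ipnorm y ^+ 2 =
     ipnorm y ^- 2 * normc (g x y) ^+ 2 by field.
  rewrite -mulrA => h; have {}h : ipnorm y ^- 2 * normc (g x y) ^+ 2 <= ipnorm x ^+ 2 by lra.
  rewrite ler_pdivrMl ?exprn_gt0// in h.
  by rewrite -ler_sqr ?nnegrE ?mulr_ge0 ?normc_ge0 ?ipnorm_ge0// exprMn mulrC.
(* For |y| = 0 the inequality is linear in t; this t turns it into |x|^2 - 2 (|x|^2 + 1) >= 0, which
   is absurd unless <x, y> = 0. *)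
rewrite y0 mulr0; have := key ((ipnorm x ^+ 2 + 1) / normc (g x y) ^+ 2).
rewrite y0 expr0n mulr0 addr0 => h.
have [->//|gn0] := eqVneq (normc (g x y)) 0.
have e : (ipnorm x ^+ 2 + 1) / normc (g x y) ^+ 2 * normc (g x y) ^+ 2 = ipnorm x ^+ 2 + 1.
  by rewrite divfK// expf_neq0.
by move: h; rewrite -mulrA e; have := sqr_ge0 (ipnorm x); lra.
Qed.

Lemma ipnorm0 : ipnorm 0 = 0. Proof. by rewrite /ipnorm ip0l sqrtr0. Qed.
Lemma ipnormZ c x : ipnorm (c *: x) = normc c * ipnorm x.
Proof.
rewrite {1}/ipnorm ipZl ipZr mulrA mulc_conj ipnormE -rcM /=.
by rewrite -exprMn sqrtr_sqr ger0_norm ?mulr_ge0 ?normc_ge0 ?ipnorm_ge0.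
Qed.
Lemma ipnormN x : ipnorm (- x) = ipnorm x.
Proof. by rewrite /ipnorm ipNl ipNr opprK. Qed.
Lemma ipnormD x y : ipnorm (x + y) <= ipnorm x + ipnorm y.
Proof.
rewrite -ler_sqr ?nnegrE ?addr_ge0 ?ipnorm_ge0//.
have e : ipnorm (x + y) ^+ 2 = complex.Re (g (x + y) (x + y)) by rewrite ipnormE.
rewrite e ipDl !ipDr !raddfD /= !ipnormE /=.
have := ip_cauchy_schwarz x y; have := normc_le_Re (g x y).
have := normc_le_Re (g y x); rewrite (gH x y) normc_conj; lra.
Qed.

End SemiInnerProduct.

Record preHilbert (R : realType) := PreHilbert {
  ph_mod : lmodType R[i];
  ph_form : ph_mod -> ph_mod -> R[i];
  ph_axiom : semi_ip ph_form }.

(* The completion is realised inside the functions on E: the limit of a Cauchy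
   sequence x is the function y |-> lim g (x m) y. *)
Section Completion.
Context {R : realType} (P : preHilbert R).
Local Notation E := (ph_mod P).
Local Notation g := (@ph_form R P).
Local Notation n := (ipnorm g).
Let gP := ph_axiom P.
Implicit Types (x y z : nat -> E) (phi psi : E -> R[i]^o).

Definition represents x phi :=
  ncauchy n x /\ forall v, cvgc (fun m => g (x m) v) (phi v).

Let nge0 u : 0 <= n u := ipnorm_ge0 g u.

(** Split <z m, z m> as <z m, z K> + <z m, z m - z K>: the first term is small by weak convergence,
    the second because z is Cauchy and bounded. Thus the limit functional determines a Cauchy
    sequence up to null sequences. *)
Lemma rep_null z : ncauchy n z -> (forall v, cvgc (fun m => g (z m) v) 0) ->
  forall e : R, 0 < e -> exists K, forall m, (K <= m)%N -> n (z m) < e.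
Proof.
move=> cz z0 e e0; have [M M0 zM] := ncauchy_bounded (ipnorm0 gP) (ipnormD gP) (ipnormN gP) cz.
have d0 : 0 < e ^+ 2 / (2 * (M + 1)) by rewrite divr_gt0 ?exprn_gt0//; lra.
have [K HK] := cz _ d0; have [K' HK'] := z0 (z K) (e ^+ 2 / 2) ltac:(nra).
exists (maxn K K') => m; rewrite geq_max => /andP[Km /HK'].
rewrite subr0 => h1; have h2 := HK m K Km (leqnn K).
rewrite -ltr_sqr ?nnegrE//; last exact: ltW.
have -> : n (z m) ^+ 2 = normc (g (z m) (z m)).
  by rewrite (ipnormE gP) normc_real ger0_norm ?sqr_ge0.
have -> : g (z m) (z m) = g (z m) (z K) + g (z m) (z m - z K).
  by rewrite -(ipDr gP) addrC subrK.
apply: le_lt_trans (le_normcD _ _) _.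
have h3 := ip_cauchy_schwarz gP (z m) (z m - z K).
have h4 : n (z m) * n (z m - z K) <= M * (e ^+ 2 / (2 * (M + 1))).
  by apply: ler_pM => //; apply: ltW.
have h5 : M * (e ^+ 2 / (2 * (M + 1))) = (M / (M + 1)) * (e ^+ 2 / 2).
  by field; lra.
have h6 : M / (M + 1) <= 1 by rewrite ler_pdivrMr; lra.
have h7 : M / (M + 1) * (e ^+ 2 / 2) <= e ^+ 2 / 2.
  by rewrite ler_piMl// divr_ge0// sqr_ge0.
lra.
Qed.

Lemma cvgc_form0 x y : ncauchy n x ->
  (forall e : R, 0 < e -> exists K, forall m, (K <= m)%N -> n (y m) < e) ->
  cvgc (fun m => g (x m) (y m)) 0 /\ cvgc (fun m => g (y m) (x m)) 0.
Proof.
move=> cx y0; have [M M0 xM] := ncauchy_bounded (ipnorm0 gP) (ipnormD gP) (ipnormN gP) cx.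
suff H : cvgc (fun m => g (x m) (y m)) 0.
  split=> //; have := cvgc_conj H; rewrite -[X in cvgc _ X]/(conjc _) /= oppr0.
  by congr cvgc; apply: funext => m; have [_ gH _] := gP; rewrite [RHS]gH.
move=> e e0; have [|K HK] := y0 (e / (M + 1)); first by rewrite divr_gt0//; lra.
exists K => m /HK; rewrite subr0 ltr_pdivlMr; last lra.
have := ip_cauchy_schwarz gP (x m) (y m); have := nge0 (x m); have := nge0 (y m).
by have := xM m; nra.
Qed.

Lemma represents_diff x x' phi : represents x phi -> represents x' phi ->
  forall e : R, 0 < e -> exists K, forall m, (K <= m)%N -> n (x m - x' m) < e.
Proof.
move=> [cx xp] [cx' xp']; apply: rep_null => [e e0|v].
  have [K HK] := cx (e / 2) ltac:(lra); have [K' HK'] := cx' (e / 2) ltac:(lra).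
  exists (maxn K K') => m m'; rewrite !geq_max => /andP[h1 h2] /andP[h3 h4].
  rewrite opprB addrACA [- _ + _]addrC.
  rewrite (_ : _ + _ = (x m - x m') - (x' m - x' m')); last first.
    by rewrite opprB addrACA [x' m' - x' m]addrC addrACA.
  apply: le_lt_trans (ipnormD gP _ _) _; rewrite (ipnormN gP).
  by have := HK m m' h1 h3; have := HK' m m' h2 h4; lra.
have := cvgcD (xp v) (cvgcM (-1) (xp' v)); rewrite mulN1r subrr.
by congr cvgc; apply: funext => m; rewrite (ipBl gP) mulN1r.
Qed.

Lemma represents_lin (c : R[i]) x y phi psi : represents x phi -> represents y psi ->
  represents (fun m => c *: x m + y m) (c *: phi + psi).
Proof.
move=> [cx xp] [cy yp]; split=> [e e0|v]; last first.
  have := cvgcD (cvgcM c (xp v)) (yp v).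
  by congr cvgc; apply: funext => m; have [gL _ _] := gP; rewrite gL.
have c0 : 0 < normc c + 1 by have := normc_ge0 c; lra.
have [|K HK] := cx (e / 2 / (normc c + 1)); first by rewrite !divr_gt0.
have [K' HK'] := cy (e / 2) ltac:(lra).
exists (maxn K K') => m m'; rewrite !geq_max => /andP[h1 h2] /andP[h3 h4].
rewrite opprD addrACA -scalerBr; apply: le_lt_trans (ipnormD gP _ _) _.
rewrite (ipnormZ gP); have := HK m m' h1 h3; rewrite ltr_pdivlMr//.
by have := HK' m m' h2 h4; have := nge0 (x m - x m'); lra.
Qed.

Definition hpred : {pred E -> R[i]^o} := fun phi => `[< exists x, represents x phi >].

Lemma hpred_submod : submod_closed hpred.
Proof.
split=> [|c phi psi /asboolP[x xp] /asboolP[y yp]]; apply/asboolP.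
  exists (fun=> 0); split=> [e e0|v]; last by rewrite (ip0l gP); exact: cvgc_cst.
  by exists 0%N => m m' _ _; rewrite subr0 (ipnorm0 gP).
by exists (fun m => c *: x m + y m); apply: represents_lin.
Qed.

HB.instance Definition _ := GRing.isSubmodClosed.Build R[i] (E -> R[i]^o) hpred hpred_submod.

Record hcompl := HCompl { hval :> E -> R[i]^o; hvalP : hval \in hpred }.
HB.instance Definition _ := [isSub for hval].
HB.instance Definition _ := [Choice of hcompl by <:].
HB.instance Definition _ := [SubChoice_isSubLmodule of hcompl by <:].

Implicit Types (f h : hcompl).

Lemma hrep_ex f : exists x, represents x f.
Proof. exact/asboolP/(hvalP f). Qed.

(** The choice by [xget] is harmless and its default 0 never occurs: by [hip_lim] the limit exists
    along all representing sequences and does not depend on them. *)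
Definition hip f h : R[i] := xget 0 [set c | exists x y,
  [/\ represents x f, represents y h & cvgc (fun m => g (x m) (y m)) c]].

Lemma form_near x y x' y' f h : represents x f -> represents y h ->
  represents x' f -> represents y' h ->
  cvgc (fun m => g (x m) (y m) - g (x' m) (y' m)) 0.
Proof.
move=> xf yh xf' yh'.
have [_ h1] := cvgc_form0 yh.1 (represents_diff xf xf').
have [h2 _] := cvgc_form0 xf'.1 (represents_diff yh yh').
have := cvgcD h1 h2; rewrite addr0; congr cvgc; apply: funext => m.
by rewrite (ipBl gP) (ipBr gP) addrA subrK.
Qed.

Lemma hip_lim x y f h : represents x f -> represents y h ->
  cvgc (fun m => g (x m) (y m)) (hip f h).
Proof.
move=> xf yh; have [c cxy] : exists c, cvgc (fun m => g (x m) (y m)) c.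
  apply: cvgc_cauchy => e e0.
  have [M M0 xM] := ncauchy_bounded (ipnorm0 gP) (ipnormD gP) (ipnormN gP) xf.1.
  have [M' M'0 yM] := ncauchy_bounded (ipnorm0 gP) (ipnormD gP) (ipnormN gP) yh.1.
  have s0 : 0 < e / 2 / (M' + 1) by rewrite !divr_gt0//; lra.
  have s1 : 0 < e / 2 / (M + 1) by rewrite !divr_gt0//; lra.
  have [K HK] := xf.1 _ s0; have [K' HK'] := yh.1 _ s1.
  exists (maxn K K') => m m'; rewrite !geq_max => /andP[h1 h2] /andP[h3 h4].
  rewrite (_ : _ - _ = g (x m - x m') (y m) + g (x m') (y m - y m')); last first.
    by rewrite (ipBl gP) (ipBr gP) addrA subrK.
  apply: le_lt_trans (le_normcD _ _) _.
  have a1 := ip_cauchy_schwarz gP (x m - x m') (y m).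
  have a2 := ip_cauchy_schwarz gP (x m') (y m - y m').
  have := HK m m' h1 h3; have := HK' m m' h2 h4.
  have p1 : 0 < M' + 1 by lra.
  have p2 : 0 < M + 1 by lra.
  rewrite !ltr_pdivlMr// => b1 b2.
  have := nge0 (x m - x m'); have := nge0 (y m - y m').
  have := nge0 (x m'); have := nge0 (y m); have := xM m'; have := yM m; nra.
suff -> : hip f h = c by [].
rewrite /hip; case: xgetP => [c' ->|/(_ c)]; last by case; exists x, y.
move=> [x' [y' [xf' yh' cc']]]; apply: cvgc_uniq cxy.
exact: cvgc_near cc' (form_near xf yh xf' yh').
Qed.

Lemma hip_semi : semi_ip hip.
Proof.
split=> [c f f' h|f h|f].
- have [x xf] := hrep_ex f; have [x' xf'] := hrep_ex f'; have [y yh] := hrep_ex h.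
  have r := represents_lin c xf xf'; apply: (cvgc_uniq (hip_lim (f := c *: f + f') r yh)).
  have := cvgcD (cvgcM c (hip_lim xf yh)) (hip_lim xf' yh).
  by congr cvgc; apply: funext => m; have [gL _ _] := gP; rewrite gL.
- have [x xf] := hrep_ex f; have [y yh] := hrep_ex h.
  apply: (cvgc_uniq (hip_lim yh xf)); have := cvgc_conj (hip_lim xf yh).
  by congr cvgc; apply: funext => m; have [_ gH _] := gP; rewrite [RHS]gH.
- have [x xf] := hrep_ex f; apply: (cvgc_ge0 (hip_lim xf xf)) => m.
  by have [_ _ g0] := gP; apply: g0.
Qed.

Lemma represents_emb (v : E) : represents (fun=> v) (g v).
Proof.
split=> [e e0|w]; last exact: cvgc_cst.
by exists 0%N => m m' _ _; rewrite subrr (ipnorm0 gP).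
Qed.

Lemma emb_subproof (v : E) : (g v : E -> R[i]^o) \in hpred.
Proof. by apply/asboolP; exists (fun=> v); apply: represents_emb. Qed.

(** Null vectors of the form go to 0, so the completion performs the quotient as well. *)
Definition emb (v : E) : hcompl := HCompl (emb_subproof v).

Lemma hip_emb v w : hip (emb v) (emb w) = g v w.
Proof.
apply: cvgc_uniq (hip_lim (f := emb v) (h := emb w) (represents_emb v) (represents_emb w)) _.
exact: cvgc_cst.
Qed.

Lemma emb_lin c v w : emb (c *: v + w) = c *: emb v + emb w.
Proof. by apply/val_inj/funext => u; have [gL _ _] := gP; rewrite /= gL. Qed.

Lemma hip_embr f v : hip f (emb v) = f v.
Proof.
have [x xf] := hrep_ex f.
exact: cvgc_uniq (hip_lim (h := emb v) xf (represents_emb v)) (xf.2 v).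
Qed.

Lemma hip_def f : hip f f = 0 -> f = 0.
Proof.
move=> f0; apply/val_inj/funext => v /=; rewrite -hip_embr; apply: eq0_normc.
apply/eqP; rewrite eq_le normc_ge0 andbT.
apply: le_trans (ip_cauchy_schwarz hip_semi _ _) _.
by rewrite {1}/ipnorm f0 sqrtr0 mul0r.
Qed.

Definition hnorm f : R[i] := ((ipnorm hip f)%:C)%C.

Lemma hnormD f h : hnorm (f + h) <= hnorm f + hnorm h.
Proof. by rewrite -rcD lecR (ipnormD hip_semi). Qed.
Lemma hnormZ (c : R[i]) f : hnorm (c *: f) = `|c| * hnorm f.
Proof. by rewrite /hnorm (ipnormZ hip_semi) rcM. Qed.
Lemma hnorm0 f : hnorm f = 0 -> f = 0.
Proof.
by move=> /complexI f0; apply: hip_def; rewrite (ipnormE hip_semi) f0 expr0n.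
Qed.

HB.instance Definition _ := Lmodule_isNormed.Build R[i] hcompl hnormD hnormZ hnorm0.

Lemma hip_norm f : `|f| ^+ 2 = hip f f.
Proof. by rewrite (ipnormE hip_semi) -rmorphXn. Qed.

End Completion.

Section CompletionComplete.
Context {R : realType} (P : preHilbert R).
Local Notation H := (hcompl P).
Implicit Types (f h : H).

Let hipP : semi_ip (@hip R P) := hip_semi P.

Lemma hip_zmodl h : zmod_morphism ((@hip R P) ^~ h).
Proof. by move=> f f'; rewrite /= (ipBl hipP). Qed.
Lemma hip_zmodr h : zmod_morphism (@hip R P h).
Proof. by move=> f f'; rewrite /= (ipBr hipP). Qed.
Lemma hip_scall h : scalable_for *%R ((@hip R P) ^~ h).
Proof. by move=> c f; rewrite /= (ipZl hipP). Qed.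
Lemma hip_scalr h : scalable_for (@Num.conj R[i] \; *%R) (@hip R P h).
Proof. by move=> c f; rewrite /= (ipZr hipP). Qed.
HB.instance Definition _ := isBilinear.Build R[i] H H R[i] *%R
  (@Num.conj R[i] \; *%R) (@hip R P) hip_zmodl hip_zmodr hip_scall hip_scalr.
Lemma hip_herm f h : hip f h = (-1) ^+ false * (hip h f)^*.
Proof. by rewrite mul1r; have [_ gH _] := hipP; rewrite [LHS]gH. Qed.
HB.instance Definition _ := isHermitianSesquilinear.Build R[i] H false
  (@Num.conj R[i]) (@hip R P) hip_herm.
Lemma hip_gt0 f : f != 0 -> 0 < hip f f.
Proof.
move=> f0; rewrite lt_neqAle eq_sym; apply/andP; split.
  by apply: contra f0 => /eqP/hip_def->.
by have [_ _ g0] := hipP; apply: g0.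
Qed.
HB.instance Definition _ := isDotProduct.Build R[i] H (@hip R P) hip_gt0.

(** The squared distance of [emb (x k)] to [f] is the limit over m of the squared distances between
    [x k] and [x m]. *)
Lemma represents_cvg x f : represents x f -> ncvg (ipnorm (@hip R P)) (@emb R P \o x) f.
Proof.
move=> xf e e0; have [K HK] := xf.1 (e / 2) ltac:(lra); exists K => k Kk /=.
have xr : represents (fun m => (-1) *: x m + x k) ((-1) *: (f : _ -> R[i]^o) + emb (x k)).
  exact: represents_lin xf (represents_emb (x k)).
set f' := emb (x k) - f.
have rf' : represents (fun m => (-1) *: x m + x k) f'.
  by rewrite (_ : (f' : _ -> _) = (-1) *: (f : _ -> R[i]^o) + emb (x k))// scaleN1r addrC.
have hl := hip_lim rf' rf'; rewrite (ipnormE hipP) in hl.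
suff : ipnorm (@hip R P) f' <= e / 2 by lra.
rewrite -ler_sqr ?nnegrE ?ipnorm_ge0//; last lra.
rewrite -subr_ge0 -ler0c rcB.
have := cvgcD (cvgc_cst (((e / 2) ^+ 2)%:C)%C) (cvgcM (-1) hl); rewrite mulN1r.
(* The index is shifted by [K] so that every term of [s], and not only a tail, is nonnegative. *)
move=> hl'; pose s m := (((e / 2) ^+ 2)%:C)%C + (-1) * ph_form ((-1) *: x (m + K)%N + x k) ((-1) *: x (m + K)%N + x k).
apply: (@cvgc_ge0 _ s).
  move=> d /hl'[K' HK']; exists K' => m Km; apply: HK'.
  exact: leq_trans Km (leq_addr _ _).
move=> m; rewrite /s mulN1r (ipnormE (ph_axiom P)) -rcB ler0c subr_ge0.
rewrite ler_sqr ?nnegrE ?ipnorm_ge0//; last lra.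
by rewrite scaleN1r addrC ltW// HK// leq_addl.
Qed.

Lemma emb_ipnorm v : ipnorm (@hip R P) (emb v) = ipnorm (@ph_form R P) v.
Proof. by rewrite /ipnorm hip_emb. Qed.

Lemma embB v w : emb (v - w) = emb v - emb w :> H.
Proof. by rewrite addrC -scaleN1r emb_lin scaleN1r addrC. Qed.

Let N := ipnorm (@hip R P).
Let ND f h : N (f + h) <= N f + N h := ipnormD hipP f h.
Let NN f : N (- f) = N f := ipnormN hipP f.

(** Replace [f m] by a vector of the dense subspace within 1 / (m + 1) of it. The new sequence is
    Cauchy there, and its pointwise limit functional is the limit sought. *)
Lemma hcompl_seq_complete (f : nat -> H) :
  ncauchy N f -> exists h, ncvg N f h.
Proof.
move=> cf; have /choice[y Hy] : forall m : nat, exists v, N (f m - emb v) < m.+1%:R^-1.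
  move=> m; have [x xf] := hrep_ex (f m).
  have [|K /(_ _ (leqnn K))] := represents_cvg xf (e := m.+1%:R^-1).
    by rewrite invr_gt0.
  by exists (x K); rewrite -[X in X < _]NN opprB.
have cy : ncauchy (ipnorm (@ph_form R P)) y.
  move=> e e0; have [K HK] := cf (e / 3) ltac:(lra).
  have [K' HK'] := invn_small (e := e / 3) ltac:(lra).
  exists (maxn K K') => m m'; rewrite !geq_max => /andP[h1 h2] /andP[h3 h4].
  rewrite -emb_ipnorm embB -/N.
  have Hy' k : (K' <= k)%N -> N (emb (y k) - f k) < e / 3.
    by move=> /HK'; apply: lt_trans; rewrite -NN opprB.
  apply: (nseminorm_lt3 ND (y := f m) (z := f m')); [exact: Hy'|exact: HK|].
  by rewrite -NN opprB; exact: Hy'.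
have [l ly] : exists l : H, represents y l.
  have /choice[l Hl] : forall v, exists c, cvgc (fun m => ph_form (y m) v) c.
    move=> v; apply: cvgc_cauchy => e e0.
    set M := ipnorm (@ph_form R P) v; have M0 : 0 <= M by apply: ipnorm_ge0.
    have [|K HK] := cy (e / (M + 1)); first by rewrite divr_gt0//; lra.
    exists K => m m' Km Km'; have := HK m m' Km Km'.
    rewrite ltr_pdivlMr; last lra.
    have := ip_cauchy_schwarz (ph_axiom P) (y m - y m') v.
    rewrite (ipBl (ph_axiom P)) -/M.
    by have := ipnorm_ge0 (@ph_form R P) (y m - y m'); nra.
  have ly : represents y (l : _ -> R[i]^o) by [].
  have lP : (l : _ -> R[i]^o) \in @hpred R P by apply/asboolP; exists y.
  by exists (HCompl lP).
exists l => e e0; have [K HK] := represents_cvg ly (e := e / 2) ltac:(lra).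
have [K' HK'] := invn_small (e := e / 2) ltac:(lra).
exists (maxn K K') => m; rewrite geq_max => /andP[/HK h1 /HK' h2].
apply: (nseminorm_lt2 ND (y := emb (y m))); last exact: h1.
exact: lt_trans (Hy m) _.
Qed.

(** Centres of balls of radius 1 / (m + 1) belonging to the filter form a Cauchy sequence, and the
    filter converges to its limit. *)
Lemma hcompl_cauchy_cvg (F : set_system H) : ProperFilter F -> cauchy F -> cvg F.
Proof.
move=> FF /cauchyP cF; apply/cvg_ex.
have pr m : 0 < ((m.+1%:R^-1 : R)%:C)%C :> R[i] by rewrite ltcR invr_gt0.
have /choice[x Hx] : forall m : nat, exists x, F (ball x ((m.+1%:R^-1 : R)%:C)%C).
  by move=> m; apply: cF.
have ballE (u v : H) (e : R) : ball u (e%:C)%C v = (N (u - v) < e) :> Prop.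
  by rewrite -ball_normE /ball_/= -[`|_|]/(hnorm _) /hnorm ltcR.
have cx : ncauchy N x.
  move=> e e0; have [K HK] := invn_small (e := e / 2) ltac:(lra); exists K => m m' /HK h /HK h'.
  have [z [/=]] := filter_ex (filterI (Hx m) (Hx m')).
  rewrite !ballE => h1 h2; apply: (nseminorm_lt2 ND (y := z)).
    exact: lt_trans h1 _.
  by rewrite -NN opprB; apply: lt_trans h2 _.
have [l xl] := hcompl_seq_complete cx; exists l.
apply/cvgrPdist_lt => e e0; have [er _] := ge0_complex (ltW e0).
move: e0; rewrite er ltcR => e0; set d := complex.Re e in e0 *.
have [K HK] := xl (d / 2) ltac:(lra); have [K' HK'] := invn_small (e := d / 2) ltac:(lra).
apply: filterS (Hx (maxn K K')) => z; rewrite ballE => h1.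
rewrite -[`|_|]/(hnorm _) /hnorm ltcR -/N.
apply: (nseminorm_lt2 ND (y := x (maxn K K'))).
  by rewrite -NN opprB; apply: HK; apply: leq_maxl.
by apply: lt_trans h1 _; apply: HK'; apply: leq_maxr.
Qed.

HB.instance Definition _ := Uniform_isComplete.Build H hcompl_cauchy_cvg.

Lemma emb_dense f : exists2 x, represents x f & ncvg N (@emb R P \o x) f.
Proof. by have [x xf] := hrep_ex f; exists x => //; apply: represents_cvg. Qed.

Lemma hval_antilinear f (c : R[i]) v w : hval f (c *: v + w) = c^* * hval f v + hval f w.
Proof. by rewrite -!hip_embr emb_lin (ipDr hipP) (ipZr hipP). Qed.

End CompletionComplete.

Definition hcompl_hilbert (R : realType) (P : preHilbert R) :
  completeNormedModType R[i] := hcompl P.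

Definition hdot (R : realType) (P : preHilbert R) :
  {dot hcompl_hilbert P for @Num.conj R[i]} := @hip R P.

Lemma hdot_hilbert (R : realType) (P : preHilbert R) : hilbert (hdot P).
Proof. by move=> f; rewrite hip_norm. Qed.

(* The extension of an adjointable bounded operator T to the completion is
   precomposition with its adjoint T'. *)
Section Extension.
Context {R : realType} (P : preHilbert R).
Local Notation E := (ph_mod P).
Local Notation H := (hcompl P).
Local Notation g := (@ph_form R P).

Definition adjointable (T T' : E -> E) :=
  [/\ forall x y, T (x - y) = T x - T y, forall x y, g (T x) y = g x (T' y) &
      exists M : R, forall x, ipnorm g (T x) <= M * ipnorm g x].

Lemma ext_represents T T' (f : H) x : adjointable T T' -> represents x f ->
  represents (T \o x) ((f : E -> R[i]^o) \o T').
Proof.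
move=> [TB TT' [M TM]] [cx xf]; split=> [e e0|v]; last first.
  by have := xf (T' v); congr cvgc; apply: funext => m; rewrite /= TT'.
have M0 : 0 < `|M| + 1 by have := normr_ge0 M; lra.
have [|K HK] := cx (e / (`|M| + 1)); first by rewrite divr_gt0.
exists K => m m' Km Km'; rewrite /= -TB; apply: le_lt_trans (TM _) _.
have := HK m m' Km Km'; rewrite ltr_pdivlMr//.
by have := ler_norm M; have := ipnorm_ge0 g (x m - x m'); nra.
Qed.

Lemma ext_subproof T T' (TT : adjointable T T') (f : H) :
  ((f : E -> R[i]^o) \o T') \in @hpred R P.
Proof.
have [x xf] := hrep_ex f; apply/asboolP; exists (T \o x).
exact: ext_represents.
Qed.

Definition ext T T' (TT : adjointable T T') (f : H) : H := HCompl (ext_subproof TT f).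

Lemma ext_linear T T' (TT : adjointable T T') : linear (ext TT).
Proof. by move=> c f h; apply/val_inj/funext. Qed.

Lemma ext_emb T T' (TT : adjointable T T') v : ext TT (emb v) = emb (T v).
Proof.
by apply/val_inj/funext => w /=; have [_ -> _] := TT.
Qed.

Lemma ext_adj T T' S S' (TT : adjointable T T') (SS : adjointable S S') f h :
  (forall x y, g (T x) y = g x (S y)) -> hip (ext TT f) h = hip f (ext SS h).
Proof.
move=> TS; have [x xf] := hrep_ex f; have [y yh] := hrep_ex h.
have h1 := hip_lim (f := ext TT f) (ext_represents TT xf) yh.
have h2 := hip_lim (h := ext SS h) xf (ext_represents SS yh).
apply: (cvgc_uniq h1); move: h2; congr cvgc; apply: funext => m /=.
by rewrite TS.
Qed.

End Extension.

(** * GNS representations and slice maps *)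

Definition mk_linear (K : pzRingType) (U V : lmodType K) (f : U -> V)
    (fl : linear f) : {linear U -> V} :=
  HB.pack f (GRing.isLinear.Build K U V *:%R f fl).

Section MkMorphism.
Context {R : realType} {A B : cstarAlgType R}.

Lemma mk_lrmorphism (f : A -> B) : linear f -> f 1 = 1 ->
  {morph f : x y / x * y} -> exists F : {lrmorphism A -> B}, F =1 f.
Proof.
move=> fl f1 fM; pose F : {lrmorphism A -> B} := HB.pack f
  (GRing.isLinear.Build R[i] A B *:%R f fl)
  (GRing.isMonoidMorphism.Build A B f (f1, fM)).
by exists F.
Qed.

End MkMorphism.

Section GNS.
Context {R : realType} {A : cstarAlgType R}.

Section PreRepresentation.
Context {E : lmodType R[i]} (g : E -> E -> R[i]) (pi : A -> E -> E).
Hypothesis gP : semi_ip g.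
Hypothesis pi1 : forall x, pi 1 x = x.
Hypothesis pil : forall (c : R[i]) a b x, pi (c *: a + b) x = c *: pi a x + pi b x.
Hypothesis piM : forall a b x, pi (a * b) x = pi a (pi b x).
Hypothesis pis : forall a x y, g (pi a x) y = g x (pi (star a) y).

Lemma prerep0 x : pi 0 x = 0.
Proof. by have := pil (-1) 0 0 x; rewrite scaler0 addr0 => ->; rewrite scaleN1r addNr. Qed.
Lemma prerepB a b x : pi (a - b) x = pi a x - pi b x.
Proof. by have := pil (-1) b a x; rewrite !scaleN1r addrC => ->; rewrite addrC. Qed.
Lemma prerep_rs r x : pi (rs r) x = (r%:C)%C *: x.
Proof. by have := pil (r%:C)%C 1 0 x; rewrite !addr0 pi1 prerep0 addr0. Qed.

(* |a|^2 - a^* a is a square, hence acts positively. *)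
Lemma prerep_contractive a x :
  g (pi a x) (pi a x) <= ((cnorm a ^+ 2)%:C)%C * g x x.
Proof.
have [k [[sk _] hk _]] := pos_sqrt (pos_norm_sub (sa_sM a)).
have [_ _ g0] := gP; have := g0 (pi k x).
rewrite pis sk -piM -hk prerepB prerep_rs piM (ipBr gP) (ipZr gP) conjC_rc cnorm_star.
by rewrite -[X in _ - X]pis subr_ge0.
Qed.

Lemma prerep_ipnorm a x : ipnorm g (pi a x) <= cnorm a * ipnorm g x.
Proof.
rewrite -ler_sqr ?nnegrE ?mulr_ge0 ?ipnorm_ge0// exprMn.
rewrite -lecR (rcM (cnorm a ^+ 2)) -!(ipnormE gP); exact: prerep_contractive.
Qed.

End PreRepresentation.

(** The operators of an algebraic representation are automatically bounded ([prerep_ipnorm]), hence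
    extend to the completion. *)
Lemma prerep_complete (P : preHilbert R) (pi : A -> ph_mod P -> ph_mod P) :
  (forall a x y, pi a (x - y) = pi a x - pi a y) ->
  (forall x, pi 1 x = x) ->
  (forall (c : R[i]) a b x, pi (c *: a + b) x = c *: pi a x + pi b x) ->
  (forall a b x, pi (a * b) x = pi a (pi b x)) ->
  (forall a x y, ph_form (pi a x) y = ph_form x (pi (star a) y)) ->
  exists2 Pi : A -> {linear hcompl_hilbert P -> hcompl_hilbert P},
    star_rep (hdot P) Pi & forall a v, Pi a (emb v) = emb (pi a v).
Proof.
move=> piB pi1 pil piM pis; have gP := ph_axiom P.
have adj (b : A) : @adjointable R P (pi b) (pi (star b)).
  split=> [x y|x y|]; [exact: piB | exact: pis | exists (cnorm b) => x].
  exact: prerep_ipnorm.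
pose Pi (b : A) : {linear hcompl_hilbert P -> hcompl_hilbert P} :=
  mk_linear (ext_linear (adj b)).
exists Pi => [|a v]; last exact: ext_emb.
split=> [f|c b b' f|b b' f|b f h].
- by apply/val_inj/funext => v; rewrite /= star1 pi1.
- apply/val_inj/funext => v /=.
  by rewrite starD starZ pil (@hval_antilinear R P f c^*) conjCK.
- by apply/val_inj/funext => v /=; rewrite starM piM.
- by apply: (ext_adj (adj b) (adj (star b))) => x y; have [_ -> _] := adj b.
Qed.

(** The state is chosen to attain the squared norm of [a] at [star a * a], so already the cyclic
    vector 1 sees the whole norm of [a]. *)
Theorem gns (a : A) : exists (H : completeNormedModType R[i])
    (ip : {dot H for @Num.conj R[i]}) (pi : A -> {linear H -> H}) (x : H),
  [/\ hilbert ip, star_rep ip pi, ip x x = 1 &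
      ip (pi a x) (pi a x) = ((cnorm a ^+ 2)%:C)%C].
Proof.
have [phi [phil phi0 phis phi1 phia]] := state_exists a.
pose form (x y : (A : lmodType R[i])) := phi (star y * x).
have fP : semi_ip form.
  split=> [c x y z|x y|x]; rewrite /form.
  - by rewrite mulrDr -scalerAr phil.
  - by rewrite -phis starM starK.
  - exact: phi0.
pose P := PreHilbert fP.
have [||||| Pi rep Pie] := @prerep_complete P (fun b : A => *%R b).
- by move=> b x y; apply: mulrBr.
- by move=> x; apply: mul1r.
- by move=> c b b' x; rewrite mulrDl scalerAl.
- by move=> b b' x; rewrite mulrA.
- by move=> b x y; rewrite /= /form starM starK mulrA.
exists (hcompl_hilbert P), (hdot P), Pi, (@emb R P (1 : A)); split=> //.
- exact: hdot_hilbert.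
- by rewrite -[LHS]/(hip _ _) hip_emb /= /form star1 mul1r.
- rewrite -[LHS]/(hip (Pi a _) (Pi a _)) !Pie hip_emb /= /form.
  by rewrite !mulr1 phia.
Qed.

Lemma star_rep_contractive (H : completeNormedModType R[i])
    (ip : {dot H for @Num.conj R[i]}) (pi : A -> {linear H -> H}) a x :
  semi_ip ip -> star_rep ip pi ->
  ip (pi a x) (pi a x) <= ((cnorm a ^+ 2)%:C)%C * ip x x.
Proof.
by move=> ipP [pi1 pil piM pis]; apply: (@prerep_contractive H ip (fun b => pi b)).
Qed.

Lemma dot_semi_ip (H : completeNormedModType R[i])
    (ip : {dot H for @Num.conj R[i]}) : semi_ip ip.
Proof.
split=> [c x y z|x y|x].
- by rewrite linearDl linearZl_LR.
- by rewrite hermC expr0 mul1r.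
- have [->|x0] := eqVneq x 0; first by rewrite linear0l.
  exact/ltW/neq0_dnorm_gt0.
Qed.

End GNS.

(** A GNS representation that sees the norm of [f a], composed with [f], is a representation of A,
    hence contractive. *)
Lemma star_hom_contractive (R : realType) (A B : cstarAlgType R)
  (f : {lrmorphism A -> B}) : star_hom f -> forall a, cnorm (f a) <= cnorm a.
Proof.
move=> fs a; have [H [ip [pi [x [_ [pi1 pil piM pis] x1 fa]]]]] := gns (f a).
have rep : star_rep ip (pi \o f).
  split=> [y|c b b' y|b b' y|b y z] /=.
  - by rewrite rmorph1 pi1.
  - by rewrite linearP pil.
  - by rewrite rmorphM piM.
  - by rewrite pis fs.
have := star_rep_contractive a x (dot_semi_ip ip) rep.
by rewrite /= fa x1 mulr1 lecR ler_sqr ?nnegrE.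
Qed.

(** * Positivity of the tensor product of two forms, and slice maps *)

Section TensorForm.
Context {R : realType} {E F : lmodType R[i]}.
Context (g : E -> E -> R[i]) (k : F -> F -> R[i]).
Hypothesis (gP : semi_ip g) (kP : semi_ip k).
Implicit Types s : seq (E * F).

Definition tform s s' := \sum_(x <- s) \sum_(y <- s') g x.1 y.1 * k x.2 y.2.

Lemma ip_suml (I : Type) (r : seq I) (f : I -> E) y :
  g (\sum_(i <- r) f i) y = \sum_(i <- r) g (f i) y.
Proof. exact: (big_morph (g^~ y) (fun a b => ipDl gP a b y) (ip0l gP y)). Qed.
Lemma ip_sumr (I : Type) (r : seq I) (f : I -> E) y :
  g y (\sum_(i <- r) f i) = \sum_(i <- r) g y (f i).
Proof. exact: (big_morph (g y) (fun a b => ipDr gP a b y) (ip0r gP y)). Qed.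

(** Gram-Schmidt in the second leg: splitting every second component along [y] separates a term
    [k y y] times a square in the first leg from the form of a list shorter by one. *)
Lemma tform_ge0 s : 0 <= tform s s.
Proof.
have [m] := ubnP (size s); elim: m s => // m IH [|[x y] s] /=; first by rewrite /tform big_nil.
(* If k y y = 0, the quotient is 0 and [proj] changes nothing; Cauchy-Schwarz then makes y
   orthogonal to everything, so the identities below also cover the degenerate case. *)
rewrite ltnS => sm; pose alpha z := k z y / k y y.
pose proj z := z - alpha z *: y; pose s' := [seq (p.1, proj p.2) | p <- s].
have ky : complex.Re (k y y) = ipnorm k y ^+ 2 by rewrite (ipnormE kP).
have kproj z w : k z w = alpha z * (alpha w)^* * k y y + k (proj z) (proj w).
  rewrite /proj (ipBl kP) !(ipBr kP) !(ipZl kP) !(ipZr kP) /alpha.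
  have [k0|k0] := eqVneq (k y y) 0.
    by rewrite k0 invr0 !mulr0 conjC0 !mul0r !subr0 add0r.
  have [_ kH _] := kP; rewrite (kH w y) conjCM.
  have -> : ((k y y)^-1)^* = (k y y)^-1.
    by rewrite (ipnormE kP) -[X in X^-1]/(real_complex _ _) -fmorphV conjC_rc.
  by field.
have yproj z : k (proj y) z = 0.
  have [k0|k0] := eqVneq (k y y) 0.
    rewrite /proj /alpha k0 invr0 mulr0 scale0r subr0.
    apply: eq0_normc; apply/eqP; rewrite eq_le normc_ge0 andbT.
    apply: le_trans (ip_cauchy_schwarz kP _ _) _.
    by rewrite {1}/ipnorm k0 sqrtr0 mul0r.
  by rewrite /proj /alpha divff// scale1r subrr (ip0l kP).
have yprojr z : k z (proj y) = 0.
  by have [_ kH _] := kP; rewrite kH yproj conjC0.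
have -> : tform ((x, y) :: s) ((x, y) :: s) =
    k y y * g (\sum_(p <- (x, y) :: s) alpha p.2 *: p.1)
              (\sum_(p <- (x, y) :: s) alpha p.2 *: p.1) + tform s' s'.
  have -> : tform s' s' = \sum_(p <- (x, y) :: s) \sum_(p' <- (x, y) :: s)
      g p.1 p'.1 * k (proj p.2) (proj p'.2).
    rewrite big_cons [X in _ = X + _]big1 => [|p' _]; last by rewrite yproj mulr0.
    rewrite add0r /tform big_map; apply: eq_bigr => p _.
    by rewrite big_cons yprojr mulr0 add0r big_map.
  rewrite ip_suml mulr_sumr -big_split; apply: eq_bigr => p _ /=.
  rewrite ip_sumr mulr_sumr -big_split; apply: eq_bigr => p' _ /=.
  by rewrite (ipZl gP) (ipZr gP) kproj; ring.
have [_ _ g0] := gP; have [_ _ k0] := kP.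
by rewrite addr_ge0 ?mulr_ge0//; apply: IH; rewrite size_map.
Qed.

(** Adjoin the pair (- l X, w) to [s]. Positivity of the enlarged form reads l^2 a b - 2 l a >= 0
    with a = |X|^2 and b = |w|^2; for l = 1 / (b + 1) this forces a = 0. *)
Lemma tform_null s w : tform s s = 0 ->
  let X := \sum_(p <- s) k p.2 w *: p.1 in g X X = 0.
Proof.
move=> s0 X; pose l : R := (ipnorm k w ^+ 2 + 1)^-1.
have l0 : 0 < l by rewrite invr_gt0; have := sqr_ge0 (ipnorm k w); lra.
have gX z : \sum_(p <- s) g p.1 z * k p.2 w = g X z.
  by rewrite ip_suml; apply: eq_bigr => p _; rewrite (ipZl gP) mulrC.
have Xg z : \sum_(p <- s) g z p.1 * k w p.2 = g z X.
  rewrite ip_sumr; apply: eq_bigr => p _; rewrite (ipZr gP) mulrC.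
  by have [_ kH _] := kP; rewrite (kH p.2 w).
have := tform_ge0 ((- (l%:C)%C *: X, w) :: s).
rewrite /tform big_cons big_cons /=.
under [X in _ <= _ + X]eq_bigr do rewrite big_cons /=.
rewrite big_split /= -/(tform s s) s0 addr0.
under eq_bigr do rewrite (ipZl gP) -mulrA.
rewrite -mulr_sumr Xg.
under [X in _ <= _ + X]eq_bigr do rewrite (ipZr gP) -mulrA.
rewrite -mulr_sumr gX (ipZl gP) (ipZr gP) conjCN conjC_rc !(ipnormE gP) (ipnormE kP).
set a := ipnorm g X ^+ 2; set b := ipnorm k w ^+ 2.
rewrite (_ : _ + _ = ((l ^+ 2 * a * b - 2 * l * a)%:C)%C); last first.
  by rewrite rcB !rcM; rewrite -[(2%:C)%C]/((2%:R : R)%:C)%C rmorph_nat; ring.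
rewrite ler0c => h; have a0 : 0 <= a by apply: sqr_ge0.
have b0 : 0 <= b by apply: sqr_ge0.
have b1 : 0 < b + 1 by lra.
have lb : l * (b + 1) = 1 by rewrite mulVf// gt_eqF.
have : l * (1 + l) * a <= 0.
  have lb' : l * b = 1 - l by rewrite -lb; ring.
  have e : l ^+ 2 * a * b = l * a * (l * b) by ring.
  by move: h; rewrite e lb'; nra.
rewrite pmulr_rle0; last by rewrite mulr_gt0//; lra.
by move=> a00; rewrite (_ : a = 0)//; apply: le_anti; rewrite a00 a0.
Qed.

End TensorForm.

Section Slice.
Context {R : realType}.

(** The spatial norm only tests representations on Hilbert spaces, so these are the functionals
    along which an equation in the tensor product can be sliced. *)
Definition vector_functional (B : cstarAlgType R) (phi : B -> R[i]) :=
  exists (K : completeNormedModType R[i]) (ip : {dot K for @Num.conj R[i]})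
    (rho : B -> {linear K -> K}) (y w : K),
  [/\ hilbert ip, star_rep ip rho & phi = fun b => ip (rho b y) w].

Lemma vector_functional_sep (B : cstarAlgType R) (b : B) : b != 0 ->
  exists2 phi, vector_functional phi & phi b != 0.
Proof.
move=> b0; have [K [ip [rho [y [hK rK y1 yb]]]]] := gns b.
exists (fun c => ip (rho c y) (rho b y)); first by exists K, ip, rho, y, (rho b y).
rewrite yb; apply: contra b0 => /eqP/complexI/eqP.
by rewrite expf_eq0 => /eqP/cnorm0_eq0->.
Qed.

Lemma vector_functional_linear (B : cstarAlgType R) (phi : B -> R[i]) :
  vector_functional phi -> forall (c : R[i]) a b, phi (c *: a + b) = c * phi a + phi b.
Proof.
move=> [K [ip [rho [y [w [_ [_ rl _ _] ->]]]]]] c a b.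
by have [iL _ _] := dot_semi_ip ip; rewrite rl iL.
Qed.

(** Norm 0 says that the represented operator kills every elementary tensor x (x) y, and
    [tform_null] turns this into the vanishing of the sliced sum at x. Choosing x by GNS for the
    sliced sum itself shows that its norm is 0. *)
Lemma tensor_slice (A B T : cstarAlgType R) (i1 : {lrmorphism A -> T})
    (i2 : {lrmorphism B -> T}) (t : seq (A * B)) (phi : B -> R[i]) :
  is_tensor i1 i2 -> vector_functional phi ->
  \sum_(a <- t) i1 a.1 * i2 a.2 = 0 -> \sum_(a <- t) phi a.2 *: a.1 = 0.
Proof.
move=> [_ _ _ tn] [K [ipK [rho [y [w [hK rK ->]]]]]] t0.
set a0 := \sum_(a <- t) _; apply/eqP/negPn/negP => a0n.
have [H [ipH [pi [x [hH rH x1 xa]]]]] := gns a0.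
have := (tn t 0 (lexx 0)).1; rewrite t0 cnorm0 => /(_ (lexx 0)).
move=> /(_ H K ipH ipK pi rho hH hK rH rK [:: (x, y)]).
rewrite expr0n mul0r; set s := (X in tensor_sqnorm _ _ X <= _) => sle.
have s0 : tform ipH ipK s s = 0.
  apply: le_anti; rewrite [_ <= 0]sle andTb.
  exact: tform_ge0 (dot_semi_ip ipH) (dot_semi_ip ipK) s.
have := tform_null (dot_semi_ip ipH) (dot_semi_ip ipK) w s0.
have [pi1 pil _ _] := rH.
have pi0 : pi 0 x = 0.
  by have := pil (-1) 0 0 x; rewrite scaler0 addr0 => ->; rewrite scaleN1r addNr.
have -> : \sum_(p <- s) ipK p.2 w *: p.1 = pi a0 x.
  rewrite /s /a0 big_allpairs_dep /=.
  elim: (t) => [|p t' IH]; first by rewrite !big_nil.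
  by rewrite !big_cons big_nil addr0 IH pil.
rewrite /= xa => /complexI/eqP; rewrite expf_eq0 => /eqP/cnorm0_eq0.
by apply/eqP.
Qed.

End Slice.

(** * Kernel Hilbert spaces and bounded operators *)

Lemma conjC_sum (R : realType) (I : Type) (r : seq I) (P : pred I) (F : I -> R[i]) :
  (\sum_(i <- r | P i) F i)^* = \sum_(i <- r | P i) (F i)^*.
Proof. exact: rmorph_sum. Qed.

(* The span of the functions kappa x, carrying the inner product for which
   <f, kappa x> = f x. *)
Section KernelSpace.
Context {R : realType} {X : Type} (kappa : X -> X -> R[i]).

Definition psd_kernel := (forall x y, kappa y x = (kappa x y)^*) /\
  forall s : seq (R[i] * X),
    0 <= \sum_(p <- s) \sum_(q <- s) p.1 * q.1^* * kappa p.2 q.2.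

Definition kfun (s : seq (R[i] * X)) : X -> R[i]^o :=
  fun x => \sum_(p <- s) p.1 * kappa p.2 x.

Definition kpred : {pred X -> R[i]^o} := fun f => `[< exists s, f = kfun s >].

Lemma kfun_cat s t : kfun (s ++ t) = kfun s + kfun t.
Proof. by apply: funext => x; rewrite /kfun big_cat. Qed.

Lemma kfun_scale (c : R[i]) s : kfun [seq (c * p.1, p.2) | p <- s] = c *: kfun s.
Proof.
apply: funext => x; rewrite /kfun big_map -[RHS]/(c * _) mulr_sumr.
by apply: eq_bigr => p _; rewrite mulrA.
Qed.

Lemma kpred_submod : submod_closed kpred.
Proof.
split=> [|c f h /asboolP[s ->] /asboolP[t ->]]; apply/asboolP.
  by exists [::]; apply: funext => x; rewrite /kfun big_nil.
by exists ([seq (c * p.1, p.2) | p <- s] ++ t); rewrite kfun_cat kfun_scale.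
Qed.

HB.instance Definition _ := GRing.isSubmodClosed.Build R[i] (X -> R[i]^o) kpred kpred_submod.

Record kspace := KSpace { kval :> X -> R[i]^o; kvalP : kval \in kpred }.
HB.instance Definition _ := [isSub for kval].
HB.instance Definition _ := [Choice of kspace by <:].
HB.instance Definition _ := [SubChoice_isSubLmodule of kspace by <:].

Implicit Types f h : kspace.

Lemma krep_ex f : exists s, kval f = kfun s.
Proof. exact/asboolP/(kvalP f). Qed.

Lemma kelt_subproof s : kfun s \in kpred. Proof. by apply/asboolP; exists s. Qed.
Definition kelt s : kspace := KSpace (kelt_subproof s).

Definition krep f : seq (R[i] * X) := sval (cid (krep_ex f)).
Lemma krepE f : kval f = kfun (krep f).
Proof. exact: svalP (cid (krep_ex f)). Qed.

Definition kform f h : R[i] := \sum_(p <- krep h) p.1^* * kval f p.2.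

Hypothesis kP : psd_kernel.

Lemma kform_sym s t : \sum_(p <- t) p.1^* * kfun s p.2 =
  (\sum_(p <- s) p.1^* * kfun t p.2)^*.
Proof.
rewrite conjC_sum /kfun; under eq_bigr do rewrite mulr_sumr.
rewrite exchange_big /=; apply: eq_bigr => p _.
rewrite conjCM conjCK conjC_sum mulr_sumr; apply: eq_bigr => q _.
by rewrite conjCM kP.1 mulrCA.
Qed.

(** [kform] expands its second argument along a chosen list. By hermitian symmetry the value depends
    on the functions alone, so any expansion may be used. *)
Lemma kformE f t h : kval h = kfun t -> kform f h = \sum_(p <- t) p.1^* * kval f p.2.
Proof.
move=> ht; rewrite /kform krepE kform_sym [RHS]kform_sym.
by congr (_ ^*); apply: eq_bigr => p _; rewrite -krepE ht.
Qed.

Lemma kform_semi : semi_ip kform.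
Proof.
split=> [c f f' h|f h|f].
- rewrite /kform mulr_sumr -big_split; apply: eq_bigr => p _ /=.
  by rewrite [X in _ * X](_ : _ = c * kval f p.2 + kval f' p.2)// mulrDr mulrCA.
- rewrite (kformE _ (krepE f)) (kformE _ (krepE h)) [in LHS]krepE kform_sym.
  by congr (_ ^*); apply: eq_bigr => p _; rewrite -krepE.
- rewrite (kformE _ (krepE f)) krepE; have := kP.2 (krep f).
  rewrite exchange_big /=; congr (_ <= _); apply: eq_bigr => p _.
  by rewrite /kfun mulr_sumr; apply: eq_bigr => q _; rewrite mulrCA mulrA.
Qed.

Definition kprehilbert : preHilbert R := PreHilbert kform_semi.

Lemma kform_kelt s t : kform (kelt s) (kelt t) =
  \sum_(p <- s) \sum_(q <- t) p.1 * q.1^* * kappa p.2 q.2.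
Proof.
rewrite (kformE _ (t := t))// exchange_big /=; apply: eq_bigr => q _.
by rewrite /kfun mulr_sumr; apply: eq_bigr => p _; rewrite mulrCA mulrA.
Qed.

Lemma kmap_subproof (alpha alpha' : X -> X) f :
  (forall x y, kappa (alpha x) y = kappa x (alpha' y)) ->
  (kval f \o alpha' : X -> R[i]^o) \in kpred.
Proof.
move=> aa; apply/asboolP; exists [seq (p.1, alpha p.2) | p <- krep f].
apply: funext => x; rewrite /= krepE /kfun big_map.
by apply: eq_bigr => p _; rewrite aa.
Qed.

Definition kmap alpha alpha' aa f := KSpace (@kmap_subproof alpha alpha' f aa).

Lemma kmap_kelt alpha alpha' (aa : forall x y, kappa (alpha x) y = kappa x (alpha' y)) s :
  kmap aa (kelt s) = kelt [seq (p.1, alpha p.2) | p <- s].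
Proof.
apply/val_inj/funext => x; rewrite /= /kfun big_map.
by apply: eq_bigr => p _; rewrite aa.
Qed.

Lemma kmap_adj alpha alpha' (aa : forall x y, kappa (alpha x) y = kappa x (alpha' y))
    (aa' : forall x y, kappa (alpha' x) y = kappa x (alpha y)) f h :
  kform (kmap aa f) h = kform f (kmap aa' h).
Proof.
rewrite (kformE _ (krepE h)) (kformE _ (t := [seq (p.1, alpha' p.2) | p <- krep h])).
  by rewrite big_map.
apply: funext => x; rewrite /= krepE /kfun big_map.
by apply: eq_bigr => p _; rewrite aa'.
Qed.

End KernelSpace.

Section BoundedOperators.
Context {R : realType} (P : preHilbert R).
Local Notation H := (hcompl P).
Local Notation N := (ipnorm (@hip R P)).
Let hP : semi_ip (@hip R P) := hip_semi P.
Implicit Types (T S : H -> H) (x y : H).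

Definition adjoint_pair T S := forall x y, hip (T x) y = hip x (S y).
Definition bounded_by T (M : R) := forall x, N (T x) <= M * N x.

(** An adjoint is demanded outright, so that the involution does not rest on the Riesz theorem; in
    return, completeness has to produce the adjoint of a limit. *)
Definition bpred : {pred H -> H} := fun T =>
  `[< [/\ linear T, exists S, adjoint_pair T S & exists M, bounded_by T M] >].

Let N0 x : 0 <= N x := ipnorm_ge0 _ x.

Lemma hip_ext x y : (forall z, hip x z = hip y z) -> x = y.
Proof.
move=> xy; apply/eqP; rewrite -subr_eq0; apply/eqP/hip_def.
by rewrite (ipBl hP) xy subrr.
Qed.

Lemma hip_extr x y : (forall z, hip z x = hip z y) -> x = y.
Proof.
have [_ gH _] := hP.
by move=> xy; apply: hip_ext => z; rewrite gH [RHS]gH xy.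
Qed.

Lemma adjoint_linear T S : adjoint_pair T S -> linear S.
Proof.
move=> TS c x y; apply: hip_extr => z.
by rewrite -TS !(ipDr hP) !(ipZr hP) !TS.
Qed.

Lemma adjoint_sym T S : adjoint_pair T S -> adjoint_pair S T.
Proof. by have [_ gH _] := hP; move=> TS x y; rewrite gH -TS -gH. Qed.

Lemma adjoint_bounded T S (M : R) : adjoint_pair T S -> bounded_by T M -> bounded_by S M.
Proof.
move=> TS TM y.
have [->|n0] := eqVneq (N (S y)) 0.
  have := TM y; have := N0 (T y); lra.
have np : 0 < N (S y) by rewrite lt_neqAle eq_sym n0 N0.
rewrite -(ler_pM2l np) -expr2.
have -> : N (S y) ^+ 2 = normc (hip (T (S y)) y).
  by rewrite TS (ipnormE hP) normc_real ger0_norm// sqr_ge0.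
apply: le_trans (ip_cauchy_schwarz hP _ _) _.
by have := TM (S y); have := N0 y; nra.
Qed.

Lemma bounded_byW T (M M' : R) : M <= M' -> bounded_by T M -> bounded_by T M'.
Proof. by move=> MM' TM x; apply: le_trans (TM x) _; rewrite ler_wpM2r. Qed.

Lemma bpred_submod : submod_closed bpred.
Proof.
split=> [|c T S /asboolP[Tl [T' TT'] [M TM]] /asboolP[Sl [S' SS'] [M' SM']]]; apply/asboolP.
  split; first by move=> c x y; rewrite scaler0 addr0.
    by exists (fun=> 0) => x y; rewrite (ip0l hP) (ip0r hP).
  by exists 0 => x; rewrite mul0r (ipnorm0 hP).
split.
- move=> d x y; rewrite -![(c *: T + S) _]/(c *: T _ + S _) Tl Sl !scalerDr !scalerA.
  by rewrite mulrC addrACA.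
- exists (fun y => c^* *: T' y + S' y) => x y.
  rewrite -[(c *: T + S) _]/(c *: T _ + S _) (ipDl hP) (ipZl hP) TT' SS'.
  by rewrite (ipDr hP) (ipZr hP) conjCK.
- exists (normc c * M + M') => x; apply: le_trans (ipnormD hP _ _) _.
  rewrite mulrDl lerD// (ipnormZ hP) -mulrA ler_wpM2l ?normc_ge0//.
Qed.

HB.instance Definition _ := GRing.isSubmodClosed.Build R[i] (H -> H) bpred bpred_submod.

(* The proof that H is nonzero makes 1 != 0. *)
Record bounded_op (nz : exists x : H, x != 0) := BOp { bval :> H -> H; bvalP : bval \in bpred }.

Context (nz : exists x : H, x != 0).
Local Notation bop := (bounded_op nz).
HB.instance Definition _ := [isSub for @bval nz].
HB.instance Definition _ := [Choice of bop by <:].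
HB.instance Definition _ := [SubChoice_isSubLmodule of bop by <:].
Implicit Types a b c : bop.

Lemma bop_eq a b : (forall x, a x = b x) -> a = b.
Proof. by move=> ab; apply/val_inj/funext. Qed.

Lemma bop_linear a : linear a. Proof. by have /asboolP[] := bvalP a. Qed.
Lemma bop_adj_ex a : exists S, adjoint_pair a S. Proof. by have /asboolP[] := bvalP a. Qed.
Lemma bop_bnd a : exists M, bounded_by a M. Proof. by have /asboolP[] := bvalP a. Qed.
Lemma bopD a x y : a (x + y) = a x + a y.
Proof. by have := bop_linear a 1 x y; rewrite !scale1r. Qed.

Lemma bopBE a b x : (a - b) x = a x - b x. Proof. by []. Qed.
Lemma bop0 a : a 0 = 0.
Proof. by apply: (@addrI _ (a 0)); rewrite -bopD !addr0. Qed.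
Lemma bopZ a (k : R[i]) x : a (k *: x) = k *: a x.
Proof. by have := bop_linear a k x 0; rewrite bop0 !addr0. Qed.

Lemma bone_subproof : (id : H -> H) \in bpred.
Proof.
by apply/asboolP; split=> //; [exists id | exists 1 => x; rewrite mul1r].
Qed.
Lemma bmul_subproof a b : (bval a \o bval b) \in bpred.
Proof.
have [M aM] := bop_bnd a; have [M' bM'] := bop_bnd b.
have [S aS] := bop_adj_ex a; have [S' bS'] := bop_adj_ex b.
apply/asboolP; split=> [d x y||] /=; first by rewrite !bop_linear.
- by exists (S' \o S) => x y /=; rewrite aS bS'.
- exists (`|M| * M') => x /=; apply: le_trans (bounded_byW (ler_norm M) aM _) _.
  by rewrite -mulrA ler_wpM2l.
Qed.
Definition bone : bop := BOp nz bone_subproof.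
Definition bmul a b : bop := BOp nz (bmul_subproof a b).

Lemma bmulA : associative bmul. Proof. by move=> a b c; apply: bop_eq. Qed.
Lemma bmul1 : left_id bone bmul. Proof. by move=> a; apply: bop_eq. Qed.
Lemma bmulr1 : right_id bone bmul. Proof. by move=> a; apply: bop_eq. Qed.
Lemma bmulDl : left_distributive bmul +%R. Proof. by move=> a b c; apply: bop_eq. Qed.
Lemma bmulDr : right_distributive bmul +%R.
Proof. by move=> a b c; apply: bop_eq => x; rewrite /= bopD. Qed.
Lemma bone_neq0 : bone != 0.
Proof.
have [x x0] := nz; apply: contra x0 => /eqP/(congr1 (fun a : bop => a x))/= ->.
by [].
Qed.
HB.instance Definition _ := GRing.Zmodule_isNzRing.Build bop bmulA bmul1 bmulr1
  bmulDl bmulDr bone_neq0.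

Lemma bscaleAl (k : R[i]) a b : k *: (a * b) = (k *: a) * b.
Proof. exact: bop_eq. Qed.
HB.instance Definition _ := GRing.Lmodule_isLalgebra.Build R[i] bop bscaleAl.
Lemma bscaleAr (k : R[i]) a b : k *: (a * b) = a * (k *: b).
Proof.
by apply: bop_eq => x; rewrite /= bopZ.
Qed.
HB.instance Definition _ := GRing.Lalgebra_isAlgebra.Build R[i] bop bscaleAr.

Lemma bstar_subproof a : sval (cid (bop_adj_ex a)) \in bpred.
Proof.
case: cid => S aS /=; have [M aM] := bop_bnd a; apply/asboolP; split.
- exact: adjoint_linear aS.
- by exists a; apply: adjoint_sym.
- by exists M; apply: adjoint_bounded aS aM.
Qed.
Definition bstar a : bop := BOp nz (bstar_subproof a).
Lemma bstarP a : adjoint_pair a (bstar a).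
Proof. by rewrite /=; case: cid. Qed.
Lemma bstar_uniq a S : adjoint_pair a S -> forall y, bstar a y = S y.
Proof. by move=> aS y; apply: hip_extr => x; rewrite -bstarP aS. Qed.

Lemma bstarK : involutive bstar.
Proof.
by move=> a; apply: bop_eq => x; apply: bstar_uniq; apply: adjoint_sym; exact: bstarP.
Qed.
Lemma bstarD : {morph bstar : x y / x + y}.
Proof.
move=> a b; apply: bop_eq => x; apply: bstar_uniq => {}x y.
by rewrite (ipDl hP) (ipDr hP) !bstarP.
Qed.
Lemma bstarZ (k : R[i]) a : bstar (k *: a) = k^* *: bstar a.
Proof.
apply: bop_eq => x; apply: bstar_uniq => {}x y.
by rewrite (ipZl hP) (ipZr hP) conjCK !bstarP.
Qed.
Lemma bstarN a : bstar (- a) = - bstar a.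
Proof. by rewrite -scaleN1r bstarZ conjCN conjC1 scaleN1r. Qed.
Lemma bstarM a b : bstar (a * b) = bstar b * bstar a.
Proof. by apply: bop_eq => x; apply: bstar_uniq => {}x y; rewrite /= !bstarP. Qed.

Definition bbounds a := [set M : R | 0 <= M /\ bounded_by a M].
Definition bnorm a : R := inf (bbounds a).

Lemma bbounds_inf a : has_inf (bbounds a).
Proof.
have [M aM] := bop_bnd a; split; last by exists 0 => M' [].
by exists `|M|; split=> //; apply: bounded_byW aM; apply: ler_norm.
Qed.
Lemma bnorm_ge0 a : 0 <= bnorm a.
Proof. by apply: lb_le_inf; [case: (bbounds_inf a) | move=> M []]. Qed.
Lemma bnormP a : bounded_by a (bnorm a).
Proof.
move=> x; have [x0|x0] := eqVneq (N x) 0.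
  by have [M aM] := bop_bnd a; have := aM x; rewrite x0 !mulr0.
have np : 0 < N x by rewrite lt_neqAle eq_sym x0 N0.
rewrite -ler_pdivrMr//; apply: lb_le_inf; first by case: (bbounds_inf a).
by move=> M [_ aM]; rewrite ler_pdivrMr.
Qed.
Lemma bnorm_le a (M : R) : 0 <= M -> bounded_by a M -> bnorm a <= M.
Proof. by move=> M0 aM; apply: inf_lbound => //; case: (bbounds_inf a). Qed.

Lemma bnorm0_eq0 a : bnorm a = 0 -> a = 0.
Proof.
move=> a0; apply: bop_eq => x; apply: hip_def; rewrite (ipnormE hP).
have := bnormP a x; rewrite a0 mul0r => h.
by rewrite (_ : N _ = 0) ?expr0n//; apply: le_anti; rewrite h N0.
Qed.
Lemma ler_bnormD a b : bnorm (a + b) <= bnorm a + bnorm b.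
Proof.
apply: bnorm_le => [|x]; first by rewrite addr_ge0 ?bnorm_ge0.
apply: le_trans (ipnormD hP _ _) _; rewrite mulrDl lerD//; exact: bnormP.
Qed.
Lemma bnormZ_le (k : R[i]) a : bnorm (k *: a) <= normc k * bnorm a.
Proof.
apply: bnorm_le => [|x]; first by rewrite mulr_ge0 ?bnorm_ge0 ?normc_ge0.
rewrite -[(k *: a) x]/(k *: a x) (ipnormZ hP) -mulrA ler_wpM2l ?normc_ge0//; exact: bnormP.
Qed.
Lemma bnormZ (k : R[i]) a : bnorm (k *: a) = normc k * bnorm a.
Proof.
apply: le_anti; rewrite bnormZ_le/=.
have [->|k0] := eqVneq k 0; first by rewrite normc0 mul0r bnorm_ge0.
have nk : 0 < normc k.
  by rewrite lt_neqAle eq_sym normc_ge0 andbT; apply: contra k0 => /eqP/eq0_normc->.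
rewrite -ler_pdivlMl// -normcV.
by have := bnormZ_le k^-1 (k *: a); rewrite scalerA mulVf// scale1r.
Qed.
Lemma ler_bnormM a b : bnorm (a * b) <= bnorm a * bnorm b.
Proof.
apply: bnorm_le => [|x]; first by rewrite mulr_ge0 ?bnorm_ge0.
apply: le_trans (bnormP a _) _; rewrite -mulrA ler_wpM2l ?bnorm_ge0//; exact: bnormP.
Qed.
Lemma bnorm_star a : bnorm (bstar a * a) = bnorm a ^+ 2.
Proof.
have le b : bnorm (bstar b) <= bnorm b.
  apply: bnorm_le; first exact: bnorm_ge0.
  exact: adjoint_bounded (bstarP b) (bnormP b).
apply: le_anti; apply/andP; split.
  apply: le_trans (ler_bnormM _ _) _.
  by rewrite expr2 ler_wpM2r ?bnorm_ge0.
set c := bnorm (bstar a * a); have c0 : 0 <= c by apply: bnorm_ge0.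
suff h : bnorm a <= Num.sqrt c.
  by rewrite -(sqr_sqrtr c0) ler_sqr ?nnegrE ?bnorm_ge0 ?sqrtr_ge0.
apply: bnorm_le => [|x]; first exact: sqrtr_ge0.
rewrite -ler_sqr ?nnegrE ?mulr_ge0 ?sqrtr_ge0// exprMn (sqr_sqrtr c0).
have -> : N (a x) ^+ 2 = normc (hip ((bstar a * a) x) x).
  rewrite (adjoint_sym (bstarP a)) (ipnormE hP) normc_real ger0_norm//; exact: sqr_ge0.
apply: le_trans (ip_cauchy_schwarz hP _ _) _.
by rewrite expr2 mulrA ler_wpM2r//; apply: bnormP.
Qed.

(** The limit is taken pointwise. The adjoints also form a Cauchy sequence, since taking adjoints
    does not increase the norm, and their pointwise limit is the adjoint of the limit. *)
Lemma bnorm_complete (u : nat -> bop) :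
  (forall e : R, 0 < e -> \forall m & m' \near \oo, bnorm (u m - u m') < e) ->
  exists l : bop, bnorm (u m - l) @[m --> \oo] --> (0 : R).
Proof.
move=> cu0; have cu : ncauchy bnorm u.
  move=> e /cu0[[S1 S2] /= [[K1 _ H1] [K2 _ H2]] S12].
  exists (maxn K1 K2) => m m'; rewrite !geq_max => /andP[h1 _] /andP[_ h2].
  by apply: (S12 (m, m')); split; [apply: H1 | apply: H2].
have ND : forall x y, N (x + y) <= N x + N y by exact: ipnormD.
have NN : forall x, N (- x) = N x by exact: ipnormN.
have ptw x : ncauchy N (fun m => u m x).
  move=> e e0; have [|K HK] := cu (e / (N x + 1)); first by rewrite divr_gt0//; have := N0 x; lra.
  exists K => m m' Km Km'; have := HK m m' Km Km'; have := bnormP (u m - u m') x.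
  rewrite bopBE; have := N0 x => h0.
  rewrite ltr_pdivlMr; last lra.
  by have := bnorm_ge0 (u m - u m'); lra.
have /choice[l Hl] x : exists y, ncvg N (fun m => u m x) y by apply: hcompl_seq_complete.
have uniq v y z : ncvg N v y -> ncvg N v z -> y = z.
  move=> vy vz; have := ncvg_uniq0 (ipnorm0 hP) ND NN vy vz => h.
  by apply/eqP; rewrite -subr_eq0; apply/eqP/hip_def; rewrite (ipnormE hP) h expr0n.
have ll : linear l.
  move=> k x y; apply: (uniq (fun m => u m (k *: x + y))) => //.
  have cz : ncvg N (fun m => k *: u m x) (k *: l x).
    apply: (ncvg_comp (f := fun z => k *: z) (normc_ge0 k) _ (Hl x)) => z.
    by rewrite -scalerBr (ipnormZ hP).
  have E : (fun m => u m (k *: x + y)) = (fun m => k *: u m x + u m y).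
    by apply: funext => m; exact: bop_linear.
  rewrite E => e e0; have [K HK] := ncvgD ND cz (Hl y) e0; exists K => m Km.
  exact: HK.
have unif e : 0 < e -> exists K, forall m, (K <= m)%N -> forall x, N (u m x - l x) <= e * N x.
  move=> e0; have [K HK] := cu e e0; exists K => m Km x.
  apply/ler_addgt0Pr => d /(Hl x)[K' HK'].
  have h1 := HK m (maxn K K') Km (leq_maxl _ _).
  have h2 := HK' (maxn K K') (leq_maxr _ _).
  have h3 := nseminorm_tri ND (u m x) (u (maxn K K') x) (l x).
  have := bnormP (u m - u (maxn K K')) x.
  rewrite bopBE.
  have h4 : bnorm (u m - u (maxn K K')) * N x <= e * N x by rewrite ler_wpM2r// ltW.
  by move=> h5; apply: (le_trans h3); apply: lerD (le_trans h5 h4) (ltW h2).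
have lP : l \in bpred.
  apply/asboolP; split=> //.
    have cus : ncauchy bnorm (fun m => bstar (u m)).
      move=> e /cu[K HK]; exists K => m m' Km Km'; apply: le_lt_trans (HK m m' Km Km').
      apply: bnorm_le; first exact: bnorm_ge0.
      have -> : bstar (u m) - bstar (u m') = bstar (u m - u m').
        by rewrite bstarD bstarN.
      exact: adjoint_bounded (bstarP _) (bnormP _).
    have ptws x : ncauchy N (fun m => bstar (u m) x).
      move=> e e0; have [|K HK] := cus (e / (N x + 1)); first by rewrite divr_gt0//; have := N0 x; lra.
      exists K => m m' Km Km'; have := HK m m' Km Km'.
      have := bnormP (bstar (u m) - bstar (u m')) x.
      rewrite bopBE; have := N0 x => h0.
      rewrite ltr_pdivlMr; last lra.
      by have := bnorm_ge0 (bstar (u m) - bstar (u m')); lra.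
    have /choice[l' Hl'] x : exists y, ncvg N (fun m => bstar (u m) x) y by apply: hcompl_seq_complete.
    exists l' => x y.
    have ipc (v : nat -> H) z w : ncvg N v z -> cvgc (fun m => hip (v m) w) (hip z w).
      apply: (ncvg_comp (f := fun v => hip v w) (N0 w)) => v'.
      by rewrite -(ipBl hP) mulrC; apply: ip_cauchy_schwarz.
    apply: (cvgc_uniq (ipc _ _ y (Hl x))); have := cvgc_conj (ipc _ _ x (Hl' y)).
    have [_ gH _] := hP; rewrite -gH; congr cvgc; apply: funext => m.
    by rewrite [RHS]bstarP [RHS]gH.
  have [K HK] := unif 1 ltr01; exists (1 + bnorm (u K)) => x.
  have := HK K (leqnn K) x; have := bnormP (u K) x.
  have := nseminorm_tri ND (l x) (u K x) 0; rewrite !subr0.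
  by rewrite -[N (l x - _)]NN opprB; lra.
exists (BOp nz lP); apply/cvgrPdist_lt => e e0.
have [K HK] := unif (e / 2) ltac:(lra); exists K => // m Km.
rewrite sub0r normrN ger0_norm ?bnorm_ge0//.
suff : bnorm (u m - BOp nz lP) <= e / 2 by lra.
by apply: bnorm_le => [|x]; [lra | apply: HK].
Qed.

HB.instance Definition _ := isCStar.Build R bop bstarK bstarD bstarZ bstarM
  bnorm0_eq0 ler_bnormD bnormZ ler_bnormM bnorm_star bnorm_complete.

End BoundedOperators.

(** * Universal C*-algebras and group C*-algebras *)

(* A family of representations ev i of a set X of formal elements whose values
   are stable under the operations; the uniform closure of the image of X in the
   bounded product of the D i is a C*-algebra. *)
Record cfamily (R : realType) := CFamily {
  cf_index : Type;
  cf_index0 : cf_index;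
  cf_alg : cf_index -> cstarAlgType R;
  cf_set : Type;
  cf_ev : forall i, cf_set -> cf_alg i;
  cf_bnd : forall x, exists M : R, forall i, cnorm (cf_ev i x) <= M;
  cf_one : exists x, forall i, cf_ev i x = 1;
  cf_lin : forall (c : R[i]) x y, exists z, forall i, cf_ev i z = c *: cf_ev i x + cf_ev i y;
  cf_mul : forall x y, exists z, forall i, cf_ev i z = cf_ev i x * cf_ev i y;
  cf_star : forall x, exists z, forall i, cf_ev i z = star (cf_ev i x) }.

Section FamilyAlgebra.
Context {R : realType} (F : cfamily R).
Local Notation I := (cf_index F).
Local Notation D := (@cf_alg R F).
Local Notation X := (cf_set F).
Local Notation ev := (@cf_ev R F).

Definition approximable (b : forall i, D i) := forall e : R, 0 < e ->
  exists x : X, forall i, cnorm (b i - ev i x) <= e.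

Record famalg := FamAlg { fval :> forall i, D i; fvalP : approximable fval }.
HB.instance Definition _ := gen_eqMixin famalg.
HB.instance Definition _ := gen_choiceMixin famalg.
Implicit Types a b c : famalg.

Lemma fam_eq a b : (forall i, a i = b i) -> a = b.
Proof.
case: a b => [a aP] [b bP] /= ab; have {ab} ab := functional_extensionality_dep ab.
by case: _ / ab bP => bP; congr FamAlg; exact: Prop_irrelevance.
Qed.

Lemma fam_bounded a : exists2 M : R, 0 <= M & forall i, cnorm (a i) <= M.
Proof.
have [x ax] := fvalP a ltr01; have [M xM] := cf_bnd x.
exists (1 + M) => [|i].
  by have := xM (cf_index0 F); have := cnorm_ge0 (ev (cf_index0 F) x); lra.
by have := nseminorm_tri (@ler_cnormD R (D i)) (a i) (ev i x) 0;
  rewrite !subr0; have := ax i; have := xM i; lra.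
Qed.

Lemma ev_approximable (x : X) : approximable (fun i => ev i x).
Proof. by move=> e e0; exists x => i; rewrite subrr cnorm0 ltW. Qed.
Definition fev (x : X) : famalg := FamAlg (ev_approximable x).

Lemma lin_approximable (k : R[i]) a b : approximable (fun i => k *: a i + b i).
Proof.
move=> e e0; have k0 : 0 < normc k + 1 by have := normc_ge0 k; lra.
have [|x ax] := fvalP a (e := e / 2 / (normc k + 1)); first by rewrite !divr_gt0.
have [y bE] := fvalP b (e := e / 2) ltac:(lra); have [z zE] := cf_lin k x y.
exists z => i; rewrite zE opprD addrACA -scalerBr.
apply: le_trans (ler_cnormD _ _) _; rewrite cnormZ.
have := ax i; rewrite ler_pdivlMr// => h; have := bE i.
by have := cnorm_ge0 (a i - ev i x); have := normc_ge0 k; nra.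
Qed.

Lemma mul_approximable a b : approximable (fun i => a i * b i).
Proof.
move=> e e0; have [M M0 aM] := fam_bounded a; have [M' M'0 bM] := fam_bounded b.
(* The bound d <= 1 keeps the approximant [ev i x] below M + 1 in norm; the two errors then add up
   to at most d (M' + M + 1). *)
pose d := Num.min 1 (e / (M + M' + 1)).
have q0 : 0 < e / (M + M' + 1) by rewrite divr_gt0//; lra.
have d0 : 0 < d by rewrite lt_min ltr01.
have [x ax] := fvalP a d0; have [y bE] := fvalP b d0; have [z zE] := cf_mul x y.
exists z => i; rewrite zE.
have -> : a i * b i - ev i x * ev i y =
    (a i - ev i x) * b i + ev i x * (b i - ev i y).
  by rewrite mulrBl mulrBr addrA subrK.
apply: le_trans (ler_cnormD _ _) _.
have := ler_cnormM (a i - ev i x) (b i); have := ler_cnormM (ev i x) (b i - ev i y).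
have := nseminorm_tri (@ler_cnormD R (D i)) (ev i x) (a i) 0; rewrite !subr0.
rewrite [cnorm (ev i x - _)]cnormB.
have := ax i; have := bE i; have := aM i; have := bM i.
have : d <= 1 by rewrite ge_min lexx.
have : d * (M + M' + 1) <= e by rewrite -ler_pdivlMr ?ge_min ?lexx ?orbT//; lra.
have := cnorm_ge0 (a i - ev i x); have := cnorm_ge0 (b i - ev i y).
have := cnorm_ge0 (ev i x); have := cnorm_ge0 (b i).
set p := cnorm (a i - _); set q := cnorm (b i - _); set r := cnorm (ev i x).
set s := cnorm (b i); set t := cnorm (a i).
move=> s0 r0 qq0 p0 hd d1 sM tM qd pd rr h1 h2.
have : p * s <= d * M' by apply: ler_pM.
have : r * q <= (M + 1) * d by apply: ler_pM => //; lra.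
nra.
Qed.

Lemma star_approximable a : approximable (fun i => star (a i)).
Proof.
move=> e e0; have [x ax] := fvalP a e0; have [z zE] := cf_star x.
by exists z => i; rewrite zE -starB cnorm_starE.
Qed.

Lemma one_approximable : approximable (fun=> 1).
Proof.
have [x xE] := cf_one F; move=> e e0; exists x => i.
by rewrite xE subrr cnorm0 ltW.
Qed.

Definition fone := FamAlg one_approximable.
Definition flin k a b := FamAlg (lin_approximable k a b).
Definition fadd a b := flin 1 a b.
Definition fzero := flin (-1) fone fone.
Definition fscale k a := flin k a fzero.
Definition fopp a := flin (-1) a fzero.
Definition fmul a b := FamAlg (mul_approximable a b).
Definition fstar a := FamAlg (star_approximable a).

Lemma faddE a b i : fadd a b i = a i + b i. Proof. by rewrite /= scale1r. Qed.
Lemma fzeroE i : fzero i = 0. Proof. by rewrite /= scaleN1r addNr. Qed.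
Lemma fscaleE k a i : fscale k a i = k *: a i.
Proof. by rewrite /= scaleN1r addNr addr0. Qed.
Lemma foppE a i : fopp a i = - a i.
Proof. by rewrite /= !scaleN1r addNr addr0. Qed.
Definition fE := (faddE, fzeroE, fscaleE, foppE).

Lemma faddA : associative fadd.
Proof. by move=> a b c; apply: fam_eq => i; rewrite !fE addrA. Qed.
Lemma faddC : commutative fadd.
Proof. by move=> a b; apply: fam_eq => i; rewrite !fE addrC. Qed.
Lemma fadd0 : left_id fzero fadd.
Proof. by move=> a; apply: fam_eq => i; rewrite !fE add0r. Qed.
Lemma faddN : left_inverse fzero fopp fadd.
Proof. by move=> a; apply: fam_eq => i; rewrite !fE addNr. Qed.
HB.instance Definition _ := GRing.isZmodule.Build famalg faddA faddC fadd0 faddN.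

Lemma fmulE a b i : fmul a b i = a i * b i. Proof. by []. Qed.
Lemma fmulA : associative fmul.
Proof. by move=> a b c; apply: fam_eq => i; rewrite !fmulE mulrA. Qed.
Lemma fmul1 : left_id fone fmul.
Proof. by move=> a; apply: fam_eq => i; rewrite fmulE mul1r. Qed.
Lemma fmulr1 : right_id fone fmul.
Proof. by move=> a; apply: fam_eq => i; rewrite fmulE mulr1. Qed.
Lemma fmulDl : left_distributive fmul fadd.
Proof. by move=> a b c; apply: fam_eq => i; rewrite !(fmulE, faddE) mulrDl. Qed.
Lemma fmulDr : right_distributive fmul fadd.
Proof. by move=> a b c; apply: fam_eq => i; rewrite !(fmulE, faddE) mulrDr. Qed.
Lemma fone_neq0 : fone != fzero.
Proof.
apply/eqP => /(congr1 (fun a : famalg => a (cf_index0 F))); rewrite fzeroE /=.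
by apply/eqP; exact: oner_neq0.
Qed.
HB.instance Definition _ := GRing.Zmodule_isNzRing.Build famalg fmulA fmul1 fmulr1
  fmulDl fmulDr fone_neq0.

Lemma fscaleA k l a : fscale k (fscale l a) = fscale (k * l) a.
Proof. by apply: fam_eq => i; rewrite !fscaleE scalerA. Qed.
Lemma fscale1 : left_id 1 fscale.
Proof. by move=> a; apply: fam_eq => i; rewrite fscaleE scale1r. Qed.
Lemma fscaleDr : right_distributive fscale +%R.
Proof. by move=> k a b; apply: fam_eq => i; rewrite !(fscaleE, faddE) scalerDr. Qed.
Lemma fscaleDl a : {morph fscale^~ a : k l / k + l}.
Proof. by move=> k l; apply: fam_eq => i; rewrite !(fscaleE, faddE) scalerDl. Qed.
HB.instance Definition _ := GRing.Zmodule_isLmodule.Build R[i] famalg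
  fscaleA fscale1 fscaleDr fscaleDl.

Lemma famD a b i : (a + b) i = a i + b i. Proof. exact: faddE. Qed.
Lemma famN a i : (- a) i = - a i. Proof. exact: foppE. Qed.
Lemma famB a b i : (a - b) i = a i - b i. Proof. by rewrite famD famN. Qed.
Lemma fam0 i : (0 : famalg) i = 0. Proof. exact: fzeroE. Qed.
Lemma famM a b i : (a * b) i = a i * b i. Proof. by []. Qed.
Lemma famZ k a i : (k *: a) i = k *: a i. Proof. exact: fscaleE. Qed.

Lemma fscaleAl k a b : k *: (a * b) = (k *: a) * b.
Proof. by apply: fam_eq => i; rewrite !(famM, famZ) scalerAl. Qed.
HB.instance Definition _ := GRing.Lmodule_isLalgebra.Build R[i] famalg fscaleAl.
Lemma fscaleAr k a b : k *: (a * b) = a * (k *: b).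
Proof. by apply: fam_eq => i; rewrite !(famM, famZ) scalerAr. Qed.
HB.instance Definition _ := GRing.Lalgebra_isAlgebra.Build R[i] famalg fscaleAr.

Lemma fstarE a i : fstar a i = star (a i). Proof. by []. Qed.
Lemma fstarK : involutive fstar.
Proof. by move=> a; apply: fam_eq => i; rewrite !fstarE starK. Qed.
Lemma fstarD : {morph fstar : x y / x + y}.
Proof. by move=> a b; apply: fam_eq => i; rewrite !(fstarE, famD) starD. Qed.
Lemma fstarZ k a : fstar (k *: a) = k^* *: fstar a.
Proof. by apply: fam_eq => i; rewrite !(fstarE, famZ) starZ. Qed.
Lemma fstarM a b : fstar (a * b) = fstar b * fstar a.
Proof. by apply: fam_eq => i; rewrite !(fstarE, famM) starM. Qed.

Definition fbounds a := [set M : R | exists i, M = cnorm (a i)].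
Definition fnorm a : R := sup (fbounds a).
Lemma fbounds_sup a : has_sup (fbounds a).
Proof.
split; first by exists (cnorm (a (cf_index0 F))), (cf_index0 F).
by have [M _ aM] := fam_bounded a; exists M => _ [i ->].
Qed.
Lemma fnorm_ge a i : cnorm (a i) <= fnorm a.
Proof. by apply: (sup_upper_bound (fbounds_sup a)); exists i. Qed.
Lemma fnorm_le a (M : R) : (forall i, cnorm (a i) <= M) -> fnorm a <= M.
Proof. by move=> aM; apply: ge_sup => [|_ [i ->]//]; case: (fbounds_sup a). Qed.
Lemma fnorm_ge0 a : 0 <= fnorm a.
Proof. exact: le_trans (cnorm_ge0 _) (fnorm_ge a (cf_index0 F)). Qed.

Lemma fnorm0_eq0 a : fnorm a = 0 -> a = 0.
Proof.
by move=> a0; apply: fam_eq => i; rewrite fam0; apply: cnorm_le0; rewrite -a0 fnorm_ge.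
Qed.
Lemma ler_fnormD a b : fnorm (a + b) <= fnorm a + fnorm b.
Proof.
apply: fnorm_le => i; rewrite famD; apply: le_trans (ler_cnormD _ _) _.
by rewrite lerD ?fnorm_ge.
Qed.
Lemma fnormZ_le k a : fnorm (k *: a) <= normc k * fnorm a.
Proof.
by apply: fnorm_le => i; rewrite famZ cnormZ ler_wpM2l ?normc_ge0 ?fnorm_ge.
Qed.
Lemma fnormZ k a : fnorm (k *: a) = normc k * fnorm a.
Proof.
apply: le_anti; rewrite fnormZ_le/=.
have [->|k0] := eqVneq k 0; first by rewrite normc0 mul0r fnorm_ge0.
have nk : 0 < normc k.
  by rewrite lt_neqAle eq_sym normc_ge0 andbT; apply: contra k0 => /eqP/eq0_normc->.
rewrite -ler_pdivlMl// -normcV.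
by have := fnormZ_le k^-1 (k *: a); rewrite scalerA mulVf// scale1r.
Qed.
Lemma ler_fnormM a b : fnorm (a * b) <= fnorm a * fnorm b.
Proof.
apply: fnorm_le => i; rewrite famM; apply: le_trans (ler_cnormM _ _) _.
by rewrite ler_pM ?fnorm_ge.
Qed.
Lemma fnorm_star a : fnorm (fstar a * a) = fnorm a ^+ 2.
Proof.
apply: le_anti; apply/andP; split.
  apply: fnorm_le => i; rewrite famM fstarE cnorm_star.
  by rewrite ler_sqr ?nnegrE ?fnorm_ge0 ?fnorm_ge.
rewrite -[leRHS]sqr_sqrtr ?fnorm_ge0// ler_sqr ?nnegrE ?fnorm_ge0 ?sqrtr_ge0//.
apply: fnorm_le => i; rewrite -ler_sqr ?nnegrE ?sqrtr_ge0// sqr_sqrtr ?fnorm_ge0//.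
by rewrite -cnorm_star; exact: (fnorm_ge (fstar a * a) i).
Qed.

Lemma fnorm_complete (u : nat -> famalg) :
  (forall e : R, 0 < e -> \forall m & m' \near \oo, fnorm (u m - u m') < e) ->
  exists l : famalg, fnorm (u m - l) @[m --> \oo] --> (0 : R).
Proof.
move=> cu0; have cu : ncauchy fnorm u.
  move=> e /cu0[[S1 S2] /= [[K1 _ H1] [K2 _ H2]] S12].
  exists (maxn K1 K2) => m m'; rewrite !geq_max => /andP[h1 _] /andP[_ h2].
  by apply: (S12 (m, m')); split; [apply: H1 | apply: H2].
have ptw i : exists y, cvgC (fun m => u m i) y.
  apply: ncauchyC_cvg => e /cu[K HK]; exists K => m m' Km Km'.
  by rewrite -famB; apply: le_lt_trans (fnorm_ge _ i) (HK _ _ Km Km').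
pose l i := sval (cid (ptw i)); have Hl i : cvgC (fun m => u m i) (l i) := svalP (cid (ptw i)).
have unif e : 0 < e -> exists K, forall m, (K <= m)%N -> forall i, cnorm (u m i - l i) <= e.
  move=> e0; have [K HK] := cu e e0; exists K => m Km i.
  apply/ler_addgt0Pr => d /(Hl i)[K' HK'].
  have h1 := HK m (maxn K K') Km (leq_maxl _ _).
  have h2 := HK' (maxn K K') (leq_maxr _ _).
  have h3 := nseminorm_tri (@ler_cnormD R (D i)) (u m i) (u (maxn K K') i) (l i).
  have h4 := fnorm_ge (u m - u (maxn K K')) i; rewrite famB in h4.
  by apply: (le_trans h3); apply: lerD (ltW h2); apply: le_trans h4 (ltW h1).
have lP : approximable l.
  move=> e e0; have [K HK] := unif (e / 2) ltac:(lra).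
  have [x ux] := fvalP (u K) (e := e / 2) ltac:(lra); exists x => i.
  have := nseminorm_tri (@ler_cnormD R (D i)) (l i) (u K i) (ev i x).
  by have := ux i; have := HK K (leqnn K) i; rewrite (cnormB (l i) (u K i)); lra.
exists (FamAlg lP); apply/cvgrPdist_lt => e e0.
have [K HK] := unif (e / 2) ltac:(lra); exists K => // m Km.
rewrite sub0r normrN ger0_norm ?fnorm_ge0//.
suff : fnorm (u m - FamAlg lP) <= e / 2 by lra.
by apply: fnorm_le => i; rewrite famB; apply: HK.
Qed.

HB.instance Definition _ := isCStar.Build R famalg fstarK fstarD fstarZ fstarM
  fnorm0_eq0 ler_fnormD fnormZ ler_fnormM fnorm_star fnorm_complete.

End FamilyAlgebra.

Section Universal.
Context {R : realType} (X : Type) (one : X) (lin : R[i] -> X -> X -> X)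
  (mul : X -> X -> X) (st : X -> X).

Definition star_ev (D : cstarAlgType R) (ev : X -> D) :=
  [/\ ev one = 1, forall c x y, ev (lin c x y) = c *: ev x + ev y,
      forall x y, ev (mul x y) = ev x * ev y & forall x, ev (st x) = star (ev x)].

(* The admissible representations form a proper class, but their norm functions
   X -> R form a set, which indexes the product. *)
Theorem universal_cstar (M : X -> R) (Q : forall D : cstarAlgType R, (X -> D) -> Prop) :
  (exists (D : cstarAlgType R) (ev : X -> D), Q D ev) ->
  (forall (D : cstarAlgType R) (ev : X -> D), Q D ev -> star_ev ev) ->
  (forall (D : cstarAlgType R) (ev : X -> D), Q D ev -> forall x, cnorm (ev x) <= M x) ->
  exists (B : cstarAlgType R) (ev : X -> B),
    [/\ star_ev ev, cstar_dense (range ev),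
        forall (D : cstarAlgType R) (ev' : X -> D), Q D ev' ->
          forall x, cnorm (ev' x) <= cnorm (ev x) &
        forall x (c : R), (forall (D : cstarAlgType R) (ev' : X -> D),
          Q D ev' -> cnorm (ev' x) <= c) -> cnorm (ev x) <= c].
Proof.
move=> [D0 [ev0 Q0]] Qev QM.
pose PN (N : X -> R) := exists (D : cstarAlgType R) (ev : X -> D),
  Q D ev /\ N = fun x => cnorm (ev x).
pose I := {N : X -> R | PN N}.
(* One representation is chosen for each norm function; which one does not matter, because the
   conclusions compare norms only. *)
pose D (i : I) : cstarAlgType R := sval (cid (svalP i)).
have HD (i : I) : exists ev : X -> D i, Q (D i) ev /\ sval i = fun x => cnorm (ev x).
  exact: (svalP (cid (svalP i))).
pose ev (i : I) : X -> D i := sval (cid (HD i)).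
have HQ (i : I) : Q (D i) (ev i) by have [] := svalP (cid (HD i)).
have HN (i : I) x : sval i x = cnorm (ev i x).
  by have [_ e] := svalP (cid (HD i)); rewrite {1}e.
have i0 : I by exists (fun x => cnorm (ev0 x)); exists D0, ev0.
have [h1 h2 h3 h4 h5] : [/\ forall x, exists M : R, forall i, cnorm (ev i x) <= M,
    exists x, forall i, ev i x = 1,
    forall (c : R[i]) x y, exists z, forall i, ev i z = c *: ev i x + ev i y,
    forall x y, exists z, forall i, ev i z = ev i x * ev i y &
    forall x, exists z, forall i, ev i z = star (ev i x)].
  split=> [x||c x y|x y|x].
  - by exists (M x) => i; apply: QM.
  - by exists one => i; have [-> _ _ _] := Qev _ _ (HQ i).
  - by exists (lin c x y) => i; have [_ -> _ _] := Qev _ _ (HQ i).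
  - by exists (mul x y) => i; have [_ _ -> _] := Qev _ _ (HQ i).
  - by exists (st x) => i; have [_ _ _ ->] := Qev _ _ (HQ i).
pose F := CFamily i0 h1 h2 h3 h4 h5.
exists (famalg F), (@fev R F); split.
- split=> [|c x y|x y|x]; apply: fam_eq => i.
  + by rewrite /=; have [-> _ _ _] := Qev _ _ (HQ i).
  + by rewrite famD famZ /=; have [_ -> _ _] := Qev _ _ (HQ i).
  + by rewrite famM /=; have [_ _ -> _] := Qev _ _ (HQ i).
  + by rewrite /=; have [_ _ _ ->] := Qev _ _ (HQ i).
- move=> b e e0; have [x bx] := fvalP b (e := e / 2) ltac:(lra).
  exists (fev x); first by exists x.
  suff : cnorm (b - fev x) <= e / 2 by lra.
  by apply: fnorm_le => i; rewrite famB; exact: bx.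
- move=> D' ev' Q' x.
  have pi : PN (fun x => cnorm (ev' x)) by exists D', ev'.
  pose i : I := exist _ _ pi.
  have -> : cnorm (ev' x) = cnorm (ev i x) by rewrite -HN.
  have := @fnorm_ge R F (@fev R F x) i; exact.
- move=> x c H; apply: fnorm_le => i; exact: H (HQ i).
Qed.

End Universal.

Lemma dense_range_cvg (R : realType) (B : cstarAlgType R) (X : Type) (b : X -> B) :
  cstar_dense (range b) -> forall y, exists x : nat -> X, cvgC (fun m => b (x m)) y.
Proof.
move=> dS y; have [u uS uy] := cstar_dense_cvg dS y.
have /choice[x xu] : forall m, exists x, b x = u m.
  by move=> m; have [x _ <-] := uS m; exists x.
by exists x; rewrite (_ : (fun m => _) = u)//; apply: funext.
Qed.

Section ExtendByDensity.
Context {R : realType} (X : Type) (one : X) (lin : R[i] -> X -> X -> X)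
  (mul : X -> X -> X) (st : X -> X) (B D : cstarAlgType R) (b : X -> B) (d : X -> D).
Hypothesis bP : star_ev one lin mul st b.
Hypothesis dP : star_ev one lin mul st d.
Hypothesis bdense : cstar_dense (range b).
Hypothesis db : forall x, cnorm (d x) <= cnorm (b x).

Let dB x y : cnorm (d x - d y) <= cnorm (b x - b y).
Proof.
have [_ bl _ _] := bP; have [_ dl _ _] := dP; have := db (lin (-1) y x).
by rewrite bl dl !scaleN1r ![- _ + _]addrC.
Qed.

Let ext_ex (y : B) : exists z : D, forall x : nat -> X,
  cvgC (fun m => b (x m)) y -> cvgC (fun m => d (x m)) z.
Proof.
have [x uy] := dense_range_cvg bdense y.
have cu : ncauchy (@cnorm R D) (fun m => d (x m)).
  have := ncvg_cauchy (@ler_cnormD R B) (@cnormN R B) uy => cu e e0.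
  have [K HK] := cu e e0; exists K => m m' Km Km'.
  exact: le_lt_trans (dB _ _) (HK _ _ Km Km').
have [z dz] := ncauchyC_cvg cu; exists z => x' xy e e0.
have [K HK] := dz (e / 2) ltac:(lra); have [K' HK'] := xy (e / 4) ltac:(lra).
have [K'' HK''] := uy (e / 4) ltac:(lra).
exists (maxn K (maxn K' K'')) => m; rewrite !geq_max => /and3P[h1 h2 h3].
apply: (nseminorm_lt2 (@ler_cnormD R D) (y := d (x m))); last exact: HK.
apply: le_lt_trans (dB _ _) _.
have := nseminorm_tri (@ler_cnormD R B) (b (x' m)) y (b (x m)).
by have := HK' m h2; have := HK'' m h3; rewrite (cnormB y); lra.
Qed.

(** Since [b] dominates [d] in norm, [d] sends sequences with convergent image under [b] to
    convergent ones, with a limit depending only on that of [b]. *)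
Theorem extend_star_hom : exists F : {lrmorphism B -> D},
  star_hom F /\ forall x, F (b x) = d x.
Proof.
have /choice[f Hf] := ext_ex.
have [b1 bl bm bs] := bP; have [d1 dl dm ds] := dP.
have seqx y : exists x : nat -> X, cvgC (fun m => b (x m)) y.
  exact: dense_range_cvg.
have fb x : f (b x) = d x.
  by apply: cvgC_uniq (Hf (b x) (fun=> x) (cvgC_cst _)) (cvgC_cst _).
have fl : linear f.
  move=> c y z; have [x xy] := seqx y; have [x' xz] := seqx z.
  have E : (fun m => b (lin c (x m) (x' m))) = (fun m => c *: b (x m) + b (x' m)).
    by apply: funext => m.
  have E' : (fun m => d (lin c (x m) (x' m))) = (fun m => c *: d (x m) + d (x' m)).
    by apply: funext => m.
  have := Hf _ (fun m => lin c (x m) (x' m)); rewrite E E' => /(_ _ (cvgCD (cvgCZ c xy) xz)).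
  by move=> /cvgC_uniq; apply; apply: cvgCD (cvgCZ c (Hf _ _ xy)) (Hf _ _ xz).
have fm : {morph f : y z / y * z}.
  move=> y z; have [x xy] := seqx y; have [x' xz] := seqx z.
  have E : (fun m => b (mul (x m) (x' m))) = (fun m => b (x m) * b (x' m)).
    by apply: funext => m.
  have E' : (fun m => d (mul (x m) (x' m))) = (fun m => d (x m) * d (x' m)).
    by apply: funext => m.
  have := Hf _ (fun m => mul (x m) (x' m)); rewrite E E' => /(_ _ (cvgCM xy xz)).
  by move=> /cvgC_uniq; apply; apply: cvgCM (Hf _ _ xy) (Hf _ _ xz).
have fs y : f (star y) = star (f y).
  have [x xy] := seqx y.
  have E : (fun m => b (st (x m))) = (fun m => star (b (x m))) by apply: funext => m.
  have E' : (fun m => d (st (x m))) = (fun m => star (d (x m))) by apply: funext => m.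
  have := Hf _ (fun m => st (x m)); rewrite E E' => /(_ _ (cvgC_star xy)).
  by move=> /cvgC_uniq; apply; apply: cvgC_star (Hf _ _ xy).
have f1 : f 1 = 1 by rewrite -b1 fb d1.
have [F FE] := mk_lrmorphism fl f1 fm.
by exists F; split=> [y|x]; rewrite !FE ?fs ?fb.
Qed.

End ExtendByDensity.

Lemma star_hom_dense_eq (R : realType) (A B : cstarAlgType R) (S : set A)
    (f g : {lrmorphism A -> B}) : star_hom f -> star_hom g -> cstar_dense S ->
  (forall x, S x -> f x = g x) -> f =1 g.
Proof.
move=> fs gs dS fg x; have [u uS ux] := cstar_dense_cvg dS x.
have H (h : {lrmorphism A -> B}) : star_hom h -> cvgC (fun m => h (u m)) (h x).
  move=> hs; apply: (ncvg_comp (f := h) ler01) ux => y.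
  by rewrite -raddfB mul1r star_hom_contractive.
by apply: cvgC_uniq (H f fs) _; under eq_fun do rewrite (fg _ (uS _)); apply: H.
Qed.

Section RepBop.
Context {R : realType} (P : preHilbert R) (nz : exists x : hcompl P, x != 0).

Lemma star_rep_bop (A : cstarAlgType R)
    (Pi : A -> {linear hcompl_hilbert P -> hcompl_hilbert P}) :
  star_rep (hdot P) Pi -> exists F : {lrmorphism A -> bounded_op nz},
    star_hom F /\ forall a x, bval (F a) x = Pi a x.
Proof.
move=> [pi1 pil piM pis].
have FP a : (Pi a : hcompl P -> hcompl P) \in @bpred R P.
  apply/asboolP; split; first exact: linearP.
    by exists (Pi (star a)) => x y; exact: pis.
  exists (cnorm a) => x.
  exact: (@prerep_ipnorm R A (hcompl P) (@hip R P) (fun a => Pi a) (hip_semi P)).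
pose F a : bounded_op nz := BOp nz (FP a).
have Fl : linear F by move=> c a b; apply: bop_eq => x; exact: pil.
have F1 : F 1 = 1 by apply: bop_eq => x; exact: pi1.
have FM : {morph F : a b / a * b} by move=> a b; apply: bop_eq => x; exact: piM.
have [G GE] := mk_lrmorphism Fl F1 FM; exists G; split=> [a|a x]; rewrite !GE//.
apply: bop_eq => x; apply/esym/bstar_uniq => y z; exact: pis.
Qed.

End RepBop.

Lemma isometry_cnorm (R : realType) (A : cstarAlgType R) (a : A) :
  star a * a = 1 -> cnorm a = 1.
Proof.
move=> aa; have := cnorm_star a; rewrite aa cnorm1 => /esym/eqP.
rewrite -subr_eq0 -[X in _ - X](expr1n _ 2) subr_sqr mulf_eq0 => /orP[|/eqP h].
  by rewrite subr_eq0 => /eqP.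
by have := cnorm_ge0 a; lra.
Qed.

(** * The maximal group C*-algebra and its faithful unitaries *)

Section GroupAlgebra.
Context {R : realType} (G : groupType).
Implicit Types s t : seq (R[i] * G).

(** Elements of the group algebra are lists of coefficients and group elements without any quotient;
    only their values in C*-algebras are ever compared. *)
Definition gev (D : cstarAlgType R) (v : G -> D) s : D := \sum_(p <- s) p.1 *: v p.2.
Definition gone : seq (R[i] * G) := [:: (1, 1%g)].
Definition glin (c : R[i]) s t := [seq (c * p.1, p.2) | p <- s] ++ t.
Definition gmul s t := [seq (p.1 * q.1, (p.2 * q.2)%g) | p <- s, q <- t].
Definition gstar s := [seq (p.1^*, p.2^-1%g) | p <- s].

Lemma unitary_repV (D : cstarAlgType R) (v : G -> D) g :
  unitary_rep v -> v g^-1%g = star (v g).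
Proof.
move=> [v1 vM vU]; have [u1 u2] := vU g.
by rewrite -[LHS]mul1r -u1 -mulrA -vM mulgV v1 mulr1.
Qed.

Lemma gev_star_ev (D : cstarAlgType R) (v : G -> D) : unitary_rep v ->
  star_ev gone glin gmul gstar (gev v).
Proof.
move=> vU; have [v1 vM _] := vU; split=> [|c s t|s t|s]; rewrite /gev.
- by rewrite big_seq1 v1 scale1r.
- rewrite big_cat big_map scaler_sumr; congr (_ + _).
  by apply: eq_bigr => p _; rewrite scalerA.
- rewrite big_allpairs_dep mulr_suml; apply: eq_bigr => p _.
  rewrite mulr_sumr; apply: eq_bigr => q _ /=.
  by rewrite vM -scalerAl -scalerAr scalerA.
- rewrite big_map star_sum; apply: eq_bigr => p _.
  by rewrite starZ (unitary_repV _ vU).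
Qed.

Lemma gev_le (D : cstarAlgType R) (v : G -> D) s : unitary_rep v ->
  cnorm (gev v s) <= \sum_(p <- s) normc p.1.
Proof.
move=> [_ _ vU]; apply: le_trans (cnorm_sum _ _ _) _; rewrite le_eqVlt; apply/orP; left.
by apply/eqP/eq_bigr => p _; rewrite cnormZ isometry_cnorm ?mulr1//; have [] := vU p.2.
Qed.

Definition gkappa (x y : G) : R[i] := (x == y)%:R.

(** Grouping the terms by group element turns the double sum into a sum of squared moduli. *)
Lemma gkappa_psd : psd_kernel gkappa.
Proof.
split=> [x y|s]; first by rewrite /gkappa eq_sym conjC_nat.
pose U := undup [seq p.2 | p <- s].
have kE p q : p \in s -> q \in s ->
    gkappa p.2 q.2 = \sum_(z <- U) (p.2 == z)%:R * (q.2 == z)%:R.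
  move=> ps qs; have pU : p.2 \in U by rewrite mem_undup map_f.
  rewrite (bigD1_seq _ pU (undup_uniq _)) /= eqxx mul1r big1 ?addr0 => [|z zp].
    by rewrite /gkappa eq_sym.
  by rewrite eq_sym (negPf zp) mul0r.
rewrite (_ : \sum_(p <- s) _ = \sum_(z <- U) (\sum_(p <- s) p.1 * (p.2 == z)%:R) *
   (\sum_(p <- s) p.1 * (p.2 == z)%:R)^*).
  by apply: sumr_ge0 => z _; rewrite mulc_conj ler0c sqr_ge0.
under [RHS]eq_bigr do rewrite mulr_suml.
rewrite [RHS]exchange_big big_seq [RHS]big_seq; apply: eq_bigr => p ps.
under [RHS]eq_bigr do rewrite conjC_sum mulr_sumr.
rewrite [RHS]exchange_big big_seq [RHS]big_seq; apply: eq_bigr => q qs.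
rewrite kE// mulr_sumr; apply: eq_bigr => z _.
by rewrite conjCM conjC_nat; ring.
Qed.

Lemma gkappa_inv g x y : gkappa (g * x)%g y = gkappa x (g^-1 * y)%g.
Proof. by rewrite /gkappa -(inj_eq (mulgI g^-1%g)) mulKg. Qed.

Lemma gkappa_inv' g x y : gkappa (g^-1 * x)%g y = gkappa x (g * y)%g.
Proof. by rewrite gkappa_inv invgK. Qed.

Let P := kprehilbert gkappa_psd.

Let gshift g : ph_mod P -> ph_mod P := kmap (gkappa_inv g).
Let gshift' g : ph_mod P -> ph_mod P := kmap (gkappa_inv' g).

Let gshiftK g f : gshift' g (gshift g f) = f.
Proof. by apply/val_inj/funext => x /=; rewrite mulKg. Qed.
Let gshift'K g f : gshift g (gshift' g f) = f.
Proof. by apply/val_inj/funext => x /=; rewrite mulKVg. Qed.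

Let gshift_adj g : @adjointable R P (gshift g) (gshift' g).
Proof.
split=> [x y|x y|]; first exact/val_inj.
  exact: (kmap_adj gkappa_psd).
exists 1 => x; rewrite mul1r /ipnorm.
have -> : ph_form (gshift g x) (gshift g x) = ph_form x x; last exact: lexx.
apply: etrans (kmap_adj gkappa_psd (gkappa_inv g) (gkappa_inv' g) x (gshift g x)) _.
by congr (kform x _); exact: gshiftK.
Qed.
Let gshift'_adj g : @adjointable R P (gshift' g) (gshift g).
Proof.
split=> [x y|x y|]; first exact/val_inj.
  exact: (kmap_adj gkappa_psd).
exists 1 => x; rewrite mul1r /ipnorm.
have -> : ph_form (gshift' g x) (gshift' g x) = ph_form x x; last exact: lexx.
apply: etrans (kmap_adj gkappa_psd (gkappa_inv' g) (gkappa_inv g) x (gshift' g x)) _.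
by congr (kform x _); exact: gshift'K.
Qed.

Let delta g : hcompl P := @emb R P (kelt gkappa [:: (1, g)]).

Let delta_ip g h : hip (delta g) (delta h) = (g == h)%:R.
Proof.
rewrite hip_emb -[LHS]/(kform _ _) (kform_kelt gkappa_psd) !big_seq1 /=.
by rewrite conjC1 !mul1r.
Qed.

(** The left regular representation: the kernel space of the Kronecker delta completes to l^2(G),
    where [v g] moves the basis vector at 1 to the one at g. *)
Lemma regular_rep : exists (D : cstarAlgType R) (v : G -> D),
  unitary_rep v /\ injective v.
Proof.
have nz : exists x : hcompl P, x != 0.
  exists (delta 1%g); apply/eqP => d0; have := delta_ip 1%g 1%g.
  by rewrite d0 (ip0l (hip_semi P)) eqxx => /eqP; rewrite eq_sym oner_eq0.
have vP g : (ext (gshift_adj g) : hcompl P -> hcompl P) \in @bpred R P.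
  apply/asboolP; split; first exact: ext_linear.
    exists (ext (gshift'_adj g)) => x y; apply: ext_adj => f h.
    exact: (kmap_adj gkappa_psd).
  exists 1 => x; rewrite mul1r /ipnorm.
  rewrite (ext_adj (gshift_adj g) (gshift'_adj g)); last by move=> f h; exact: (kmap_adj gkappa_psd).
  rewrite (_ : ext _ (ext _ x) = x)//; apply/val_inj/funext => f /=.
  by congr (hval x _); first [exact: gshiftK | exact: gshift'K].
pose v g : bounded_op nz := BOp nz (vP g).
have sv g : star (v g) = v g^-1%g.
  apply: bop_eq => x; apply: bstar_uniq => y z; apply: ext_adj => f h.
  apply: etrans (kmap_adj gkappa_psd (gkappa_inv g) (gkappa_inv' g) f h) _.
  congr (kform f _).
  by apply/val_inj/funext => u /=; rewrite invgK.
have v1 : v 1%g = 1.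
  apply: bop_eq => x; apply/val_inj/funext => f /=; congr (hval x _).
  by apply/val_inj/funext => u /=; rewrite mul1g.
have vM g h : v (g * h)%g = v g * v h.
  apply: bop_eq => x; apply/val_inj/funext => f /=; congr (hval x _).
  by apply/val_inj/funext => u /=; rewrite mulgA.
exists (bounded_op nz), v; split.
  by split=> // g; rewrite sv -!vM mulVg mulgV.
move=> g h gh; have vd k : bval (v k) (delta 1%g) = delta k.
  rewrite /= /delta ext_emb; congr emb; rewrite /gshift kmap_kelt /=.
  by rewrite mulg1.
have := delta_ip g h; rewrite -(vd g) gh vd delta_ip eqxx.
by case: eqVneq => // _ /eqP; rewrite oner_eq0.
Qed.

(** The supremum over all unitary representations is finite, being at most the sum of the moduli of
    the coefficients; the regular representation is among them and keeps distinct group elements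
    apart. *)
Theorem group_cstar : exists (B : cstarAlgType R) (w : G -> B),
  max_group_cstar w /\ injective w.
Proof.
pose Q (D : cstarAlgType R) (ev : seq (R[i] * G) -> D) :=
  exists v, unitary_rep v /\ ev = gev v.
have [D0 [v0 [v0U v0I]]] := regular_rep.
have [|D ev [v [vU ->]]|D ev [v [vU ->]] s|B [ev [evP dense evQ evle]]] := @universal_cstar R _ gone glin gmul gstar
  (fun s => \sum_(p <- s) normc p.1) Q.
- by exists D0, (gev v0), v0.
- exact: gev_star_ev.
- exact: gev_le.
pose w g := ev [:: (1, g)].
have [ev1 evl evm evs] := evP.
have wU : unitary_rep w.
  have wM g h : w (g * h)%g = w g * w h by rewrite /w -evm /gmul /= mulr1.
  have ws g : star (w g) = w g^-1%g by rewrite /w -evs /gstar /= conjC1.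
  by split=> // g; rewrite ws -!wM mulVg mulgV.
have evE : ev = gev w.
  apply: funext; elim=> [|[c g] s IH].
    have := evl (-1) gone gone; rewrite /gev big_nil scaleN1r addNr => e0.
    apply: cnorm_le0; have : cnorm (ev [::]) <= 0; last by [].
    apply: evle => D _ [v [_ ->]]; by rewrite /gev big_nil cnorm0.
  have := evl c [:: (1, g)] s; rewrite /glin /= mulr1 IH => ->.
  by rewrite /gev big_cons.
exists B, w; split; last first.
  move=> g h gh; apply: v0I; have := evQ _ _ (ex_intro _ v0 (conj v0U erefl)) [:: (1, g); (-1, h)].
  rewrite evE /gev !big_cons !big_nil !addr0 /= !scale1r !scaleN1r gh subrr cnorm0.
  by move=> /cnorm_le0/eqP; rewrite subr_eq0 => /eqP.
split=> //.
  move=> x e e0; have [_ [s _ <-] sx] := dense x e e0; exists (ev s) => //.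
  move=> S [[S1 Sl SM Ss] wS]; rewrite evE /gev; elim: s {sx} => [|p s IH].
    by rewrite big_nil; have := Sl (-1) 1 1 S1 S1; rewrite scaleN1r addNr.
  by rewrite big_cons; apply: Sl => //; apply: wS; exists p.2.
move=> D v vU.
have [F [Fs FE]] := extend_star_hom evP (gev_star_ev vU) dense
  (fun s => evQ D (gev v) (ex_intro _ v (conj vU erefl)) s).
by exists F; split=> // g; rewrite FE /gev big_seq1 scale1r.
Qed.

End GroupAlgebra.

(** * Spatial tensor products *)

Section KernelRepresentation.
Context {R : realType} {A : cstarAlgType R} {X : Type} (kappa : X -> X -> R[i]).
Context (kP : psd_kernel kappa) (act : A -> X -> X).
Hypothesis act1 : forall p, act 1 p = p.
Hypothesis actM : forall a b p, act (a * b) p = act a (act b p).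
Hypothesis act_lin : forall (c : R[i]) a b p q,
  kappa q (act (c *: a + b) p) = c^* * kappa q (act a p) + kappa q (act b p).
Hypothesis act_adj : forall a p q, kappa (act a p) q = kappa p (act (star a) q).

Let P := kprehilbert kP.

(** The algebra acts on points only, so linearity in the algebra element has to be expressed after
    pairing with the kernel, whose second argument is the conjugate-linear one. *)
Lemma kernel_rep : exists2 Pi : A -> {linear hcompl_hilbert P -> hcompl_hilbert P},
  star_rep (hdot P) Pi & forall a s,
    Pi a (@emb R P (kelt kappa s)) = @emb R P (kelt kappa [seq (p.1, act a p.2) | p <- s]).
Proof.
pose pi a : ph_mod P -> ph_mod P := kmap (act_adj a).
have [|||||Pi PiP PiE] := @prerep_complete R A P pi.
- by move=> a x y; apply/val_inj.
- by move=> x; apply/val_inj/funext => p; rewrite /= star1 act1.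
- move=> c a b x; apply/val_inj/funext => p.
  rewrite -[RHS]/(c * kval x (act (star a) p) + kval x (act (star b) p)) /=.
  rewrite starD starZ krepE /kfun mulr_sumr -big_split; apply: eq_bigr => q _ /=.
  by rewrite act_lin conjCK; ring.
- by move=> a b x; apply/val_inj/funext => p; rewrite /= starM actM.
- move=> a x y; have aa' p q : kappa (act (star a) p) q = kappa p (act a q).
    by rewrite act_adj starK.
  apply: etrans (kmap_adj kP (act_adj a) aa' x y) _; congr (kform x _).
  by apply/val_inj/funext => p; rewrite /= starK.
exists Pi => // a s; rewrite PiE; congr emb; exact: kmap_kelt.
Qed.

End KernelRepresentation.

(** For [emb v] close to x, the finite norm of T controls T (x - emb v), and its size is irrelevant
    in the limit. *)
Lemma bop_bound_dense (R : realType) (P : preHilbert R)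
    (nz : exists x : hcompl P, x != 0) (T : bounded_op nz) (c : R) : 0 <= c ->
  (forall v, ipnorm (@hip R P) (T (emb v)) <= c * ipnorm (@hip R P) (emb v)) ->
  cnorm T <= c.
Proof.
move=> c0 Tc; apply: bnorm_le => // x.
have [v _ vx] := emb_dense x; have hP := hip_semi P.
pose N := ipnorm (@hip R P).
have ND y z : N (y + z) <= N y + N z by exact: ipnormD.
have key (a b d e : R) : 0 <= d -> (forall r : R, 0 < r -> a <= d * r + c * (b + r)) -> a <= c * b.
  move=> d0 H; apply/ler_addgt0Pr => r r0.
  have s0 : 0 < d + c + 1 by lra.
  have := H (r / (d + c + 1)); rewrite divr_gt0// => /(_ isT) h.
  apply: le_trans h _; rewrite mulrDr addrCA lerD2l -mulrDl mulrC -mulrA ler_piMr//; first lra.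
  by rewrite mulrC ler_pdivrMr// mul1r; lra.
apply: (key (N (T x)) (N x) (bnorm T) 0 (bnorm_ge0 T)) => r r0.
have [K /(_ _ (leqnn K))] := vx r r0; rewrite -/N /= => h.
have h1 : N (T x) <= N (T (x - emb (v K))) + N (T (emb (v K))).
  by have := ND (T (x - emb (v K))) (T (emb (v K))); rewrite -bopD subrK.
have h2 : N (T (x - emb (v K))) <= bnorm T * N (x - emb (v K)) by apply: bnormP.
have h3 : N (x - emb (v K)) < r by rewrite -[N _](ipnormN hP) opprB.
have h4 : N (emb (v K)) <= N x + r.
  have := ND (emb (v K) - x) x; rewrite subrK => h4; apply: le_trans h4 _.
  by rewrite addrC lerD2l ltW.
apply: le_trans h1 _; apply: lerD.
  by apply: le_trans h2 _; rewrite ler_wpM2l ?bnorm_ge0// ltW.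
by apply: le_trans (Tc _) _; rewrite ler_wpM2l.
Qed.

Section TensorRepresentation.
Context {R : realType} {A B : cstarAlgType R} (H K : completeNormedModType R[i])
  (ipH : {dot H for @Num.conj R[i]}) (ipK : {dot K for @Num.conj R[i]})
  (pi : A -> {linear H -> H}) (rho : B -> {linear K -> K}).
Hypothesis piP : star_rep ipH pi.
Hypothesis rhoP : star_rep ipK rho.
Let hH := dot_semi_ip ipH.
Let hK := dot_semi_ip ipK.

(** The kernel space of this kernel on pairs is the algebraic tensor product of H and K modulo null
    vectors, a pair standing for its elementary tensor. *)
Definition tkappa (p q : H * K) : R[i] := ipH p.1 q.1 * ipK p.2 q.2.

Lemma tkappa_psd : psd_kernel tkappa.
Proof.
split=> [p q|s].
  by have [_ gH _] := hH; have [_ kH _] := hK; rewrite /tkappa gH kH conjCM.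
rewrite (_ : \sum_(p <- s) _ = tform ipH ipK [seq (p.1 *: p.2.1, p.2.2) | p <- s]
   [seq (p.1 *: p.2.1, p.2.2) | p <- s]); first exact: tform_ge0.
rewrite /tform big_map; apply: eq_bigr => p _; rewrite big_map; apply: eq_bigr => q _ /=.
by rewrite (ipZl hH) (ipZr hH) /tkappa; ring.
Qed.

Let P := kprehilbert tkappa_psd.
Let tk := @kelt R (H * K) tkappa.
Let N := ipnorm (@hip R P).

Definition tens (s : seq (H * K)) : hcompl P := @emb R P (tk [seq (1, p) | p <- s]).

Lemma tens_norm s : ((N (tens s) ^+ 2)%:C)%C = tensor_sqnorm ipH ipK s.
Proof.
rewrite -(ipnormE (hip_semi P)) hip_emb -[LHS]/(kform _ _) (kform_kelt tkappa_psd).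
rewrite big_map; apply: eq_bigr => p _; rewrite big_map; apply: eq_bigr => q _ /=.
by rewrite conjC1 !mul1r.
Qed.

Lemma tens_ex (v : ph_mod P) : exists s, v = tk [seq (1, p) | p <- s].
Proof.
exists [seq (p.1 *: p.2.1, p.2.2) | p <- krep v]; apply/val_inj/funext => q.
rewrite /= krepE /kfun -map_comp big_map; apply: eq_bigr => p _ /=.
by rewrite /tkappa (ipZl hH) mul1r mulrA.
Qed.

(** Acting on one component of the pairs preserves the kernel structure, which gives two
    representations on the completion; the unit vectors serve to show that it is nonzero. Operator
    norms can be tested on sums of elementary tensors by [bop_bound_dense]. *)
Theorem tensor_rep (x0 : H) (y0 : K) : ipH x0 x0 = 1 -> ipK y0 y0 = 1 ->
  exists (D : cstarAlgType R) (j1 : {lrmorphism A -> D}) (j2 : {lrmorphism B -> D}),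
  [/\ star_hom j1, star_hom j2, forall a b, j1 a * j2 b = j2 b * j1 a &
    forall (t : seq (A * B)) (c : R), 0 <= c ->
      (cnorm (\sum_(a <- t) j1 a.1 * j2 a.2) <= c <->
       forall s, tensor_sqnorm ipH ipK [seq (pi a.1 x.1, rho a.2 x.2) | a <- t, x <- s]
         <= (c ^+ 2)%:C%C * tensor_sqnorm ipH ipK s)].
Proof.
move=> x1 y1.
have nz : exists x : hcompl P, x != 0.
  exists (tens [:: (x0, y0)]); apply/eqP => d0; have := tens_norm [:: (x0, y0)].
  rewrite d0 /N (ipnorm0 (hip_semi P)) /tensor_sqnorm !big_seq1 /= x1 y1 mulr1.
  by rewrite expr0n => /eqP; rewrite eq_sym oner_eq0.
have [pi1 pil piM pis] := piP; have [rho1 rhol rhoM rhos] := rhoP.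
have [||||PiA PiAP PiAE] := @kernel_rep R A _ _ tkappa_psd (fun a p => (pi a p.1, p.2)).
- by move=> [x y]; rewrite pi1.
- by move=> a b [x y]; rewrite /= piM.
- by move=> c a b p q; rewrite /tkappa /= pil (ipDr hH) (ipZr hH) mulrDl mulrA.
- by move=> a p q; rewrite /tkappa /= pis.
have [||||PiB PiBP PiBE] := @kernel_rep R B _ _ tkappa_psd (fun a p => (p.1, rho a p.2)).
- by move=> [x y]; rewrite rho1.
- by move=> a b [x y]; rewrite /= rhoM.
- by move=> c a b p q; rewrite /tkappa /= rhol (ipDr hK) (ipZr hK) mulrDr; ring.
- by move=> a p q; rewrite /tkappa /= rhos.
have [j1 [j1s j1E]] := star_rep_bop nz PiAP.
have [j2 [j2s j2E]] := star_rep_bop nz PiBP.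
have jtens a b s : bval (j1 a * j2 b) (tens s) = tens [seq (pi a p.1, rho b p.2) | p <- s].
  rewrite -[LHS]/(bval (j1 a) (bval (j2 b) (tens s))) j1E j2E /tens PiBE PiAE.
  by rewrite -!map_comp.
have jtens' a b s : bval (j2 b * j1 a) (tens s) = tens [seq (pi a p.1, rho b p.2) | p <- s].
  rewrite -[LHS]/(bval (j2 b) (bval (j1 a) (tens s))) j1E j2E /tens PiAE PiBE.
  by rewrite -!map_comp.
have tens_cat s s' : tens (s ++ s') = tens s + tens s'.
  apply/val_inj/funext => v /=; rewrite -[RHS]/(_ + _).
  rewrite -(ipDl (kform_semi tkappa_psd)); congr (kform _ v); apply/val_inj/funext => p.
  by rewrite -[RHS]/(_ + _) /= /kfun map_cat big_cat.
exists (bounded_op nz), j1, j2; split=> //.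
  (* Vectors of the completion are functionals on the pre-Hilbert space, so commutation is tested
     there: adjoints move both products onto elementary tensors, where they agree. *)
  move=> a b; apply: bop_eq => x; apply/val_inj/funext => v.
  apply: etrans (esym (hip_embr (bval (j1 a * j2 b) x) v)) _.
  apply: etrans _ (hip_embr (bval (j2 b * j1 a) x) v).
  have [s ->] := tens_ex v; rewrite -/(tens s).
  have adj (T : bounded_op nz) y z : hip (T y) z = hip y (bval (star T) z).
    exact: bstarP.
  by rewrite !adj !starM -j1s -j2s jtens jtens'.
move=> t c c0; set Phi := \sum_(a <- t) _.
have PhiE s : bval Phi (tens s) = tens [seq (pi a.1 x.1, rho a.2 x.2) | a <- t, x <- s].
  rewrite /Phi; elim: (t) => [|a t' IH].
    rewrite big_nil /=; apply/val_inj/funext => v.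
    by apply/esym/big1 => p _; rewrite /= /kfun big_nil mulr0.
  have addE (S T : bounded_op nz) y : bval (S + T) y = bval S y + bval T y by [].
  by rewrite big_cons addE IH jtens -tens_cat.
have sqE s d : 0 <= d -> (tensor_sqnorm ipH ipK [seq (pi a.1 x.1, rho a.2 x.2) | a <- t, x <- s]
    <= (d ^+ 2)%:C%C * tensor_sqnorm ipH ipK s) = (N (bval Phi (tens s)) <= d * N (tens s)).
  move=> d0; rewrite PhiE -!tens_norm -rcM -exprMn lecR ler_sqr ?nnegrE//.
    exact: ipnorm_ge0.
  by rewrite mulr_ge0 ?ipnorm_ge0.
split=> [cP s|H'].
  rewrite sqE//; apply: le_trans (bnormP Phi _) _.
  by rewrite ler_wpM2r ?ipnorm_ge0.
apply: bop_bound_dense => // v; have [s ->] := tens_ex v.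
by rewrite -sqE.
Qed.

End TensorRepresentation.

Section SpatialTensor.
Context {R : realType} (A B : cstarAlgType R).
Implicit Types s t : seq (A * B).

Definition tev (D : cstarAlgType R) (j1 : A -> D) (j2 : B -> D) t : D :=
  \sum_(a <- t) j1 a.1 * j2 a.2.
Definition tone : seq (A * B) := [:: (1, 1)].
Definition tlin (c : R[i]) s t := [seq (c *: p.1, p.2) | p <- s] ++ t.
Definition tmul s t := [seq (p.1 * q.1, p.2 * q.2) | p <- s, q <- t].
Definition tstar s := [seq (star p.1, star p.2) | p <- s].

Lemma tev_star_ev (D : cstarAlgType R) (j1 : {lrmorphism A -> D})
    (j2 : {lrmorphism B -> D}) : star_hom j1 -> star_hom j2 ->
  (forall a b, j1 a * j2 b = j2 b * j1 a) -> star_ev tone tlin tmul tstar (tev j1 j2).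
Proof.
move=> s1 s2 comm; split=> [|c s t|s t|s]; rewrite /tev.
- by rewrite big_seq1 !rmorph1 mulr1.
- rewrite big_cat big_map scaler_sumr; congr (_ + _).
  by apply: eq_bigr => p _; rewrite linearZ -scalerAl.
- rewrite big_allpairs_dep mulr_suml; apply: eq_bigr => p _.
  rewrite mulr_sumr; apply: eq_bigr => q _ /=.
  by rewrite !rmorphM -!mulrA; congr (_ * _); rewrite !mulrA comm.
- rewrite big_map star_sum; apply: eq_bigr => p _ /=.
  by rewrite comm starM s1 s2.
Qed.

(** The spatial norm also quantifies over zero Hilbert spaces; there the form vanishes and the
    required bound is trivial. *)
Lemma unit_vector (H : completeNormedModType R[i]) (ip : {dot H for @Num.conj R[i]}) :
  (exists x, ip x x = 1) \/ (forall x y, ip x y = 0).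
Proof.
have hP := dot_semi_ip ip.
have [[x x0]|/forallNP h] := pselect (exists x, ip x x <> 0); last first.
  right=> x y; apply: eq0_normc; apply/eqP; rewrite eq_le normc_ge0 andbT.
  apply: le_trans (ip_cauchy_schwarz hP _ _) _.
  have x0 : ip x x = 0 by apply: contrapT (h x).
  by rewrite {1}/ipnorm x0 sqrtr0 mul0r.
left; have n0 : ipnorm ip x != 0.
  by apply/eqP => n0; apply: x0; rewrite (ipnormE hP) n0 expr0n.
exists (((ipnorm ip x)^-1)%:C%C *: x).
rewrite (ipZl hP) (ipZr hP) conjC_rc (ipnormE hP) -!rcM.
by rewrite (_ : _ * _ = 1)//; field.
Qed.

(** The spatial norm is a supremum over pairs of representations, so T is the universal algebra for
    evaluations through such pairs. [Q] records that the norm of an evaluation is the one tested on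
    the elementary tensors of its pair. *)
Theorem spatial_tensor : exists (T : cstarAlgType R) (i1 : {lrmorphism A -> T})
  (i2 : {lrmorphism B -> T}), is_tensor i1 i2.
Proof.
pose Q (D : cstarAlgType R) (ev : seq (A * B) -> D) :=
  exists (j1 : {lrmorphism A -> D}) (j2 : {lrmorphism B -> D})
    (H K : completeNormedModType R[i])
    (ipH : {dot H for @Num.conj R[i]}) (ipK : {dot K for @Num.conj R[i]})
    (pi : A -> {linear H -> H}) (rho : B -> {linear K -> K}),
  [/\ [/\ star_hom j1, star_hom j2 & forall a b, j1 a * j2 b = j2 b * j1 a],
      [/\ hilbert ipH, hilbert ipK, star_rep ipH pi & star_rep ipK rho],
      ev = tev j1 j2 &
      forall (t : seq (A * B)) (c : R), 0 <= c ->
      (cnorm (tev j1 j2 t) <= c <->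
       forall s : seq (H * K), tensor_sqnorm ipH ipK [seq (pi a.1 x.1, rho a.2 x.2) | a <- t, x <- s]
         <= (c ^+ 2)%:C%C * tensor_sqnorm ipH ipK s)].
have exQ (H K : completeNormedModType R[i])
    (ipH : {dot H for @Num.conj R[i]}) (ipK : {dot K for @Num.conj R[i]})
    (pi : A -> {linear H -> H}) (rho : B -> {linear K -> K}) x y :
    hilbert ipH -> hilbert ipK -> star_rep ipH pi -> star_rep ipK rho ->
    ipH x x = 1 -> ipK y y = 1 ->
    exists (D : cstarAlgType R) (ev : seq (A * B) -> D), Q D ev /\
      forall (t : seq (A * B)) (c : R), 0 <= c ->
      (cnorm (ev t) <= c <->
       forall s : seq (H * K), tensor_sqnorm ipH ipK [seq (pi a.1 x.1, rho a.2 x.2) | a <- t, x <- s]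
         <= (c ^+ 2)%:C%C * tensor_sqnorm ipH ipK s).
  move=> hH hK rH rK x1 y1; have [D [j1 [j2 [s1 s2 comm nrm]]]] := tensor_rep rH rK x1 y1.
  by exists D, (tev j1 j2); split=> //; exists j1, j2, H, K, ipH, ipK, pi, rho.
have [|D ev [j1 [j2 [H [K [ipH [ipK [pi [rho [[s1 s2 comm] _ -> _]]]]]]]]]
    |D ev [j1 [j2 [H [K [ipH [ipK [pi [rho [[s1 s2 _] _ -> _]]]]]]]]] t
    |T [ev [evP dense evQ evle]]] :=
    @universal_cstar R _ tone tlin tmul tstar (fun t => \sum_(p <- t) cnorm p.1 * cnorm p.2) Q.
- have [H [ipH [pi [x [hH rH x1 _]]]]] := gns (1 : A).
  have [K [ipK [rho [y [hK rK y1 _]]]]] := gns (1 : B).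
  have [D [ev [QD _]]] := exQ _ _ _ _ _ _ _ _ hH hK rH rK x1 y1.
  by exists D, ev.
- exact: tev_star_ev.
- apply: le_trans (cnorm_sum _ _ _) _; apply: ler_sum => p _.
  apply: le_trans (ler_cnormM _ _) _.
  by rewrite ler_pM ?star_hom_contractive.
have [ev1 evl evm evs] := evP.
(* Formal sums with equal values under all pairs of morphisms coincide in T, because the norm of
   their difference is a supremum of zeros. *)
have ev_eq s t : (forall (D : cstarAlgType R) (j1 : {lrmorphism A -> D})
    (j2 : {lrmorphism B -> D}), tev j1 j2 s = tev j1 j2 t) -> ev s = ev t.
  move=> st; apply/eqP; rewrite -subr_eq0; apply/eqP/cnorm_le0.
  have -> : ev s - ev t = ev (tlin (-1) t s) by rewrite evl scaleN1r addrC.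
  apply: evle => D ev' [j1 [j2 [H [K [ipH [ipK [pi [rho [[s1 s2 comm] _ -> _]]]]]]]]].
  have [_ jl _ _] := tev_star_ev s1 s2 comm.
  by rewrite jl st scaleN1r addNr cnorm0.
have [|||i1 i1E] := @mk_lrmorphism R A T (fun a => ev [:: (a, 1)]).
- move=> c a b; rewrite -evl; apply: ev_eq => D j1 j2.
  by rewrite /tev !big_cons big_nil /= !rmorph1 !mulr1 !addr0 linearP linearZ.
- exact: ev1.
- move=> a b; rewrite -evm; apply: ev_eq => D j1 j2.
  by rewrite /tev !big_cons big_nil /= mulr1.
have [|||i2 i2E] := @mk_lrmorphism R B T (fun b => ev [:: (1, b)]).
- move=> c a b; rewrite -evl; apply: ev_eq => D j1 j2.
  rewrite /tev !big_cons big_nil /= [j1 (c *: 1)]linearZ !rmorph1 -scalerAl !mul1r !addr0.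
  by rewrite linearP.
- exact: ev1.
- move=> a b; rewrite -evm; apply: ev_eq => D j1 j2.
  by rewrite /tev !big_cons big_nil /= mulr1.
have i12 a b : i1 a * i2 b = ev [:: (a, b)].
  by rewrite i1E i2E -evm /tmul /= mulr1 mul1r.
have evE t : ev t = \sum_(a <- t) i1 a.1 * i2 a.2.
  elim: t => [|[a b] t IH].
    rewrite big_nil -(subrr (ev tone)) addrC -scaleN1r -evl.
    apply: ev_eq => D j1 j2.
    by rewrite /tev !big_cons !big_nil /= [j1 (_ *: _)]linearZ_LR !rmorph1 !mulr1 addr0 scaleN1r addNr.
  rewrite big_cons -IH i12 -[ev [:: _]]scale1r -evl; apply: ev_eq => D j1 j2.
  by rewrite /tev !big_cons /= scale1r.
exists T, i1, i2; split.
- split=> a; [rewrite !i1E | rewrite !i2E]; rewrite -evs /tstar /=.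
    by rewrite (star1 (A := B)).
  by rewrite (star1 (A := A)).
- move=> a b; rewrite i12 i1E i2E -evm /tmul /=.
  by rewrite mulr1 mul1r.
- move=> x e e0; have [_ [t _ <-] xt] := dense x e e0; exists (ev t) => //.
  by exists t.
move=> t c c0; rewrite -evE; split=> [tc H K ipH ipK pi rho hH hK rH rK s|tsp].
  have [[x x1]|z] := unit_vector ipH; last first.
    rewrite /tensor_sqnorm [leLHS]big1; last by move=> *; rewrite big1// => *; rewrite z mul0r.
    by rewrite big1 ?mulr0// => *; rewrite big1// => *; rewrite z mul0r.
  have [[y y1]|z] := unit_vector ipK; last first.
    rewrite /tensor_sqnorm [leLHS]big1; last by move=> *; rewrite big1// => *; rewrite z mulr0.
    by rewrite big1 ?mulr0// => *; rewrite big1// => *; rewrite z mulr0.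
  have [D [ev' [QD nrm]]] := exQ _ _ _ _ _ _ _ _ hH hK rH rK x1 y1.
  by apply: (nrm t c c0).1; apply: le_trans tc; apply: evQ.
apply: evle => D ev' [j1 [j2 [H [K [ipH [ipK [pi [rho [_ [hH hK rH rK] -> nrm]]]]]]]]].
by apply/(nrm t c c0) => s; apply: tsp.
Qed.

End SpatialTensor.

(** * The tensor product with C(S_n) as an algebra of functions *)

Section PermutationAlgebra.
Context {R : realType} (n : nat) (B : cstarAlgType R).

Definition csym_delta (s : 'S_n) : csym R n := [ffun t => (t == s)%:R].

Lemma csym_sumE (I : Type) (r : seq I) (f : I -> csym R n) t :
  (\sum_(i <- r) f i) t = \sum_(i <- r) f i t.
Proof.
by elim: r => [|i r IH]; rewrite ?(big_nil, big_cons) ffunE// IH.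
Qed.

Lemma csym_decomp (f : csym R n) : f = \sum_s f s *: csym_delta s.
Proof.
apply/ffunP => t; rewrite csym_sumE; under eq_bigr do rewrite csymZE ffunE.
rewrite (bigD1 t)//= eqxx mulr1 big1 ?addr0// => s.
by rewrite eq_sym => /negPf->; rewrite mulr0.
Qed.

Lemma csym_delta_mul s t : csym_delta s * csym_delta t = (s == t)%:R *: csym_delta s.
Proof.
apply/ffunP => r; rewrite csymZE !ffunE.
by have [->|_] := eqVneq r s; rewrite ?mul1r ?mulr1 ?mul0r ?mulr0.
Qed.

Lemma csym_delta_star s : star (csym_delta s) = csym_delta s.
Proof. by apply/ffunP => t; rewrite !ffunE conjC_nat. Qed.

Lemma csym_delta_sum : \sum_s csym_delta s = 1.
Proof.
apply/ffunP => t; rewrite csym_sumE (bigD1 t)//= !ffunE eqxx big1 ?addr0//.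
by move=> s st; rewrite ffunE eq_sym (negPf st).
Qed.

Definition perm_family : cfamily R.
Proof.
pose ev (s : 'S_n) (f : 'S_n -> B) := f s.
apply: (@CFamily R 'S_n 1%g (fun=> B) ('S_n -> B) ev).
- move=> f; exists (\sum_s cnorm (f s)) => s; rewrite (bigD1 s)//= lerDl.
  by apply: sumr_ge0 => *; apply: cnorm_ge0.
- by exists (fun=> 1).
- by move=> c x y; exists (fun s => c *: x s + y s).
- by move=> x y; exists (fun s => x s * y s).
- by move=> x; exists (fun s => star (x s)).
Defined.

(* T is the algebra of functions S_n -> B, and [e s] is the evaluation at s. *)
Theorem perm_tensor : exists (T : cstarAlgType R) (i1 : {lrmorphism B -> T})
    (i2 : {lrmorphism csym R n -> T}) (e : 'S_n -> {lrmorphism T -> B}),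
  [/\ is_tensor i1 i2, forall s, star_hom (e s),
      forall x y, (forall s, e s x = e s y) -> x = y,
      forall f : 'S_n -> B, exists x, forall s, e s x = f s &
      (forall s b, e s (i1 b) = b) /\ forall s f, e s (i2 f) = (f s)%:A].
Proof.
pose T : cstarAlgType R := famalg perm_family.
pose el (f : 'S_n -> B) : T := @fev R perm_family f.
have /choice[e He] : forall s : 'S_n, exists e : {lrmorphism T -> B},
    forall x : famalg perm_family, e x = fval x s.
  move=> s; have [|||e eE] := @mk_lrmorphism R T B (fun x : famalg perm_family => fval x s).
  - by move=> c x y; rewrite famD famZ.
  - by [].
  - by [].
  - by exists e.
have ext (x y : T) : (forall s, e s x = e s y) -> x = y.
  by move=> xy; apply: fam_eq => s; have := xy s; rewrite !He.
have es s : star_hom (e s) by move=> x; rewrite !He.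
have elE f s : e s (el f) = f s by rewrite He.
have [|||i1 i1E] := @mk_lrmorphism R B T (fun b => el (fun=> b)).
- by move=> c a b; apply: ext => s; rewrite linearP /= !elE.
- by apply: ext => s; rewrite elE rmorph1.
- by move=> a b; apply: ext => s; rewrite rmorphM /= !elE.
have [|||i2 i2E] := @mk_lrmorphism R (csym R n) T (fun f => el (fun s => (f s)%:A)).
- by move=> c a b; apply: ext => s; rewrite linearP /= !elE ffunE csymZE scalerDl scalerA.
- by apply: ext => s; rewrite elE rmorph1 ffunE scale1r.
- by move=> a b; apply: ext => s; rewrite rmorphM /= !elE ffunE -scalerAl mul1r scalerA.
have e1 s b : e s (i1 b) = b by rewrite i1E elE.
have e2 s f : e s (i2 f) = (f s)%:A by rewrite i2E elE.
exists T, i1, i2, e; split=> //; last by move=> f; exists (el f).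
have esum s t : e s (\sum_(a <- t) i1 a.1 * i2 a.2) = \sum_(a <- t) a.2 s *: a.1.
  by rewrite raddf_sum; apply: eq_bigr => a _ /=; rewrite rmorphM /= e1 e2 mulr_algr.
have normE (x : T) (c : R) : cnorm x <= c <-> forall s, cnorm (e s x) <= c.
  split=> [xc s|xc]; first by rewrite He; apply: le_trans xc; exact: (@fnorm_ge R perm_family x s).
  by apply: fnorm_le => s; rewrite -He.
split.
- split=> [b|f]; apply: ext => s; rewrite es ?e1 ?e2//.
  by rewrite starZ star1 ffunE.
- by move=> a f; apply: ext => s; rewrite !rmorphM /= e1 e2 mulr_algr mulr_algl.
- move=> x r r0; exists x; last by rewrite subrr cnorm0.
  exists [seq (e s x, csym_delta s) | s <- enum 'S_n]; apply: ext => s.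
  rewrite esum big_map big_enum (bigD1 s)//= ffunE eqxx scale1r big1 ?addr0//.
  by move=> t ts; rewrite ffunE eq_sym (negPf ts) scale0r.
move=> t c c0; rewrite normE; split=> [tc H K ipH ipK pi rho hH hK rH rK s|tsp s].
  have gH := dot_semi_ip ipH; have gK := dot_semi_ip ipK.
  pose b r := \sum_(a <- t) a.2 r *: a.1.
  have bc r : cnorm (b r) <= c by rewrite /b -esum.
  have [pi1 pil piM pis] := rH; have [rho1 rhol rhoM rhos] := rK.
  have pi0 x : pi 0 x = 0 by apply: (prerep0 (pi := fun a => pi a)).
  have rho0 x : rho 0 x = 0 by apply: (prerep0 (pi := fun a => rho a)).
  have pi_sum r x : pi (b r) x = \sum_(a <- t) a.2 r *: pi a.1 x.
    rewrite /b; elim: (t) => [|a t' IH]; first by rewrite !big_nil pi0.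
    by rewrite !big_cons pil IH.
  have rho_sum f y : rho f y = \sum_r f r *: rho (csym_delta r) y.
    rewrite {1}(csym_decomp f); elim: (index_enum _) => [|r l IH].
      by rewrite !big_nil rho0.
    by rewrite !big_cons rhol IH.
  have ipK_rho f f' y z : ipK (rho f y) (rho f' z) =
      \sum_r f r * (f' r)^* * ipK (rho (csym_delta r) y) (rho (csym_delta r) z).
    have dd r r' : ipK (rho (csym_delta r) y) (rho (csym_delta r') z) =
        (r == r')%:R * ipK (rho (csym_delta r) y) (rho (csym_delta r) z).
      rewrite !rhos !csym_delta_star -!rhoM !csym_delta_mul eqxx scale1r.
      have -> : (r == r')%:R *: csym_delta r = (r == r')%:R *: csym_delta r + 0 by rewrite addr0.
      by rewrite rhol rho0 addr0 (ipZr gK) conjC_nat.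
    rewrite (rho_sum f) (ip_suml gK); apply: eq_bigr => r _.
    rewrite (ipZl gK) (rho_sum f' z) (ip_sumr gK) (bigD1 r)//= big1 ?addr0.
      by rewrite (ipZr gK) mulrA.
    by move=> r' rr'; rewrite (ipZr gK) dd eq_sym (negPf rr') mul0r mulr0.
  (* The projections rho (delta_r) are orthogonal of sum 1, so they split the represented operator
     into the blocks pi (b r); both sides of the bound become sums over r. *)
  pose sq (u : 'S_n -> B) := \sum_r tform ipH ipK
    [seq (pi (u r) x.1, rho (csym_delta r) x.2) | x <- s]
    [seq (pi (u r) x.1, rho (csym_delta r) x.2) | x <- s].
  have lhsE : tensor_sqnorm ipH ipK [seq (pi a.1 x.1, rho a.2 x.2) | a <- t, x <- s] = sq b.
    rewrite /tensor_sqnorm big_allpairs_dep.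
    under eq_bigr => a _ do under eq_bigr => x _ do rewrite big_allpairs_dep /=.
    under eq_bigr => a _ do under eq_bigr => x _ do rewrite exchange_big /=.
    rewrite exchange_big /= /sq /tform.
    under [RHS]eq_bigr => r _ do rewrite big_map /=.
    rewrite [RHS]exchange_big; apply: eq_bigr => x _ /=.
    under [RHS]eq_bigr => r _ do rewrite big_map /=.
    rewrite exchange_big [RHS]exchange_big; apply: eq_bigr => y _ /=.
    under eq_bigr => a _ do under eq_bigr => a' _ do rewrite ipK_rho mulr_sumr.
    under eq_bigr => a _ do rewrite exchange_big /=.
    rewrite exchange_big; apply: eq_bigr => r _ /=.
    rewrite !pi_sum (ip_suml gH) mulr_suml; apply: eq_bigr => a _.
    rewrite (ip_sumr gH) mulr_suml; apply: eq_bigr => a' _.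
    by rewrite (ipZl gH) (ipZr gH); ring.
  have rhsE : tensor_sqnorm ipH ipK s = sq (fun=> 1).
    rewrite /sq /tensor_sqnorm /tform.
    under [RHS]eq_bigr => r _ do rewrite big_map /=.
    rewrite [RHS]exchange_big; apply: eq_bigr => x _ /=.
    under [RHS]eq_bigr => r _ do rewrite big_map /=.
    rewrite [RHS]exchange_big; apply: eq_bigr => y _ /=.
    rewrite !pi1 -mulr_sumr; congr (_ * _); rewrite -[in LHS](rho1 x.2) -[in LHS](rho1 y.2).
    by rewrite ipK_rho; apply: eq_bigr => r _; rewrite ffunE conjC1 !mul1r.
  rewrite lhsE rhsE /sq mulr_sumr; apply: ler_sum => r _.
  (* In each block the difference of the two sides is the form of a single list, transformed by the
     square root [k] of this positive element. *)
  have pc : pos (rs (c ^+ 2) - star (b r) * b r).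
    have := posD (pos_norm_sub (sa_sM (b r))) (pos_rs (r := c ^+ 2 - cnorm (star (b r) * b r)) _).
    rewrite cnorm_star addrAC -rsD [_ + (_ - _)]addrC subrK; apply.
    by rewrite subr_ge0 ler_sqr ?nnegrE.
  have [k [[sk _] hk _]] := pos_sqrt pc.
  have := tform_ge0 gH gK [seq (pi k x.1, rho (csym_delta r) x.2) | x <- s].
  rewrite -subr_ge0; congr (0 <= _); rewrite /tform !big_map mulr_sumr -sumrB.
  apply: eq_bigr => x _; rewrite !big_map mulr_sumr -sumrB; apply: eq_bigr => y _ /=.
  rewrite !pi1 mulrA -mulrBl; congr (_ * _).
  rewrite pis sk -piM -hk (prerepB (pi := fun a => pi a))//.
  rewrite (prerep_rs (pi := fun a => pi a))// (ipBr gH) (ipZr gH) conjC_rc.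
  by rewrite piM -[X in _ - X]pis.
(* For the other direction one pair of representations suffices: GNS for the coordinate [b] and the
   character of C(S_n) at s, realised on a one-dimensional space. *)
set b := e s _; have [H [ipH [pi [x [hH rH x1 xb]]]]] := gns b.
pose form (y z : R[i]^o) : R[i] := y * z^*.
have formP : semi_ip form.
  split=> [k y z w|y z|y]; rewrite /form.
  - by rewrite mulrDl -[k *: y]/(k * y) mulrA.
  - by rewrite conjCM conjCK mulrC.
  - by rewrite mulc_conj ler0c sqr_ge0.
pose P := PreHilbert formP.
have [|||||rho rhoP rhoE] := @prerep_complete R (csym R n) P (fun f y => f s * y).
- by move=> f y z; rewrite mulrBr.
- by move=> y; rewrite ffunE mul1r.
- by move=> k f h y; rewrite ffunE csymZE mulrDl -[k *: _]/(k * _) mulrA.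
- by move=> f h y; rewrite ffunE mulrA.
- by move=> f y z; rewrite /= /form ffunE conjCM conjCK mulrCA mulrA.
have := tsp H (hcompl_hilbert P) ipH (hdot P) pi rho hH (@hdot_hilbert R P) rH rhoP
  [:: (x, @emb R P 1)].
have gH := dot_semi_ip ipH; have [pi1 pil _ _] := rH.
have pi0 : pi 0 x = 0 by apply: (prerep0 (pi := fun a => pi a)).
have pib : pi b x = \sum_(a <- t) a.2 s *: pi a.1 x.
  rewrite /b esum; elim: (t) => [|a t' IH]; first by rewrite !big_nil pi0.
  by rewrite !big_cons pil IH.
rewrite /tensor_sqnorm big_allpairs_dep.
rewrite (_ : \sum_(a <- t) _ = ipH (pi b x) (pi b x)).
  rewrite !big_seq1 /= x1 -[hdot P _ _]/(@hip R P _ _) hip_emb /= /form conjC1 !mulr1.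
  by rewrite xb lecR ler_sqr ?nnegrE.
rewrite pib (ip_suml gH); apply: eq_bigr => a _.
rewrite big_seq1 big_allpairs_dep (ip_sumr gH); apply: eq_bigr => a' _.
rewrite big_seq1 /= !rhoE -[hdot P _ _]/(@hip R P _ _) hip_emb /= /form !mulr1.
by rewrite (ipZl gH) (ipZr gH); ring.
Qed.

End PermutationAlgebra.

(** * Relations in an easy quantum group *)

Section Intertwiners.
Context {R : realType} {n : nat} {A : cstarAlgType R}.
Implicit Types (u : 'M[A]_n).

Definition tpow u k (i j : k.-tuple 'I_n) : A := \prod_(r < k) u (tnth i r) (tnth j r).

Lemma tpow_cons u k (a b : 'I_n) (i j : k.-tuple 'I_n) :
  tpow u [tuple of a :: i] [tuple of b :: j] = u a b * tpow u i j.
Proof.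
rewrite /tpow big_ord_recl !tnth0; congr (_ * _).
by apply: eq_bigr => r _; rewrite !tnthS.
Qed.

Lemma tpow_nil u (i j : 0.-tuple 'I_n) : tpow u i j = 1.
Proof. by rewrite /tpow big_ord0. Qed.

Lemma sum_tuple k (F : k.-tuple 'I_n -> A) :
  \sum_(i < tdim n k) F (enum_val i) = \sum_i F i.
Proof.
rewrite (reindex_onto (@enum_rank _) (@enum_val _ _))/=; last first.
  by move=> i _; rewrite enum_valK.
by apply: eq_big => i; rewrite enum_rankK ?eqxx.
Qed.

Lemma intertwinerP u k l (T : 'M[R[i]]_(tdim n l, tdim n k)) :
  intertwiner u T <-> forall (j : l.-tuple 'I_n) (i : k.-tuple 'I_n),
    \sum_(i' : k.-tuple 'I_n) T (enum_rank j) (enum_rank i') *: tpow u i' i =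
    \sum_(j' : l.-tuple 'I_n) T (enum_rank j') (enum_rank i) *: tpow u j j'.
Proof.
have lhs (j : l.-tuple 'I_n) (i : k.-tuple 'I_n) :
    (map_mx (in_alg A) T *m tensor_power u k) (enum_rank j) (enum_rank i) =
    \sum_(i' : k.-tuple 'I_n) T (enum_rank j) (enum_rank i') *: tpow u i' i.
  rewrite mxE -sum_tuple; apply: eq_bigr => r _.
  by rewrite !mxE enum_valK enum_rankK mulr_algl.
have rhs (j : l.-tuple 'I_n) (i : k.-tuple 'I_n) :
    (tensor_power u l *m map_mx (in_alg A) T) (enum_rank j) (enum_rank i) =
    \sum_(j' : l.-tuple 'I_n) T (enum_rank j') (enum_rank i) *: tpow u j j'.
  rewrite mxE -sum_tuple; apply: eq_bigr => r _.
  by rewrite !mxE enum_valK enum_rankK mulr_algr.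
split=> [uT j i|H]; first by rewrite -lhs -rhs uT.
apply/matrixP => j i; rewrite -(enum_valK j) -(enum_valK i) lhs rhs; exact: H.
Qed.

Lemma TpartE k l (p : part k l) (j : l.-tuple 'I_n) (i : k.-tuple 'I_n) :
  Tpart n p (enum_rank j) (enum_rank i) = (delta_part p i j)%:R :> R[i].
Proof. by rewrite mxE !enum_rankK. Qed.

Lemma delta_partP k l (p : part k l) (i : k.-tuple 'I_n) (j : l.-tuple 'I_n) :
  let label := fun x : 'I_k + 'I_l =>
    match x with inl r => tnth i r | inr r => tnth j r end in
  reflect (forall B, B \in p -> forall x y, x \in B -> y \in B -> label x = label y)
          (delta_part p i j).
Proof.
move=> label; apply: (iffP idP) => [/forall_inP H B Bp x y xB yB|H].
  by have /forall_inP/(_ x xB)/forall_inP/(_ y yB)/eqP := H B Bp.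
apply/forall_inP => B Bp; apply/forall_inP => x xB; apply/forall_inP => y yB.
by apply/eqP; apply: H Bp _ _ xB yB.
Qed.

Lemma delta_part_map (phi : 'I_n -> 'I_n) k l (p : part k l)
    (i : k.-tuple 'I_n) (j : l.-tuple 'I_n) :
  delta_part p i j -> delta_part p (map_tuple phi i) (map_tuple phi j).
Proof.
move=> /delta_partP H; apply/delta_partP => B Bp x y xB yB.
by have := H B Bp x y xB yB; case: x {xB} => x; case: y {yB} => y; rewrite !tnth_map => ->.
Qed.

Lemma delta_part_perm (s : 'S_n) k l (p : part k l)
    (i : k.-tuple 'I_n) (j : l.-tuple 'I_n) :
  delta_part p (map_tuple s i) (map_tuple s j) = delta_part p i j.
Proof.
apply/idP/idP => [/(delta_part_map (s^-1)%g)|]; last exact: delta_part_map.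
have K m (t : m.-tuple 'I_n) : map_tuple (s^-1)%g (map_tuple s t) = t.
  by apply: eq_from_tnth => r; rewrite !tnth_map permK.
by rewrite !K.
Qed.

Lemma delta_pi0 (a b c d e f : 'I_n) :
  delta_part pi0 [tuple a; b; c] [tuple d; e; f] =
  (a == b) && (b == e) && (e == f) && (c == d).
Proof.
have i0 : inord 0 = ord0 :> 'I_3 by apply: val_inj; rewrite /= inordK.
have i1 : inord 1 = lift ord0 ord0 :> 'I_3 by apply: val_inj; rewrite /= inordK.
have i2 : inord 2 = lift ord0 (lift ord0 ord0) :> 'I_3 by apply: val_inj; rewrite /= inordK.
apply/delta_partP/idP => [H|/andP[/andP[/andP[/eqP-> /eqP->] /eqP->] /eqP->]].
  pose B1 : {set 'I_3 + 'I_3} :=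
    [set inl (inord 0); inl (inord 1); inr (inord 1); inr (inord 2)]%SET.
  pose B2 : {set 'I_3 + 'I_3} := [set inl (inord 2); inr (inord 0)]%SET.
  have h1 : B1 \in pi0 by rewrite !inE eqxx.
  have h2 : B2 \in pi0 by rewrite !inE eqxx orbT.
  have := H _ h2 (inl (inord 2)) (inr (inord 0)); rewrite !inE !eqxx orbT => /(_ isT isT).
  rewrite i2 i0 /= => cd.
  have := H _ h1 (inl (inord 0)) (inl (inord 1)); rewrite !inE !eqxx !orbT => /(_ isT isT).
  rewrite i1 i0 /= => ab.
  have := H _ h1 (inl (inord 1)) (inr (inord 1)); rewrite !inE !eqxx !orbT => /(_ isT isT).
  rewrite i1 /= => be.
  have := H _ h1 (inr (inord 1)) (inr (inord 2)); rewrite !inE !eqxx !orbT => /(_ isT isT).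
  rewrite i1 i2 /= => ef.
  move: cd ab be ef; rewrite /tnth /= => -> -> -> ->; by rewrite !eqxx.
move=> B; rewrite !inE => /orP[]/eqP-> x y; rewrite !inE -?orbA.
  by move=> /or4P[]/eqP-> /or4P[]/eqP->; rewrite ?i0 ?i1 ?i2.
by move=> /orP[]/eqP-> /orP[]/eqP->; rewrite ?i0 ?i1 ?i2.
Qed.

Lemma tuple3_eta (x : 3.-tuple 'I_n) : exists a b c, x = [tuple a; b; c].
Proof.
case/tupleP: x => a x; case/tupleP: x => b x; case/tupleP: x => c x.
by exists a, b, c; apply: val_inj; rewrite /= tuple0.
Qed.

Lemma tuple3_eqE (a b c d e f : 'I_n) :
  ([tuple a; b; c] == [tuple d; e; f]) = [&& a == d, b == e & c == f].
Proof. by rewrite -[LHS]val_eqE /= !eqseq_cons eqxx !andbT. Qed.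

Lemma tpow3 u (a b c d e f : 'I_n) :
  tpow u [tuple a; b; c] [tuple d; e; f] = u a d * u b e * u c f.
Proof. by rewrite /tpow !big_ord_recl big_ord0 mulr1 mulrA. Qed.

(** In the matrix of T_(pi_0), the row (d, e, f) has its only possible nonzero entry at (e, e, d),
    present iff e = f, and the column (a, b, c) at (c, a, a), present iff a = b. *)
Lemma pi0_relation u : intertwiner u (Tpart n pi0) ->
  forall d e f a b c, (e == f)%:R *: (u e a * u e b * u d c) =
    (a == b)%:R *: (u d c * u e a * u f a) :> A.
Proof.
move=> /intertwinerP H d e f a b c; have := H [tuple d; e; f] [tuple a; b; c].
have single (F : 3.-tuple 'I_n -> A) (P : pred (3.-tuple 'I_n)) x0 (g : bool) :
    (forall x, P x = g && (x == x0)) -> \sum_x (P x)%:R *: F x = g%:R *: F x0.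
  move=> Px; rewrite (bigD1 x0)//= Px eqxx andbT big1 ?addr0// => x xx0.
  by rewrite Px (negPf xx0) andbF scale0r.
under eq_bigr do rewrite TpartE.
rewrite (single (fun x => tpow u x [tuple a; b; c]) _ [tuple e; e; d] (e == f)); last first.
  move=> x; have [x1 [x2 [x3 ->]]] := tuple3_eta x; rewrite delta_pi0 tuple3_eqE.
  apply/idP/idP => [/andP[/andP[/andP[/eqP-> /eqP->] ->] /eqP->]|]; first by rewrite !eqxx.
  by move=> /and4P[-> /eqP-> /eqP-> /eqP->]; rewrite !eqxx.
under eq_bigr do rewrite TpartE.
rewrite (single (fun x => tpow u [tuple d; e; f] x) _ [tuple c; a; a] (a == b)); last first.
  move=> x; have [x1 [x2 [x3 ->]]] := tuple3_eta x; rewrite delta_pi0 tuple3_eqE.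
  apply/idP/idP => [/andP[/andP[/andP[/eqP-> /eqP->] /eqP->] /eqP->]|]; first by rewrite !eqxx.
  by move=> /and4P[/eqP-> /eqP-> /eqP-> /eqP->]; rewrite !eqxx.
by rewrite !tpow3.
Qed.

End Intertwiners.

Section CommutingProducts.
Context {R : realType} {A : cstarAlgType R} {I : eqType} (F : I -> A).
Hypothesis FC : forall i j, F i * F j = F j * F i.

Lemma prod_commute x (r : seq I) : (forall i, x * F i = F i * x) ->
  x * \prod_(i <- r) F i = (\prod_(i <- r) F i) * x.
Proof.
move=> xF; elim: r => [|i r IH]; first by rewrite big_nil mulr1 mul1r.
by rewrite big_cons mulrA xF -mulrA IH mulrA.
Qed.

Lemma prod_idem i (r : seq I) : F i * F i = F i -> i \in r ->
  F i * \prod_(j <- r) F j = \prod_(j <- r) F j.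
Proof.
move=> Fi; elim: r => // j r IH; rewrite inE big_cons => /orP[/eqP<-|/IH h].
  by rewrite mulrA Fi.
by rewrite mulrA FC -mulrA h.
Qed.

Lemma prod_star (r : seq I) : (forall i, star (F i) = F i) ->
  star (\prod_(i <- r) F i) = \prod_(i <- r) F i.
Proof.
move=> sF; elim: r => [|i r IH]; first by rewrite big_nil star1.
by rewrite big_cons starM IH sF prod_commute.
Qed.

End CommutingProducts.

Lemma star_alg_genP (R : realType) (A : cstarAlgType R) (G : set A) :
  star_subalg (star_alg_gen G) /\ G `<=` star_alg_gen G.
Proof.
split; last by move=> x Gx S [_]; apply.
split=> [S [[S1 _ _ _] _]|c x y xG yG S SG|x y xG yG S SG|x xG S SG] //.
- by have [[_ Sl _ _] _] := SG; apply: Sl; [apply: xG|apply: yG].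
- by have [[_ _ SM _] _] := SG; apply: SM; [apply: xG|apply: yG].
- by have [[_ _ _ SS] _] := SG; apply: SS; apply: xG.
Qed.

Lemma gev_collect (R : realType) (G : groupType) (A : cstarAlgType R) (v : G -> A)
    (t : seq (R[i] * G)) :
  gev v t = \sum_(g <- undup [seq x.2 | x <- t]) (\sum_(x <- t | x.2 == g) x.1) *: v g.
Proof.
under eq_bigr do rewrite scaler_suml big_mkcond.
rewrite exchange_big /gev big_seq [RHS]big_seq; apply: eq_bigr => x xt.
have xU : x.2 \in undup [seq x.2 | x <- t] by rewrite mem_undup map_f.
rewrite (bigD1_seq _ xU (undup_uniq _)) /= eqxx big1 ?addr0// => g.
by rewrite eq_sym => /negPf->.
Qed.

Section InvolutionGroup.
Context {R : realType} {n : nat} {A : cstarAlgType R} (s : 'I_n -> A).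
Hypothesis ss : forall i, s i * s i = 1.
Hypothesis sS : forall i, star (s i) = s i.

Definition wprod (w : seq 'I_n) : A := \prod_(i <- w) s i.

Lemma wprod_rev w : star (wprod w) = wprod (rev w).
Proof.
rewrite /wprod; elim: w => [|i w IH]; first by rewrite !big_nil star1.
by rewrite rev_cons -cats1 big_cat !big_cons big_nil /= mulr1 starM IH sS.
Qed.

Lemma wprod_revK w : star (wprod w) * wprod w = 1.
Proof.
elim: w => [|i w]; rewrite /wprod; first by rewrite big_nil star1 mul1r.
by rewrite big_cons starM sS -mulrA (mulrA (s i) (s i)) ss mul1r.
Qed.

Lemma wprod_Krev w : wprod w * star (wprod w) = 1.
Proof. by have := wprod_revK (rev w); rewrite -wprod_rev starK. Qed.

Definition wprodset (g : A) : bool := `[< exists w, g = wprod w >].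

(* The proofs are arguments so that the group structure below can use them. *)
Definition involgroup of (forall i, s i * s i = 1) & (forall i, star (s i) = s i) :
  predArgType := {g : A | wprodset g}.

Local Notation Gamma := (involgroup ss sS).

HB.instance Definition _ := Choice.on Gamma.

Implicit Types g h : Gamma.

Definition involval g : A := val g.

Lemma involvalP g : exists w, involval g = wprod w.
Proof. exact/asboolP/(valP g). Qed.

Lemma involgroup1 : wprodset 1.
Proof. by apply/asboolP; exists [::]; rewrite /wprod big_nil. Qed.
Lemma involgroupM g h : wprodset (involval g * involval h).
Proof.
have [[w ->] [w' ->]] := (involvalP g, involvalP h).
by apply/asboolP; exists (w ++ w'); rewrite /wprod big_cat/=.
Qed.
Lemma involgroupV g : wprodset (star (involval g)).
Proof.
have [w ->] := involvalP g.
by apply/asboolP; exists (rev w); rewrite wprod_rev.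
Qed.

Definition invol1 : Gamma := exist (fun g : A => wprodset g) _ involgroup1.
Definition involM g h : Gamma := exist (fun g : A => wprodset g) _ (involgroupM g h).
Definition involV g : Gamma := exist (fun g : A => wprodset g) _ (involgroupV g).

Lemma involA : associative involM.
Proof. by move=> x y z; apply: val_inj; rewrite /= mulrA. Qed.
Lemma invol1M : left_id invol1 involM.
Proof. by move=> x; apply: val_inj; rewrite /= mul1r. Qed.
Lemma involM1 : right_id invol1 involM.
Proof. by move=> x; apply: val_inj; rewrite /= mulr1. Qed.
Lemma involVM : left_inverse invol1 involV involM.
Proof. by move=> x; apply: val_inj; have [w e] := involvalP x; rewrite -[LHS]/(star (involval x) * involval x) e wprod_revK. Qed.
Lemma involMV : right_inverse invol1 involV involM.
Proof. by move=> x; apply: val_inj; have [w e] := involvalP x; rewrite -[LHS]/(involval x * star (involval x)) e wprod_Krev. Qed.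

HB.instance Definition _ := isGroup.Build Gamma involA invol1M involM1 involVM involMV.

Lemma involval_rep : unitary_rep involval.
Proof.
by split=> // g; have [w ->] := involvalP g; rewrite wprod_revK wprod_Krev.
Qed.

Lemma wprod_mem w : wprodset (wprod w).
Proof. by apply/asboolP; exists w. Qed.

Definition wprod_elt w : Gamma := exist (fun g : A => wprodset g) _ (wprod_mem w).

End InvolutionGroup.

Lemma span_ind (K : fieldType) (V : vectType K) (Q : V -> Prop) (r : seq V) :
  Q 0 -> (forall c x y, Q x -> Q y -> Q (c *: x + y)) ->
  (forall x, x \in r -> Q x) -> forall x, x \in <<r>>%VS -> Q x.
Proof.
move=> Q0 Ql Qr x /(@coord_span _ _ _ (in_tuple r)) ->.
apply: big_ind => // [y z Qy Qz|i _]; first by rewrite -[y]scale1r; apply: Ql.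
by rewrite -[_ *: _]addr0; apply: Ql => //; apply: Qr; rewrite mem_nth.
Qed.

Section SliceEquations.
Context {R : realType} {A B T : cstarAlgType R}.
Context {i1 : {lrmorphism A -> T}} {i2 : {lrmorphism B -> T}}.
Hypothesis tens : is_tensor i1 i2.

Lemma slice_sum (I : Type) (r : seq I) (f : I -> A) (g : I -> B) phi :
  vector_functional phi -> \sum_(x <- r) i1 (f x) * i2 (g x) = 0 ->
  \sum_(x <- r) phi (g x) *: f x = 0.
Proof.
move=> vphi e; have := tensor_slice (t := [seq (f x, g x) | x <- r]) tens vphi.
by rewrite !big_map; apply.
Qed.

Lemma slice_eq a b c d phi : vector_functional phi ->
  i1 a * i2 b = i1 c * i2 d -> phi b *: a = phi d *: c.
Proof.
move=> vphi e.
pose f (x : bool) := if x then a else - c; pose g (x : bool) := if x then b else d.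
have /(slice_sum (r := [:: true; false]) vphi) : \sum_(x <- [:: true; false]) i1 (f x) * i2 (g x) = 0.
  by rewrite !big_cons big_nil /f /g /= addr0 e -mulrDl -linearD/= subrr linear0 mul0r.
by rewrite !big_cons big_nil /f /g /= addr0 scalerN => /subr0_eq.
Qed.

Lemma tensor_neq0 a b : a != 0 -> b != 0 -> i1 a * i2 b != 0.
Proof.
move=> a0 b0; apply/eqP => e; have [phi vphi phib] := vector_functional_sep b0.
have : i1 a * i2 b = i1 0 * i2 b by rewrite e linear0 mul0r.
by move=> /(slice_eq vphi)/eqP; rewrite scaler0 scaler_eq0 (negPf phib) (negPf a0).
Qed.

Lemma tensorM a b c d : i1 a * i2 b * (i1 c * i2 d) = i1 (a * c) * i2 (b * d).
Proof.
have [_ C _ _] := tens.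
by rewrite (rmorphM i1) (rmorphM i2) -!mulrA; congr (_ * _); rewrite !mulrA C.
Qed.

End SliceEquations.

(** * The block structure that pi_0 imposes on A *)

Section SquareRelations.
Context {R : realType} {n : nat} {A : cstarAlgType R} (u : 'M[A]_n).
Hypothesis us : forall i j, star (u i j) = u i j.
Hypothesis urow : forall i j, \sum_k u i k * u j k = (i == j)%:R.
Hypothesis ucol : forall i j, \sum_k u k i * u k j = (i == j)%:R.
Hypothesis upi : forall d e f a b c, (e == f)%:R *: (u e a * u e b * u d c) =
    (a == b)%:R *: (u d c * u e a * u f a) :> A.
Hypothesis ugen : cstar_generates (entries u).

Definition sqentry i j : A := u i j * u i j.
Local Notation p := sqentry.

Definition rowsum i : A := \sum_j u i j.
Local Notation s := rowsum.

Lemma sqentry_comm i j k l : p i j * u k l = u k l * p i j.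
Proof. by have := upi k i i j j l; rewrite !eqxx !scale1r => ->; rewrite mulrA. Qed.

(** Insert 1 = sum_c u_ic u_ic: the relation [upi] with equal rows and different columns kills every
    term. *)
Lemma row_orth i j k : j != k -> u i j * u i k = 0.
Proof.
move=> jk; rewrite -[LHS]mulr1.
have <- : \sum_c u i c * u i c = 1 by rewrite urow eqxx.
rewrite mulr_sumr big1// => c _; rewrite mulrA.
have := upi i i i j k c; rewrite eqxx (negPf jk) scale1r scale0r => ->.
by rewrite mul0r.
Qed.

(** The dual case of [upi], with different rows and equal columns; now the 1 is inserted on the
    left. *)
Lemma col_orth i j k : i != j -> u i k * u j k = 0.
Proof.
move=> ij; rewrite -[LHS]mul1r.
have <- : \sum_c u i c * u i c = 1 by rewrite urow eqxx.
rewrite mulr_suml big1// => c _.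
have := upi i i j k k c; rewrite eqxx (negPf ij) scale1r scale0r -mulrA => h.
by rewrite -mulrA -h mulr0.
Qed.

Lemma sqentry_row i j k : p i j * p i k = (j == k)%:R *: p i j.
Proof.
have o j' k' : j' != k' -> p i j' * p i k' = 0.
  by move=> jk; rewrite /p mulrA -(mulrA (u i j')) (row_orth _ jk) mulr0 mul0r.
have [<-|/o->] := eqVneq; last by rewrite scale0r.
rewrite scale1r -[RHS]mulr1.
have <- : \sum_c p i c = 1 by rewrite urow eqxx.
by rewrite mulr_sumr (bigD1 j)//= big1 ?addr0// => c; rewrite eq_sym => /o.
Qed.

Lemma sqentry_col i j k : i != j -> p i k * p j k = 0.
Proof.
by move=> ij; rewrite /p mulrA -(mulrA (u i k)) (col_orth _ ij) mulr0 mul0r.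
Qed.

Lemma sqentryC i j k l : p i j * p k l = p k l * p i j.
Proof.
have -> : p k l = u k l * u k l by [].
by rewrite mulrA sqentry_comm -mulrA sqentry_comm mulrA.
Qed.

Lemma sqentry_star i j : star (p i j) = p i j.
Proof. by rewrite starM us. Qed.

Lemma rowsum_sqentry i j : s i * p i j = u i j.
Proof.
rewrite mulr_suml (bigD1 j)//= big1 => [|c cj]; last first.
  by rewrite mulrA row_orth// mul0r.
rewrite addr0 -[RHS]mulr1.
have <- : \sum_c p i c = 1 by rewrite urow eqxx.
rewrite mulr_sumr (bigD1 j)//= [X in _ + X]big1 ?addr0// => c cj.
by rewrite mulrA row_orth ?mul0r// eq_sym.
Qed.

Lemma rowsum_sq i : s i * s i = 1.
Proof.
have <- : \sum_c p i c = 1 by rewrite urow eqxx.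
rewrite {2}/s mulr_sumr; apply: eq_bigr => j _.
rewrite mulr_suml (bigD1 j)//= big1 ?addr0// => c cj; exact: row_orth.
Qed.

Lemma rowsum_star i : star (s i) = s i.
Proof. by rewrite star_sum; apply: eq_bigr. Qed.

Definition permproj (t : 'S_n) : A := \prod_j p (t j) j.
Local Notation P := permproj.

Lemma permproj_star t : star (P t) = P t.
Proof.
apply: prod_star => [? ?|?]; [exact: sqentryC | exact: sqentry_star].
Qed.

Lemma sqentry_permproj i j t : p i j * P t = (t j == i)%:R *: P t.
Proof.
have C : forall a b, p (t a) a * p (t b) b = p (t b) b * p (t a) a.
  by move=> *; apply: sqentryC.
have pP : p (t j) j * P t = P t.
  apply: (prod_idem C); first by rewrite sqentry_row eqxx scale1r.
  by rewrite mem_index_enum.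
have [<-|tji] := eqVneq; first by rewrite scale1r.
by rewrite -pP mulrA sqentry_col ?mul0r ?scale0r// eq_sym.
Qed.

(** Expand the product over the columns j of sum_i p_ij = 1 over all maps from columns to rows. A
    map that is not injective repeats a row and contributes 0; the injective ones are the
    permutations. *)
Lemma sum_permproj : \sum_t P t = 1.
Proof.
have -> : 1 = \prod_(j < n) \sum_i p i j :> A.
  by rewrite big1// => j _; have := ucol j j; rewrite eqxx.
rewrite (bigA_distr_bigA (fun j i => p i j)).
rewrite (bigID (fun f : {ffun 'I_n -> 'I_n} => injectiveb f))/=.
rewrite [X in _ + X]big1 ?addr0; last first.
  move=> f /injectivePn[a [b ab fab]].
  have C : forall a b, p (f a) a * p (f b) b = p (f b) b * p (f a) a.
    by move=> *; apply: sqentryC.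
  have id c : p (f c) c * p (f c) c = p (f c) c by rewrite sqentry_row eqxx scale1r.
  rewrite -(prod_idem C (id b) (mem_index_enum b)) -(prod_idem C (id a) (mem_index_enum a)).
  by rewrite mulrA fab sqentry_row eq_sym (negPf ab) scale0r mul0r.
rewrite (reindex_onto val (insubd (1%g : 'S_n))) /=; last first.
  by move=> f fi; rewrite val_insubd fi.
apply: eq_big => [t|t _]; last by apply: eq_bigr => j _; rewrite pvalE.
by rewrite valKd eqxx andbT (valP t).
Qed.

Lemma permproj_mul t r : P t * P r = (t == r)%:R *: P t.
Proof.
have o t' r' : t' != r' -> P t' * P r' = 0.
  move=> tr; have [j tj] : exists j, t' j != r' j.
    apply/existsP; rewrite -negb_forall; apply: contra tr => /forallP tr.
    by apply/eqP/permP => j; apply/eqP.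
  have C : forall a b, p (t' a) a * p (t' b) b = p (t' b) b * p (t' a) a.
    by move=> *; apply: sqentryC.
  have e := sqentry_permproj (t' j) j t'; rewrite eqxx scale1r in e.
  have e' : P t' * p (t' j) j = p (t' j) j * P t'.
    by rewrite /P prod_commute// => ?; rewrite sqentryC.
  by rewrite -e -e' -mulrA sqentry_permproj eq_sym (negPf tj) scale0r mulr0.
have [<-|/o->] := eqVneq; last by rewrite scale0r.
rewrite scale1r -[RHS]mulr1 -sum_permproj mulr_sumr (bigD1 t)//= big1 ?addr0//.
by move=> r'; rewrite eq_sym => /o.
Qed.

(** Squares of entries commute with the generators; the commutant of a self-adjoint element is a
    *-subalgebra and closed, so density does the rest. *)
Lemma permprojC t x : P t * x = x * P t.
Proof.
have sub : star_subalg [set x | P t * x = x * P t].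
  split=> [|c a b /= ea eb|a b /= ea eb|a /= ea]; first by rewrite /= mulr1 mul1r.
  - by rewrite mulrDr mulrDl -scalerAr -scalerAl ea eb.
  - by rewrite mulrA ea -mulrA eb mulrA.
  - by apply: (can_inj (@starK _ A)); rewrite !starM !starK permproj_star ea.
have [v vS vx] := cstar_dense_cvg ugen x.
have gv m : P t * v m = v m * P t.
  apply: (vS m [set x | P t * x = x * P t]); split=> // _ [i [j ->]] /=.
  by rewrite /P -prod_commute// => k; rewrite sqentry_comm.
apply: (cvgC_uniq (cvgCMl (P t) vx)).
by rewrite (_ : (fun m => _) = (fun m => v m * P t)); [exact: cvgCMr|apply: funext].
Qed.

Lemma entry_permproj i j t : u i j * P t = (t j == i)%:R *: (s i * P t).
Proof. by rewrite -rowsum_sqentry -mulrA sqentry_permproj scalerAr. Qed.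

Definition rowword (w : seq 'I_n) : A := \prod_(i <- w) s i.
Local Notation sw := rowword.

Lemma rowword_nil : sw [::] = 1. Proof. by rewrite /sw big_nil. Qed.
Lemma rowword_cons i w : sw (i :: w) = s i * sw w. Proof. by rewrite /sw big_cons. Qed.
Lemma rowword_cat w w' : sw (w ++ w') = sw w * sw w'. Proof. by rewrite /sw big_cat. Qed.

Lemma rowword_revK w : sw (rev w) * sw w = 1.
Proof.
elim: w => [|i w IH]; first by rewrite rowword_nil mul1r.
rewrite rev_cons -cats1 rowword_cat !rowword_cons rowword_nil mulr1.
by rewrite mulrA -(mulrA (sw (rev w)) (s i) (s i)) rowsum_sq mulr1.
Qed.

Lemma rowword_Krev w : sw w * sw (rev w) = 1.
Proof. by rewrite -{1}[w]revK rowword_revK. Qed.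

(** On the block of t the matrix u is monomial, so in column j only the row t j survives. *)
Lemma tpow_permproj k (i j : k.-tuple 'I_n) t :
  tpow u i j * P t = (map_tuple t j == i)%:R *: (sw i * P t).
Proof.
elim: k i j => [|k IH] i j.
  by rewrite !tuple0 tpow_nil rowword_nil mul1r (_ : _ == _) ?scale1r//; apply/eqP/tuple0.
case/tupleP: i => a i; case/tupleP: j => b j.
rewrite tpow_cons -mulrA IH -scalerAr mulrA.
have -> : (map_tuple t [tuple of b :: j] == [tuple of a :: i]) =
          (t b == a) && (map_tuple t j == i).
  by rewrite -[LHS]val_eqE /= eqseq_cons.
case: (map_tuple t j == i); rewrite ?scale0r ?andbF ?scale0r// andbT scale1r.
rewrite rowword_cons -(mulrA (u a b)) -(permprojC t (sw i)) (mulrA (u a b)) entry_permproj.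
by rewrite -scalerAl -(mulrA (s a) (P t)) permprojC mulrA.
Qed.

(** * The comultiplication on the blocks P_t (x) P_r *)

Section Comultiplication.
Context {T : cstarAlgType R} (i1 i2 Delta : {lrmorphism A -> T}).
Hypothesis tens : is_tensor i1 i2.
Hypothesis DU : forall i j, Delta (u i j) = \sum_k i1 (u i k) * i2 (u k j).

Definition tensproj t r := i1 (P t) * i2 (P r).
Local Notation X := tensproj.

Lemma tensprojC t r a b : X t r * (i1 a * i2 b) = i1 a * i2 b * X t r.
Proof. by rewrite !(tensorM tens) !permprojC. Qed.

(** Of the terms u_ik (x) u_kj only k = r j survives on this block, and it needs t k = i; the second
    leg is then s_k with k = t^-1 i. *)
Lemma Delta_entry i j t r : Delta (u i j) * X t r =
  (t (r j) == i)%:R *: (i1 (s i) * i2 (s (t^-1%g i)) * X t r).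
Proof.
rewrite DU mulr_suml (bigD1 (r j))//= big1 ?addr0 => [|k kj].
  rewrite !(tensorM tens) !entry_permproj eqxx scale1r.
  have [<-|_] := eqVneq; last by rewrite !scale0r linear0 mul0r.
  by rewrite !scale1r permK.
by rewrite (tensorM tens) !entry_permproj [r j == k]eq_sym (negPf kj) scale0r (linear0 i2) mulr0.
Qed.

Lemma Delta_rowsum i t r :
  Delta (s i) * X t r = i1 (s i) * i2 (s (t^-1%g i)) * X t r.
Proof.
rewrite (linear_sum Delta) mulr_suml (bigD1 (r^-1%g (t^-1%g i)))//= big1 ?addr0.
  by rewrite Delta_entry !permKV eqxx scale1r.
move=> j jn; rewrite Delta_entry; have [e|_] := eqVneq (t (r j)) i; last by rewrite scale0r.
by rewrite -e !permK eqxx in jn.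
Qed.

Lemma Delta_sqentry i j t r : Delta (p i j) * X t r = (t (r j) == i)%:R *: X t r.
Proof.
rewrite (rmorphM Delta)/= -mulrA Delta_entry -scalerAr.
rewrite -(tensprojC t r (s i) (s (t^-1%g i))) (mulrA (Delta _)) Delta_entry.
case: (_ == i); last by rewrite !scale0r.
rewrite !scale1r -mulrA tensprojC (mulrA (_ * _)) (tensorM tens) !rowsum_sq.
by rewrite (rmorph1 i1) (rmorph1 i2) !mul1r.
Qed.

(** Permutations compose from left to right, so the map j -> t (r j) belonging to the block (t, r)
    is [r * t]. *)
Lemma Delta_permproj q t r : Delta (P q) * X t r = (q == r * t)%g%:R *: X t r.
Proof.
have H (l : seq 'I_n) : Delta (\prod_(j <- l) p (q j) j) * X t r =
    (all (fun j => t (r j) == q j) l)%:R *: X t r.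
  elim: l => [|j l IH]; first by rewrite big_nil rmorph1 mul1r scale1r.
  rewrite big_cons (rmorphM Delta)/= -mulrA IH -scalerAr Delta_sqentry scalerA /=.
  by rewrite -natrM mulnb andbC.
rewrite H; congr (_%:R *: _); congr nat_of_bool; apply/allP/eqP => [e|->].
  by apply/permP => j; rewrite permM; apply/esym/eqP/e; rewrite mem_index_enum.
by move=> j _; rewrite permM.
Qed.

Lemma Delta_rowword w t r :
  Delta (sw w) * X t r = i1 (sw w) * i2 (sw (map (t^-1)%g w)) * X t r.
Proof.
elim: w => [|i w IH]; first by rewrite !rowword_nil !rmorph1 mulr1.
rewrite !rowword_cons (rmorphM Delta)/= -mulrA IH -(tensprojC t r (sw w)) (mulrA (Delta _)) Delta_rowsum.
by rewrite -mulrA tensprojC (mulrA (_ * _)) (tensorM tens).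
Qed.

(** The permutations with nonzero projection are closed under products, hence form a subgroup, as
    S_n is finite. In particular P_1 != 0, which a counit would otherwise provide. *)
Lemma permproj_supp_mul t r : P t != 0 -> P r != 0 -> P (r * t)%g != 0.
Proof.
move=> t0 r0; apply: contraNN (tensor_neq0 tens t0 r0) => /eqP e.
by have := Delta_permproj (r * t)%g t r; rewrite e linear0 mul0r eqxx scale1r => /esym/eqP.
Qed.

Lemma permproj_suppX t k : P t != 0 -> P (t ^+ k.+1)%g != 0.
Proof.
move=> t0; elim: k => [|k IH]; first by rewrite expg1.
by rewrite expgS; apply: permproj_supp_mul.
Qed.

Lemma permproj_supp1 : P 1%g != 0.
Proof.
have [t t0] : exists t, P t != 0.
  apply/existsP; apply/existsPn => H.
  have /eqP := sum_permproj; rewrite big1 ?[0 == 1]eq_sym ?oner_eq0// => t _.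
  by apply/eqP; rewrite -[_ == _]negbK H.
by have := permproj_suppX (#[t]%g.-1) t0; rewrite prednK ?order_gt0// expg_order.
Qed.

Lemma permproj_suppV t : P t != 0 -> P t^-1%g != 0.
Proof.
move=> t0; rewrite invg_expg; case: (#[t]%g.-1) => [|k].
  by rewrite expg0 permproj_supp1.
exact: permproj_suppX.
Qed.

(** On the block (t, t^-1) the comultiplied hypothesis equates an elementary tensor with first leg
    s_w P_t to P_t (x) P_(t^-1). Slicing the second leg makes the first legs proportional. *)
Lemma rowword_scalar w t : sw w * P 1%g = P 1%g -> P t != 0 ->
  exists2 c : R[i], c != 0 & sw w * P t = c *: P t.
Proof.
move=> w1 t0; have tV0 := permproj_suppV t0.
have [phi vphi phit] := vector_functional_sep tV0.
have : Delta (sw w * P 1%g) * X t t^-1%g = Delta (P 1%g) * X t t^-1%g by rewrite w1.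
rewrite (rmorphM Delta)/= -mulrA Delta_permproj mulVg eqxx scale1r Delta_rowword (tensorM tens).
move=> /(slice_eq tens vphi); set d := phi _ => e.
have d0 : d != 0.
  apply/eqP => d0; move/eqP: e; rewrite d0 scale0r eq_sym scaler_eq0.
  by rewrite (negPf phit) (negPf t0).
exists (d^-1 * phi (P t^-1%g)); first by rewrite mulf_neq0// invr_eq0.
by rewrite -scalerA -e scalerA mulVf// scale1r.
Qed.

(** With c and d the scalars of t and r t, this equation, read off from the comultiplication on the
    block (t, r), is what makes the vector of [fixed_vector] invariant. *)
Lemma rowword_scalarM w t r (c d : R[i]) : P t != 0 ->
  sw w * P t = c *: P t -> sw w * P (r * t)%g = d *: P (r * t)%g ->
  c *: (sw (map (t^-1)%g w) * P r) = d *: P r.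
Proof.
move=> t0 wt wrt; apply/eqP; rewrite -subr_eq0; apply/negPn/negP.
move=> /(tensor_neq0 tens t0)/eqP; apply.
have : Delta (sw w * P (r * t)%g) * X t r = Delta (d *: P (r * t)%g) * X t r by rewrite wrt.
rewrite (rmorphM Delta) linearZ_LR/= -scalerAl -mulrA Delta_permproj eqxx scale1r.
rewrite Delta_rowword (tensorM tens) wt linearZ_LR -scalerAl => e.
by rewrite linearB mulrBr !linearZ_LR -!scalerAr e subrr.
Qed.

(** * From fixed vectors to partitions: strong symmetry and independence *)

Section FixedVectors.
Context (C : forall k l, {set part k l}).
Hypothesis hom : forall k l (M : 'M[R[i]]_(tdim n l, tdim n k)),
  intertwiner u M <-> M \in <<[seq Tpart n p | p <- enum (C k l)]>>%VS.

Lemma permproj_ext a b : (forall t, P t != 0 -> a * P t = b * P t) -> a = b.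
Proof.
move=> ab; rewrite -[a]mulr1 -[b]mulr1 -sum_permproj !mulr_sumr.
apply: eq_bigr => t _; have [->|/ab//] := eqVneq (P t) 0.
by rewrite !mulr0.
Qed.

Lemma span_Tpart_perm k l (M : 'M[R[i]]_(tdim n l, tdim n k)) :
  M \in <<[seq Tpart n p | p <- enum (C k l)]>>%VS ->
  forall (q : 'S_n) j i, M (enum_rank (map_tuple q j)) (enum_rank (map_tuple q i)) =
    M (enum_rank j) (enum_rank i).
Proof.
apply: (span_ind (Q := fun M : 'M_(tdim n l, tdim n k) => forall (q : 'S_n) j i,
  M (enum_rank (map_tuple q j)) (enum_rank (map_tuple q i)) =
  M (enum_rank j) (enum_rank i))) => [q j i|c x y xP yP q j i|_ /mapP[p _ ->] q j i].
- by rewrite !mxE.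
- by rewrite !mxE xP yP.
- by rewrite !TpartE delta_part_perm.
Qed.

(** A nonzero entry of a combination comes from some T_p; this is how an intertwiner yields a
    partition. *)
Lemma span_Tpart_supp k l (M : 'M[R[i]]_(tdim n l, tdim n k)) :
  M \in <<[seq Tpart n p | p <- enum (C k l)]>>%VS ->
  forall j i, M (enum_rank j) (enum_rank i) != 0 ->
  exists2 p, p \in C k l & delta_part p i j.
Proof.
apply: (span_ind (Q := fun M : 'M_(tdim n l, tdim n k) => forall j i,
  M (enum_rank j) (enum_rank i) != 0 ->
  exists2 p, p \in C k l & delta_part p i j)) => [j i|c x y xP yP j i|_ /mapP[p pC ->] j i].
- by rewrite !mxE eqxx.
- have [x0|/xP//] := eqVneq (x (enum_rank j) (enum_rank i)) 0.
  by rewrite !mxE x0 mulr0 add0r => /yP.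
- rewrite TpartE; case E: (delta_part p i j); last by rewrite eqxx.
  by move=> _; exists p => //; rewrite mem_enum in pC.
Qed.

Definition squares_word : seq 'I_n := flatten [seq [:: i; i] | i <- enum 'I_n].

Lemma rowword_squares (phi : 'I_n -> 'I_n) : sw (map phi squares_word) = 1.
Proof.
rewrite /squares_word; elim: (enum 'I_n) => [|i r IH]; first by rewrite rowword_nil.
by rewrite /= !rowword_cons IH mulrA rowsum_sq mulr1.
Qed.

Lemma mem_squares_word i : i \in squares_word.
Proof. by apply/flattenP; exists [:: i; i]; rewrite ?inE ?eqxx// map_f ?mem_enum. Qed.

(* If s_w P_1 = P_1, then s_w P_t = lam(t) P_t by comultiplication, and the
   vector with entry 1 / lam(t) at t^-1 v, for all t with P_t != 0, is fixed.
   The trailing squares do not change the product but make t -> t^-1 v injective. *)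
Lemma fixed_vector w : sw w * P 1%g = P 1%g ->
  (forall t, P t != 0) /\
  (exists2 p, p \in C 0 (size (w ++ squares_word)) &
              delta_part p [tuple] (in_tuple (w ++ squares_word))).
Proof.
move=> w1; set v := in_tuple _.
have swv (q : 'S_n) : sw (map_tuple q v) = sw (map q w).
  by rewrite /= map_cat rowword_cat rowword_squares mulr1.
(* Where P_t = 0 any nonzero scalar will do, and 1 is taken, so that [lam] can be inverted
   everywhere. *)
have /choice[lam lamP] : forall t, exists c : R[i], c != 0 /\ sw w * P t = c *: P t.
  move=> t; have [->|/(rowword_scalar w1)[c c0 e]] := eqVneq (P t) 0; last by exists c.
  by exists 1; rewrite oner_eq0 scaler0 mulr0.
pose tv (t : 'S_n) := map_tuple (t^-1)%g v.
pose xi j := \sum_(t | P t != 0) (j == tv t)%:R * (lam t)^-1.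
pose M : 'M[R[i]]_(tdim n (size (w ++ squares_word)), tdim n 0) :=
  \matrix_(j, i) xi (enum_val j).
have ME j i : M (enum_rank j) (enum_rank i) = xi j by rewrite mxE enum_rankK.
have tv_inj t : v = tv t -> t = 1%g.
  move=> e; apply/permP => i; rewrite perm1.
  have /(nthP i)[k kv ki] : i \in val v by rewrite mem_cat mem_squares_word orbT.
  have : nth i (val v) k = nth i (map (t^-1)%g v) k by rewrite {1}e.
  by rewrite (nth_map i)// ki => {1}->; rewrite permKV.
have xiv : xi v = (lam 1%g)^-1.
  rewrite /xi (bigD1 1%g) ?permproj_supp1//= big1 ?addr0 => [|t /andP[_ t1]].
    by rewrite (_ : v == _) ?mul1r//; apply/eqP/eq_from_tnth => r; rewrite tnth_map invg1 perm1.
  have [/tv_inj t1'|_] := eqVneq v (tv t); last by rewrite mul0r.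
  by rewrite t1' eqxx in t1.
have xiv0 : xi v != 0 by rewrite xiv invr_eq0 (lamP _).1.
have Mi : intertwiner u M.
  apply/intertwinerP => j i; under eq_bigr do rewrite ME.
  rewrite (bigD1 [tuple])//= big1 ?addr0 => [|i' /eqP[]]; last exact: tuple0.
  under eq_bigr do rewrite ME; rewrite tpow_nil.
  apply: permproj_ext => q q0; rewrite -scalerAl mul1r mulr_suml.
  have -> : \sum_j' xi j' *: tpow u j j' * P q =
            xi (map_tuple (q^-1)%g j) *: (sw j * P q).
    have K (x y : _.-tuple 'I_n) : (map_tuple q x == y) = (x == map_tuple (q^-1)%g y).
      apply/eqP/eqP => [<-|->]; apply: eq_from_tnth => r; rewrite !tnth_map ?permK//.
      by rewrite permKV.
    rewrite (bigD1 (map_tuple (q^-1)%g j))//= big1 ?addr0 => [|x xj].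
      by rewrite -scalerAl tpow_permproj K eqxx scale1r.
    by rewrite -scalerAl tpow_permproj K (negPf xj) scale0r scaler0.
  (* Replacing t by q t matches the two sums term by term; as q lies in the subgroup of nonzero
     projections, the range of summation is preserved. *)
  rewrite /xi [in RHS](reindex_inj (mulgI q)) !scaler_suml /=.
  have qP t : (P (q * t)%g != 0) = (P t != 0).
    apply/idP/idP => [h|t0]; last exact: permproj_supp_mul.
    by have := permproj_supp_mul h (permproj_suppV q0); rewrite mulKg.
  rewrite [RHS](eq_bigl (fun t => P t != 0))//; apply: eq_bigr => t t0.
  have -> : tv (q * t)%g = map_tuple (q^-1)%g (tv t).
    by apply: eq_from_tnth => r; rewrite !tnth_map invMg permM.
  have -> : (map_tuple (q^-1)%g j == map_tuple (q^-1)%g (tv t)) = (j == tv t).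
    apply/eqP/eqP => [e|->//]; apply: eq_from_tnth => r.
    by have := congr1 (fun x => tnth x r) e; rewrite !tnth_map => /perm_inj.
  have [->|_] := eqVneq j (tv t); last by rewrite !mul0r !scale0r.
  have := rowword_scalarM t0 (lamP t).2 (lamP (q * t)%g).2.
  rewrite swv !mul1r => e.
  apply: (scalerI (lamP t).1); rewrite scalerA mulfV ?(lamP t).1// scale1r.
  by rewrite scalerA mulrC -scalerA e scalerA mulVf ?(lamP _).1// scale1r.
move/hom: Mi => Ms; split; last first.
  by apply: (span_Tpart_supp Ms (j := v) (i := [tuple])); rewrite ME.
(* As a combination of the T_p the vector is invariant under S_n, so its entry at t v equals the
   nonzero entry at v. Only the summand with index t^-1 can contribute there, so P_(t^-1), and with
   it P_t, is nonzero. *)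
move=> t; have := span_Tpart_perm Ms t v [tuple]; rewrite !ME => e.
move: xiv0; rewrite -e => /eqP xi0; apply/negP => /eqP Pt0; apply: xi0.
rewrite /xi big1// => r r0; case: eqP => [/esym e'|]; last by rewrite mul0r.
have : v = tv (t * r)%g.
  by apply: eq_from_tnth => k; have := congr1 (fun x => tnth (map_tuple (t^-1)%g x) k) e';
     rewrite !tnth_map permK invMg permM.
move=> /tv_inj/eqP; rewrite -eq_invg_mul eq_sym => /eqP rt.
by have := permproj_suppV r0; rewrite rt invgK Pt0 eqxx.
Qed.

Lemma permproj_neq0 t : P t != 0.
Proof.
have [//|H _] := @fixed_vector [::]; first by rewrite rowword_nil mul1r.
exact: H.
Qed.

(* A partition compatible with a labelling is compatible with all its images. *)
Lemma rowword_relabel w (phi : 'I_n -> 'I_n) : sw w * P 1%g = P 1%g -> sw (map phi w) = 1.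
Proof.
move=> /fixed_vector[_ [p pC pv]]; set v := in_tuple _ in pv.
suff: sw (map_tuple phi v) = 1 by rewrite /= map_cat rowword_cat rowword_squares mulr1.
have Ms : @Tpart R n _ _ p \in <<[seq Tpart n p | p <- enum (C 0 (size (w ++ squares_word)))]>>%VS.
  by apply: memv_span; apply: map_f; rewrite mem_enum.
have /hom/intertwinerP/(_ (map_tuple phi v) [tuple]) := Ms.
under eq_bigr do rewrite TpartE.
rewrite (bigD1 [tuple])//= big1 ?addr0 => [|i' /eqP[]]; last exact: tuple0.
under eq_bigr do rewrite TpartE.
have dphi (f : 'I_n -> 'I_n) : delta_part p [tuple] (map_tuple f v).
  by have := delta_part_map f pv; rewrite [map_tuple f [tuple]]tuple0.
rewrite dphi tpow_nil scale1r => e.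
apply: permproj_ext => q q0; rewrite e mulr_suml.
pose qv := map_tuple (fun i => (q^-1)%g (phi i)) v.
rewrite (bigD1 qv)//= big1 ?addr0 => [|x xj].
  rewrite dphi scale1r tpow_permproj (_ : _ == _) ?scale1r//.
  by apply/eqP/eq_from_tnth => r; rewrite !tnth_map permKV.
rewrite -scalerAl tpow_permproj.
have [xe|_] := eqVneq (map_tuple q x) (map_tuple phi v); last by rewrite scale0r scaler0.
case/eqP: xj; apply/eq_from_tnth => r.
have := congr1 (fun x => (q^-1)%g (tnth x r)) xe.
by rewrite /= !tnth_map permK.
Qed.

Lemma Delta_grouplike w q :
  Delta (sw w * P q) * X 1%g q = i1 (sw w * P 1%g) * i2 (sw w * P q).
Proof.
rewrite (rmorphM Delta)/= -mulrA Delta_permproj mulg1 eqxx scale1r Delta_rowword.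
rewrite (tensorM tens) [map _ w](_ : _ = w)// -[RHS](map_id w).
by apply: eq_map => i; rewrite invg1 perm1.
Qed.

Lemma rowword_permproj_neq0 w q : sw w * P q != 0.
Proof.
apply/eqP => e; have /negP[] := permproj_neq0 q.
by rewrite -[P q]mul1r -(rowword_revK w) -mulrA e mulr0.
Qed.

Lemma rowword_inj w w' : sw w * P 1%g = sw w' * P 1%g -> sw w = sw w'.
Proof.
move=> e; have := @rowword_relabel (rev w' ++ w) id.
rewrite map_id rowword_cat -mulrA e mulrA rowword_revK mul1r => /(_ erefl) e1.
by rewrite -[sw w]mul1r -(rowword_Krev w') -mulrA e1 mulr1.
Qed.

Local Notation Gam := (involgroup rowsum_sq rowsum_star).

Lemma involval_rowword (g : Gam) : exists w, involval g = sw w.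
Proof. exact: involvalP. Qed.

(* The elements g P_1 are group-like, up to the central projection P_1 (x) P_1,
   and distinct group-like elements are independent. *)
Lemma involval_free1 (r : seq Gam) (c : Gam -> R[i]) : uniq r ->
  \sum_(g <- r) c g *: (involval g * P 1%g) = 0 -> forall g, g \in r -> c g = 0.
Proof.
elim: r c => // g0 r IH c /andP[g0r ur] e0.
have Dg (g : Gam) : Delta (involval g * P 1%g) * X 1%g 1%g =
    i1 (involval g * P 1%g) * i2 (involval g * P 1%g).
  by have [w ->] := involval_rowword g; exact: Delta_grouplike.
(* Slicing the comultiplied relation gives one relation, scaling the original one by phi (g0 P_1)
   another. Their difference has lost the term of [g0] and falls under the induction hypothesis. *)
have key phi : vector_functional phi -> forall g, g \in r ->
    c g * (phi (involval g * P 1%g) - phi (involval g0 * P 1%g)) = 0.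
  move=> vphi g gr; apply: (IH (fun g => c g *
    (phi (involval g * P 1%g) - phi (involval g0 * P 1%g)))) => //.
  have : \sum_(g <- g0 :: r) i1 (c g *: (involval g * P 1%g)) * i2 (involval g * P 1%g) = 0.
    rewrite -[RHS](mul0r (X 1%g 1%g)) -[in RHS](linear0 Delta) -[in RHS]e0 (linear_sum Delta) mulr_suml.
    by apply: eq_bigr => h _; rewrite !linearZ_LR -!scalerAl Dg.
  move=> /(slice_sum tens vphi) e1.
  have : \sum_(g <- g0 :: r) (c g * (phi (involval g * P 1%g) - phi (involval g0 * P 1%g)))
       *: (involval g * P 1%g) = 0.
    have := congr1 (fun a => phi (involval g0 * P 1%g) *: a) e0; rewrite /= scaler0 => e2.
    rewrite -[RHS](subrr 0) -[X in _ = X - _]e1 -[X in _ = _ - X]e2.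
    rewrite scaler_sumr -sumrB; apply: eq_bigr => h _.
    by rewrite !scalerA -scalerBl; congr (_ *: _); ring.
  by rewrite big_cons subrr mulr0 scale0r add0r.
have cr g : g \in r -> c g = 0.
  move=> gr; have gg0 : involval g * P 1%g - involval g0 * P 1%g != 0.
    rewrite subr_eq0; apply: contraNneq g0r => e.
    rewrite (_ : g0 = g)//; apply/val_inj/esym; move: e.
    rewrite -[val g]/(involval g) -[val g0]/(involval g0).
    have [[w ->] [w' ->]] := (involval_rowword g, involval_rowword g0).
    exact: rowword_inj.
  have [phi vphi] := vector_functional_sep gg0.
  rewrite addrC -scaleN1r (vector_functional_linear vphi) mulN1r addrC => phi0.
  by have /eqP := key phi vphi g gr; rewrite mulf_eq0 (negPf phi0) orbF => /eqP.
move=> g; rewrite inE => /orP[/eqP->|/cr//]; move: e0.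
rewrite big_cons big_seq big1 ?addr0 => [/eqP|h /cr->]; last by rewrite scale0r.
have [w ->] := involval_rowword g0.
by rewrite scaler_eq0 (negPf (rowword_permproj_neq0 w 1%g)) orbF => /eqP.
Qed.

(** On the block (1, q) the comultiplication sends g P_q to g P_1 (x) g P_q. Slicing the second leg
    by a functional that does not vanish at g P_q reduces to the block of 1. *)
Lemma involval_free (r : seq Gam) (c : Gam -> R[i]) q : uniq r ->
  \sum_(g <- r) c g *: (involval g * P q) = 0 -> forall g, g \in r -> c g = 0.
Proof.
move=> ur e0 g gr; have [w gw] := involval_rowword g.
have [phi vphi phi0] := vector_functional_sep (rowword_permproj_neq0 w q).
have Dg (h : Gam) : Delta (involval h * P q) * X 1%g q =
    i1 (involval h * P 1%g) * i2 (involval h * P q).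
  by have [w' ->] := involval_rowword h; exact: Delta_grouplike.
have : \sum_(h <- r) i1 (c h *: (involval h * P 1%g)) * i2 (involval h * P q) = 0.
  rewrite -[RHS](mul0r (X 1%g q)) -[in RHS](linear0 Delta) -[in RHS]e0 (linear_sum Delta) mulr_suml.
  by apply: eq_bigr => h _; rewrite !linearZ_LR -!scalerAl Dg.
move=> /(slice_sum tens vphi) e1.
have /eqP : phi (involval g * P q) * c g = 0.
  apply: (@involval_free1 r (fun h => phi (involval h * P q) * c h)) => //.
  by rewrite -[RHS]e1; apply: eq_bigr => h _; rewrite scalerA.
by rewrite gw mulf_eq0 (negPf phi0) => /eqP.
Qed.

(** This is what makes the map out of A well defined: a combination of group elements that vanishes
    on one block has zero coefficients once equal elements are collected, so it vanishes in every
    algebra. *)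
Lemma gev_involval_eq0 (D : cstarAlgType R) (v : Gam -> D) t q :
  gev (fun g : Gam => involval g) t * P q = 0 -> gev v t = 0.
Proof.
rewrite !gev_collect mulr_suml => e.
rewrite big_seq big1// => g gr.
have -> : \sum_(x <- t | x.2 == g) x.1 = 0; last by rewrite scale0r.
apply: (@involval_free _ (fun g => \sum_(x <- t | x.2 == g) x.1) q (undup_uniq _) _ g gr).
by rewrite -[RHS]e; apply: eq_bigr => h _; rewrite -scalerAl.
Qed.

(** * The isomorphism between A and the tensor product of C*(Gamma) and C(S_n) *)

Section Reconstruction.
Context {B : cstarAlgType R} (v : Gam -> B).
Hypothesis vmax : max_group_cstar v.
Context {W : cstarAlgType R} (j1 : {lrmorphism B -> W}) (j2 : {lrmorphism csym R n -> W}).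
Context (e : 'S_n -> {lrmorphism W -> B}).
Hypothesis eS : forall q, star_hom (e q).
Hypothesis e_sep : forall x y, (forall q, e q x = e q y) -> x = y.
Hypothesis e_surj : forall f : 'S_n -> B, exists x, forall q, e q x = f q.
Hypothesis e1 : forall q b, e q (j1 b) = b.
Hypothesis e2 : forall q (f : csym R n), e q (j2 f) = (f q)%:A.

Local Notation ival := (fun g : Gam => involval g).

Lemma gev_ival : star_ev (@gone R Gam) (@glin R Gam) (@gmul R Gam) (@gstar R Gam) (gev ival).
Proof. exact/gev_star_ev/involval_rep. Qed.

Lemma gev_rep : star_ev (@gone R Gam) (@glin R Gam) (@gmul R Gam) (@gstar R Gam) (gev v).
Proof. by apply: gev_star_ev; have [] := vmax. Qed.

(* The graph of the morphism from A to C*(Gamma) (x) C(S_n). *)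
Definition related (a : A) (y : W) := forall q, exists t : seq (R[i] * Gam),
  a * P q = gev ival t * P q /\ e q y = gev v t.

Lemma related_fun a y y' : related a y -> related a y' -> y = y'.
Proof.
move=> ay ay'; apply: e_sep => q.
have [[t [at_ ->]] [t' [at' ->]]] := (ay q, ay' q).
have [_ L _ _] := gev_ival; have [_ L' _ _] := gev_rep.
apply/esym/subr0_eq; rewrite -scaleN1r addrC -L'; apply: (@gev_involval_eq0 _ _ _ q).
by rewrite L scaleN1r mulrDl mulNr -at_ -at' addNr.
Qed.

Lemma related1 : related 1 1.
Proof.
move=> q; exists (@gone R Gam); have [-> _ _ _] := gev_ival.
by have [-> _ _ _] := gev_rep; rewrite rmorph1.
Qed.

Lemma related_lin (c : R[i]) a b x y : related a x -> related b y ->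
  related (c *: a + b) (c *: x + y).
Proof.
move=> ax bx q; have [[t [at_ xt]] [t' [bt yt]]] := (ax q, bx q).
exists (glin c t t'); have [_ -> _ _] := gev_ival; have [_ -> _ _] := gev_rep.
by rewrite linearP/= xt yt !mulrDl -!scalerAl at_ bt.
Qed.

Lemma related_mul a b x y : related a x -> related b y -> related (a * b) (x * y).
Proof.
move=> ax bx q; have [[t [at_ xt]] [t' [bt yt]]] := (ax q, bx q).
exists (gmul t t'); have [_ _ -> _] := gev_ival; have [_ _ -> _] := gev_rep.
rewrite (rmorphM (e q))/= xt yt; split=> //.
by rewrite -mulrA bt -permprojC mulrA at_ -mulrA permprojC mulrA.
Qed.

Lemma related_star a x : related a x -> related (star a) (star x).
Proof.
move=> ax q; have [t [at_ xt]] := ax q.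
exists (gstar t); have [_ _ _ ->] := gev_ival; have [_ _ _ ->] := gev_rep.
rewrite eS xt; split=> //.
by rewrite -{1 2}(permproj_star q) -!starM permprojC at_ permprojC.
Qed.

Definition rowgen i : Gam := wprod_elt rowsum_sq rowsum_star [:: i].

Lemma involval_rowgen i : involval (rowgen i) = s i.
Proof. by rewrite /involval /= /wprod big_seq1. Qed.

Definition bowtie_entry i j : W := j1 (v (rowgen i)) * j2 (perm_coord R i j).
Local Notation U := bowtie_entry.

Lemma e_entry q i j : e q (U i j) = (q j == i)%:R *: v (rowgen i).
Proof. by rewrite (rmorphM (e q))/= e1 e2 ffunE -scalerAr mulr1. Qed.

Lemma related_entry i j : related (u i j) (U i j).
Proof.
move=> q; exists [:: ((q j == i)%:R, rowgen i)].
by rewrite /gev !big_seq1/= e_entry involval_rowgen entry_permproj scalerAl.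
Qed.

Lemma related_total a : star_alg_gen (entries u) a -> exists y, related a y.
Proof.
move=> aG; apply: (aG [set a | exists y, related a y]).
split; last by move=> _ [i [j ->]]; exists (U i j); apply: related_entry.
split=> [|c a' b [x ax] [y bx]|a' b [x ax] [y bx]|a' [x ax]].
- by exists 1; apply: related1.
- by exists (c *: x + y); apply: related_lin.
- by exists (x * y); apply: related_mul.
- by exists (star x); apply: related_star.
Qed.

Lemma reconstruction : maximal_version u ->
  exists f : {lrmorphism A -> W}, [/\ star_hom f, bijective f & forall i j, f (u i j) = U i j].
Proof.
move=> maxu; have [[genS1 genSl genSM genSS] genE] := star_alg_genP (entries u).
have /choice[f fP] : forall a, exists y, star_alg_gen (entries u) a -> related a y.
  move=> a; have [/related_total[y ay]|na] := pselect (star_alg_gen (entries u) a).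
    by exists y.
  by exists 0.
have [|F [FS Ff]] := maxu W f.
  split=> [|c x y xS yS|x y xS yS|x xS].
  - by apply: related_fun (fP _ genS1) related1.
  - by apply: related_fun (fP _ (genSl c x y xS yS)) (related_lin c (fP _ xS) (fP _ yS)).
  - by apply: related_fun (fP _ (genSM x y xS yS)) (related_mul (fP _ xS) (fP _ yS)).
  - by apply: related_fun (fP _ (genSS x xS)) (related_star (fP _ xS)).
have uE i j : star_alg_gen (entries u) (u i j) by apply: genE; exists i, j.
have FU i j : F (u i j) = U i j.
  by rewrite Ff//; apply: related_fun (fP _ (uE i j)) (related_entry i j).
have [vU vgen vuniv] := vmax; have [v1 vM vUU] := vU.
have [EB [EBS EBv]] := vuniv A ival (involval_rep rowsum_sq rowsum_star).
have PqC q a b : a * P q * (b * P q) = a * b * P q.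
  by rewrite -mulrA [P q * _]permprojC -mulrA permproj_mul eqxx scale1r mulrA.
have Pqr q r a b : q != r -> a * P q * (b * P r) = 0.
  move=> qr; rewrite -[b * P r]permprojC mulrA -(mulrA a) permproj_mul (negPf qr).
  by rewrite scale0r mulr0 mul0r.
(* The inverse: C*(Gamma) maps to A because Gamma consists of unitaries of A, and the central
   projections P_q glue the coordinates together. *)
pose E0 x := \sum_q EB (e q x) * P q.
have [E EE] : exists E : {lrmorphism W -> A}, E =1 E0.
  apply: mk_lrmorphism => [c x y||x y]; rewrite /E0.
  - rewrite scaler_sumr -big_split; apply: eq_bigr => q _ /=.
    by rewrite !linearP mulrDl -scalerAl.
  - by under eq_bigr do rewrite !rmorph1 mul1r; apply: sum_permproj.
  - rewrite mulr_suml; apply: eq_bigr => q _.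
    rewrite mulr_sumr (bigD1 q)//= big1 ?addr0 => [|r rq]; last by rewrite Pqr// eq_sym.
    by rewrite PqC (rmorphM (e q)) (rmorphM EB).
have ES : star_hom E.
  move=> x; rewrite !EE /E0 star_sum; apply: eq_bigr => q _.
  by rewrite starM permproj_star eS EBS permprojC.
have EU i j : E (U i j) = u i j.
  rewrite EE /E0 -[RHS]mulr1 -sum_permproj mulr_sumr; apply: eq_bigr => q _.
  by rewrite e_entry (linearZ_LR EB)/= EBv involval_rowgen entry_permproj scalerAl.
have EFS : star_hom (E \o F) by move=> x /=; rewrite FS ES.
have EF : cancel F E.
  apply: (star_hom_dense_eq (g := idfun) EFS _ ugen) => // x xS.
  apply: (xS [set x | E (F x) = x]); split; last by move=> _ [i [j ->]] /=; rewrite FU EU.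
  split=> [|c x' y' /= ex ey|x' y' /= ex ey|x' /= ex] /=.
  - by rewrite (rmorph1 F) (rmorph1 E).
  - by rewrite (linearP F) (linearP E)/= ex ey.
  - by rewrite (rmorphM F) (rmorphM E)/= ex ey.
  - by rewrite FS ES ex.
(* For the other composite [F] is evaluated on what [E] is built from: P_r goes to the indicator
   function of r, and s_i to the constant function [v (rowgen i)]. *)
have eFp q i j : e q (F (p i j)) = ((q j == i)%:R : B).
  rewrite (rmorphM F) (rmorphM (e q))/= FU e_entry -scalerAl -scalerAr -vM.
  have -> : (rowgen i * rowgen i = 1)%g.
    by apply: val_inj; have := rowsum_sq i; rewrite -!involval_rowgen.
  by rewrite v1; case: (_ == i); rewrite ?scale0r ?scaler0// !scale1r.
have eFP q r : e q (F (P r)) = ((q == r)%:R : B).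
  rewrite /P (rmorph_prod F) (rmorph_prod (e q))/=.
  under eq_bigr do rewrite eFp.
  have [<-|qr] := eqVneq q r; first by rewrite big1// => j _; rewrite eqxx.
  have [j qrj] : exists j, q j != r j.
    apply/existsP; rewrite -negb_forall; apply: contra qr => /forallP qr.
    by apply/eqP/permP => j; apply/eqP.
  have Cqr a b : ((q a == r a)%:R : B) * (q b == r b)%:R = (q b == r b)%:R * (q a == r a)%:R.
    by rewrite -!natrM mulnC.
  have idj : ((q j == r j)%:R : B) * (q j == r j)%:R = (q j == r j)%:R.
    by rewrite -natrM mulnb andbb.
  rewrite -(prod_idem (F := fun j => (q j == r j)%:R : B) Cqr idj (mem_index_enum j)).
  by rewrite (negPf qrj) mul0r.
have eFs q i : e q (F (s i)) = v (rowgen i).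
  rewrite (linear_sum F) (linear_sum (e q))/=.
  under eq_bigr do rewrite FU e_entry.
  rewrite (bigD1 (q^-1%g i))//= big1 ?addr0 => [|j]; first by rewrite permKV eqxx scale1r.
  move=> jn; have [qji|_] := eqVneq (q j) i; last by rewrite scale0r.
  by rewrite -qji permK eqxx in jn.
have eFEBS q : star_hom (e q \o (F \o EB)) by move=> x /=; rewrite EBS FS eS.
have eFEB q b : e q (F (EB b)) = b.
  apply: (star_hom_dense_eq (g := idfun) (eFEBS q) _ vgen) => // x xS.
  apply: (xS [set x | e q (F (EB x)) = x]); split; last first.
    move=> _ [g _ <-] /=; rewrite EBv.
    have [l gl] := involval_rowword g.
    have -> : g = wprod_elt rowsum_sq rowsum_star l by apply: val_inj.
    rewrite {1}/involval /=; elim: l {gl} => [|i l IH].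
      rewrite (_ : wprod_elt _ _ _ = 1%g) ?v1; last by apply: val_inj; rewrite /= /wprod big_nil.
      by rewrite /wprod big_nil (rmorph1 F) (rmorph1 (e q)).
    rewrite (_ : wprod_elt _ _ _ = rowgen i * wprod_elt rowsum_sq rowsum_star l)%g; last first.
      apply: val_inj; rewrite -[RHS]/(wprod s [:: i] * wprod s l) -[LHS]/(wprod s (i :: l)).
      by rewrite /wprod big_cons big_seq1.
    by rewrite vM -IH /wprod big_cons (rmorphM F) (rmorphM (e q))/= eFs.
  split=> [|c x' y' /= ex ey|x' y' /= ex ey|x' /= ex] /=.
  - by rewrite (rmorph1 EB) (rmorph1 F) (rmorph1 (e q)).
  - by rewrite (linearP EB) (linearP F) (linearP (e q))/= ex ey.
  - by rewrite (rmorphM EB) (rmorphM F) (rmorphM (e q))/= ex ey.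
  - by rewrite EBS FS eS ex.
have FE : cancel E F.
  move=> x; apply: e_sep => q; rewrite EE /E0 (linear_sum F) (linear_sum (e q))/=.
  rewrite (bigD1 q)//= big1 ?addr0 => [|r rq].
    by rewrite (rmorphM F) (rmorphM (e q))/= eFP eqxx mulr1 eFEB.
  by rewrite (rmorphM F) (rmorphM (e q))/= eFP eq_sym (negPf rq) mulr0.
by exists F; split=> //; exists E.
Qed.

End Reconstruction.

End FixedVectors.

End Comultiplication.

End SquareRelations.

Theorem easy_bowtie (R : realType) (n : nat) (A : cstarAlgType R) (u : 'M[A]_n)
    (C : forall k l, {set part k l}) :
  easy_quantum_group u C -> maximal_version u -> pi0 \in C 3%N 3%N ->
  exists (Gamma : groupType) (q : z2free n -> Gamma),
    strongly_symmetric_reflection_group q /\ iso_bowtie u q.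
Proof.
move=> [[[[uu uu'] ugen [T [i1 [i2 [Delta [tens DS DU]]]]] _] us] _ hom] maxu piC.
have urow i j : \sum_k u i k * u j k = (i == j)%:R.
  have := congr1 (fun M : 'M_n => M i j) uu; rewrite !mxE => <-.
  by apply: eq_bigr => k _; rewrite !mxE us.
have ucol i j : \sum_k u k i * u k j = (i == j)%:R.
  have := congr1 (fun M : 'M_n => M i j) uu'; rewrite !mxE => <-.
  by apply: eq_bigr => k _; rewrite !mxE us.
have upi := pi0_relation ((hom _ _ _).2 (memv_span (map_f _ (etrans (mem_enum _ _) piC)))).
pose ss := rowsum_sq urow upi; pose sS := rowsum_star us.
pose Gamma : groupType := involgroup ss sS.
have [B [v [vmax _]]] := @group_cstar R Gamma.
have [W [j1 [j2 [e [tW eS esep esurj [e1 e2]]]]]] := @perm_tensor R n B.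
have rel := rowword_relabel us urow ucol upi ugen tens DU hom.
have [F [FS Fb FU]] := reconstruction (us := us) (urow := urow) ucol (upi := upi) ugen tens DU hom vmax eS esep e1 e2 maxu.
pose gen i : Gamma := rowgen us urow upi i.
have genE i : involval (gen i) = rowsum u i by apply: involval_rowgen.
have gensq i : (gen i * gen i = 1)%g.
  by apply: val_inj; rewrite -[LHS]/(involval (gen i) * involval (gen i)) genE; apply: ss.
pose q := z2lift gen.
have qM : {morph q : x y / (x * y)%g} := z2liftM gensq.
have qgen i : q (z2gen i) = gen i := z2lift_gen gen i.
have fE (w : seq 'I_n) : involval (foldr (fun i g => gen i * g)%g 1%g w) = rowword u w.
  elim: w => [|i w IH]; first by rewrite rowword_nil.
  rewrite rowword_cons /= -IH -genE; exact: erefl.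
have fq (f : 'I_n -> 'I_n) (w : seq 'I_n) :
    q (foldr (fun i g => z2gen (f i) * g)%g 1%g w) = foldr (fun i g => gen i * g)%g 1%g (map f w).
  by elim: w => //= i w <-; rewrite qM qgen.
exists Gamma, q; split.
  split=> [//|g|phi x qx].
    have [w gw] := involvalP g.
    exists (foldr (fun i g => z2gen i * g)%g 1%g w).
    by rewrite (fq id) map_id; apply: val_inj; apply: etrans (fE w) _; exact: esym gw.
  (* Elements of Gamma are elements of A, so q x = 1 says s_w = 1 for the word w of x; hence s_w P_1
     = P_1, and [rel] yields s_(phi w) = 1. *)
  apply: val_inj; rewrite [q _](fq phi); apply: etrans (fE _) _; apply: rel.
  rewrite -[X in X * _](fE (z2word x)) -[foldr _ _ _]/(q x) qx.
  by rewrite -[involval _]/(1 : A) mul1r.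
exists B, v, W, j1, j2; split=> //; exists F; split=> // i j.
by rewrite FU mxE qgen.
Qed.

(** * The category of partitions of a reflection group *)

Section ConstantOnBlocks.
Variable I : Type.

Definition const_on (X : finType) (p : {set {set X}}) (f : X -> I) : Prop :=
  forall B, B \in p -> forall x y, x \in B -> y \in B -> f x = f y.

Lemma const_on_relabel (X Y : finType) (h : X -> Y) (p : {set {set X}}) (f : Y -> I) :
  const_on (relabel h p) f <-> const_on p (f \o h).
Proof.
split=> [H B Bp x y xB yB|H _ /imsetP[B Bp ->] _ _ /imsetP[x xB ->] /imsetP[y yB ->]].
  by apply: (H (h @: B)%SET); rewrite ?imset_f.
exact: H Bp _ _ xB yB.
Qed.

Lemma const_onU (X : finType) (p q : {set {set X}}) (f : X -> I) :
  const_on (p :|: q)%SET f <-> const_on p f /\ const_on q f.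
Proof.
split=> [H|[H H'] B]; first by split=> B Bp; apply: H; rewrite inE Bp ?orbT.
by rewrite inE => /orP[/H|/H'].
Qed.

Lemma const_on_equivalence (X : finType) (e : rel X) (f : X -> I) :
  (forall x y z, e z z * (e x y -> e x z = e y z)) ->
  const_on (equivalence_partition e [set: X]%SET) f <-> forall x y, e x y -> f x = f y.
Proof.
move=> eP; split=> [H x y exy|H _ /imsetP[z _ ->] x y].
  apply: (H [set t in [set: X] | e x t]%SET); first by apply/imsetP; exists x.
    by rewrite !inE (eP x x x).
  by rewrite !inE.
by rewrite !inE => zx zy; rewrite -(H z x zx) -(H z y zy).
Qed.

End ConstantOnBlocks.

Lemma relabel_partition (X Y : finType) (h : X -> Y) (p : {set {set X}}) :
  bijective h -> finset.partition p [set: X]%SET -> finset.partition (relabel h p) [set: Y]%SET.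
Proof.
move=> hb pP; have [k hk kh] := hb.
have -> : [set: Y]%SET = (h @: [set: X])%SET.
  by apply/setP => y; rewrite !inE; apply/esym/imsetP; exists (k y).
by rewrite imset_partition//; apply: bij_inj.
Qed.

Section CategoryOfGroup.
Context {n : nat} (i0 : 'I_n) {Gamma : groupType} (g : 'I_n -> Gamma).
Hypothesis gg : forall i, (g i * g i = 1)%g.

Definition lprod m (f : 'I_m -> 'I_n) : Gamma := (\prod_(r < m) g (f r))%g.

Lemma eq_lprod m (f f' : 'I_m -> 'I_n) : f =1 f' -> lprod f = lprod f'.
Proof. by move=> ff'; apply: eq_bigr => r _; rewrite ff'. Qed.

Definition part_compat k l (p : part k l) : Prop := forall f : 'I_k + 'I_l -> 'I_n,
  const_on p f -> lprod (f \o inl) = lprod (f \o inr).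

Definition group_parts k l : {set part k l} :=
  [set p : part k l | finset.partition p [set: _]%SET && `[< part_compat p >]]%SET.

Lemma group_partsP k l (p : part k l) :
  reflect (finset.partition p [set: _]%SET /\ part_compat p) (p \in group_parts k l).
Proof. by rewrite inE; apply: (iffP andP) => -[? /asboolP]. Qed.

Lemma group_parts_tensor k l k' l' (p : part k l) (q : part k' l') :
  p \in group_parts k l -> q \in group_parts k' l' ->
  part_tensor p q \in group_parts (k + k') (l + l').
Proof.
move=> /group_partsP[pP pC] /group_partsP[qP qC]; apply/group_partsP; split; last first.
  move=> f /const_onU[/const_on_relabel/pC e1 /const_on_relabel/qC e2].
  by rewrite /lprod !big_split_ord /=; congr (_ * _)%g.
rewrite /part_tensor; set h1 := (X in relabel X p); set h2 := (X in relabel X q).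
have h1I : injective h1 by move=> [x|x] [y|y] //= [] e; congr (_ _); apply/val_inj.
have h2I : injective h2.
  by move=> [x|x] [y|y] //= [] /addnI e; congr (_ _); apply/val_inj.
have /and3P[/eqP c1 t1 n1] : finset.partition (relabel h1 p) (h1 @: [set: _])%SET.
  by rewrite imset_partition.
have /and3P[/eqP c2 t2 n2] : finset.partition (relabel h2 q) (h2 @: [set: _])%SET.
  by rewrite imset_partition.
apply/and3P; split.
- rewrite /finset.cover finset.bigcup_setU -!/(finset.cover _) c1 c2.
  apply/eqP/setP => x; rewrite !inE; apply/orP.
  case: x => x; case: (split_ordP x) => y ->.
  + by left; apply/imsetP; exists (inl y).
  + by right; apply/imsetP; exists (inl y).
  + by left; apply/imsetP; exists (inr y).
  + by right; apply/imsetP; exists (inr y).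
- apply: trivIsetU => //; rewrite c1 c2 -setI_eq0; apply/eqP/setP => x; rewrite !inE.
  apply/negP => /andP[/imsetP[y _ ->] /imsetP[z _]].
  by case: y z => y [] z //= [] e; have := ltn_ord y; rewrite e ltnNge leq_addr.
- by rewrite inE negb_or n1.
Qed.

Lemma sum_swapK (X Y : Type) : cancel (@sum_swap X Y) (@sum_swap Y X).
Proof. by case. Qed.

Lemma group_parts_inv k l (p : part k l) :
  p \in group_parts k l -> part_inv p \in group_parts l k.
Proof.
move=> /group_partsP[pP pC]; apply/group_partsP; split.
  by apply: relabel_partition pP; exists (@sum_swap _ _); apply: sum_swapK.
by move=> f /const_on_relabel/pC/esym.
Qed.

Lemma rot_point_bij (e : forall m, 'I_m.+1) k l : bijective (@rot_point e k l).
Proof.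
pose back (x : 'I_k + 'I_l.+1) : 'I_k.+1 + 'I_l := match x with
  | inl i => inl (lift (e k) i)
  | inr j => if unlift (e l) j is Some j' then inr j' else inl (e k) end.
exists back => [[i|j]|[i|j]] /=.
- by case: unliftP => [i' ->|->] /=; rewrite ?unlift_none.
- by rewrite liftK.
- by rewrite liftK.
- by case: unliftP => [j' ->|->] /=; rewrite ?unlift_none.
Qed.

Lemma group_parts_rot_down (e : forall m, 'I_m.+1) k l (p : part k.+1 l) :
  (forall (f : 'I_k + 'I_l.+1 -> 'I_n),
     lprod (f \o @rot_point e k l \o inl) = lprod (f \o @rot_point e k l \o inr) ->
     lprod (f \o inl) = lprod (f \o inr)) ->
  p \in group_parts k.+1 l -> part_rot_down e p \in group_parts k l.+1.
Proof.
move=> H /group_partsP[pP pC]; apply/group_partsP; split.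
  exact: relabel_partition (@rot_point_bij e k l) pP.
by move=> f /const_on_relabel/pC; apply: H.
Qed.

(** The generators are involutions, so moving a letter to the same end of the other word multiplies
    both sides of the equation by it. *)
Lemma group_parts_rot_left k l (p : part k.+1 l) :
  p \in group_parts k.+1 l -> part_rot_down (@ord0) p \in group_parts k l.+1.
Proof.
apply: group_parts_rot_down => f; rewrite /lprod !big_ord_recl /= unlift_none.
under eq_bigr do rewrite liftK.
by move=> <-; rewrite mulgA gg mul1g.
Qed.

Lemma lift_max m (i : 'I_m) : lift ord_max i = widen_ord (leqnSn m) i.
Proof. by apply: val_inj; rewrite /= /bump leqNgt ltn_ord add0n. Qed.

Lemma group_parts_rot_right k l (p : part k.+1 l) :
  p \in group_parts k.+1 l -> part_rot_down (@ord_max) p \in group_parts k l.+1.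
Proof.
apply: group_parts_rot_down => f.
have -> : lprod (f \o @rot_point (@ord_max) k l \o inl) =
    (lprod (f \o inl) * g (f (inr ord_max)))%g.
  rewrite /lprod big_ord_recr /= unlift_none; congr (_ * _)%g.
  by apply: eq_bigr => i _; rewrite -lift_max liftK.
have -> : lprod (f \o inr) =
    (lprod (f \o @rot_point (@ord_max) k l \o inr) * g (f (inr ord_max)))%g.
  rewrite /lprod big_ord_recr /=; congr (_ * _)%g.
  by apply: eq_bigr => i _; rewrite -lift_max.
by move=> <-; rewrite -mulgA gg mulg1.
Qed.

Lemma group_parts_pair k l : (k + l)%N = 2 -> [set [set: _]]%SET \in group_parts k l.
Proof.
move=> kl; apply/group_partsP; split.
  apply/and3P; split; rewrite ?inE.
  - by rewrite /finset.cover big_set1.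
  - by apply/finset.trivIsetP => A B; rewrite !inE => /eqP-> /eqP->; rewrite eqxx.
  - by rewrite eq_sym -card_gt0 cardsT card_sum !card_ord kl.
move=> f fc; have fE x y : f x = f y by apply: (fc [set: _]%SET); rewrite !inE.
case: k l kl f fc fE => [|[|[|k]]] [|[|[|l]]] //= _ f _ fE; rewrite /lprod !big_ord_recl !big_ord0.
- by rewrite !mulg1 /= (fE (inr (lift ord0 ord0)) (inr ord0)) gg.
- by rewrite !mulg1 /= (fE (inl ord0) (inr ord0)).
- by rewrite !mulg1 /= (fE (inl (lift ord0 ord0)) (inl ord0)) gg.
Qed.

(** A labelling of the outer points that is constant along connections extends to the middle row: a
    middle point takes the label of an outer point connected to it, or the default [i0] if there is
    none. The middle word then links the upper one to the lower one. *)
Lemma group_parts_comp k l m (p : part k l) (q : part l m) :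
  p \in group_parts k l -> q \in group_parts l m -> part_comp q p \in group_parts k m.
Proof.
move=> /group_partsP[pP pC] /group_partsP[qP qC].
pose out (x : 'I_k + 'I_m) : 'I_k + 'I_l + 'I_m :=
  match x with inl i => inl (inl i) | inr h => inr h end.
pose e (x y : 'I_k + 'I_m) := connect (Defs.glue p q) (out x) (out y).
have gs : symmetric (Defs.glue p q).
  by move=> x y; rewrite /Defs.glue; congr orb; apply: eq_existsb => B; rewrite andbA andbC andbA [(y \in B) && _]andbC -andbA andbC.
have cs := sym_connect_sym gs.
have eP x y z : e z z * (e x y -> e x z = e y z).
  by split=> [|exy]; [exact: connect0 | exact: same_connect cs _ _ exy _].
apply/group_partsP; split.
  by apply: equivalence_partitionP => x y z _ _ _; apply: eP.
move=> f /(const_on_equivalence f eP) fe.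
pose f' (z : 'I_k + 'I_l + 'I_m) : 'I_n :=
  if [pick x | connect (Defs.glue p q) (out x) z] is Some x then f x else i0.
have f'out x : f' (out x) = f x.
  rewrite /f'; case: pickP => [y yx|/(_ x)]; first exact: fe.
  by rewrite connect0.
have f'glue x y : Defs.glue p q x y -> f' x = f' y.
  move=> xy; rewrite /f'.
  rewrite (eq_pick (Q := fun z => connect (Defs.glue p q) (out z) y))// => z.
  by rewrite !(cs (out z)); apply: same_connect; rewrite // connect1.
have f'p : const_on p (f' \o inl).
  apply/const_on_relabel => B Bp x y xB yB; apply: f'glue; apply/orP; left.
  by apply/exists_inP; exists B => //; rewrite xB.
have f'q : const_on q (fun x : 'I_l + 'I_m =>
    f' match x with inl j => inl (inr j) | inr h => inr h end).
  apply/(const_on_relabel _ _ f') => B Bp x y xB yB; apply: f'glue; apply/orP; right.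
  by apply/exists_inP; exists B => //; rewrite xB.
have e1 := pC _ f'p; have e2 := qC _ f'q.
rewrite (eq_lprod (f' := f' \o inl \o inl)); last by move=> r /=; rewrite -(f'out (inl r)).
rewrite [RHS](eq_lprod (f' := f' \o inr)); last by move=> r /=; rewrite -(f'out (inr r)).
by apply: etrans e1 _; apply: etrans _ e2.
Qed.

Lemma group_parts_category : partition_category group_parts.
Proof.
split.
- by move=> k l p /group_partsP[].
- exact: group_parts_tensor.
- exact: group_parts_comp.
- exact: group_parts_inv.
- exact: group_parts_rot_left.
- exact: group_parts_rot_right.
- by move=> k l p /group_parts_inv/group_parts_rot_left/group_parts_inv.
- by move=> k l p /group_parts_inv/group_parts_rot_right/group_parts_inv.
- exact: group_parts_pair.
Qed.

(** Admissible labellings read a a b above and b a a below; the squares cancel and both words give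
    the generator of b. *)
Lemma group_parts_pi0 : pi0 \in group_parts 3%N 3%N.
Proof.
have i0E : inord 0 = ord0 :> 'I_3 by apply: val_inj; rewrite /= inordK.
have i1E : inord 1 = lift ord0 ord0 :> 'I_3 by apply: val_inj; rewrite /= inordK.
have i2E : inord 2 = lift ord0 (lift ord0 ord0) :> 'I_3 by apply: val_inj; rewrite /= inordK.
have I3 (x : 'I_3) : [\/ x = ord0, x = lift ord0 ord0 | x = lift ord0 (lift ord0 ord0)].
  by case: x => [[|[|[|]]] lx] //; [apply: Or31|apply: Or32|apply: Or33]; apply: val_inj.
rewrite /pi0 i0E i1E i2E.
set B1 := (X in [set X; _]%SET); set B2 := (X in [set _; X]%SET).
have B12 : (B1 :&: B2)%SET = finset.set0.
  by apply/setP; case=> x; rewrite !inE; case: (I3 x) => ->.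
apply/group_partsP; split.
  apply/and3P; split.
  - rewrite /finset.cover finset.bigcup_setU !big_set1; apply/eqP/setP => x; rewrite !inE.
    by case: x => x; case: (I3 x) => ->.
  - apply/finset.trivIsetP => A B; rewrite !inE => /orP[]/eqP-> /orP[]/eqP->; rewrite ?eqxx//.
      by rewrite -finset.setI_eq0 B12.
    by rewrite -finset.setI_eq0 finset.setIC B12.
  - rewrite !inE negb_or; apply/andP; split; apply/eqP => /setP.
      by move=> /(_ (inl ord0)); rewrite !inE.
    by move=> /(_ (inr ord0)); rewrite !inE.
move=> f fc; rewrite /lprod !big_ord_recl !big_ord0 !mulg1 /=.
have f1 x y : x \in B1 -> y \in B1 -> f x = f y by apply: fc; rewrite !inE eqxx.
have f2 x y : x \in B2 -> y \in B2 -> f x = f y by apply: fc; rewrite !inE eqxx orbT.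
rewrite (f1 (inl (lift ord0 ord0)) (inl ord0)) ?inE// mulgA gg mul1g.
rewrite (f1 (inr (lift ord0 ord0)) (inl ord0)) ?inE//.
rewrite (f1 (inr (lift ord0 (lift ord0 ord0))) (inl ord0)) ?inE// gg mulg1.
by rewrite (f2 _ (inr ord0)) ?inE.
Qed.

End CategoryOfGroup.

(** * Labellings up to permutation, and the span of the T_p *)

Section SameKernel.
Context {n : nat} {X : finType}.
Implicit Types f : X -> 'I_n.

Lemma same_kernel_perm f f' : (forall x y, (f x == f y) = (f' x == f' y)) ->
  exists s : 'S_n, forall x, f' x = s (f x).
Proof.
move=> ff'; pose rep x := odflt x [pick y | f y == f x].
have repE x : f (rep x) = f x by rewrite /rep; case: pickP => [y /eqP|].
have repE' x : f' (rep x) = f' x by apply/eqP; rewrite -ff' repE.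
have rep_rep x y : f x = f y -> rep x = rep y.
  move=> e; rewrite /rep (eq_pick (Q := fun z => f z == f y)); last by move=> z; rewrite /= e.
  by case: pickP => [//|/(_ y)]; rewrite eqxx.
pose R := [seq x <- enum X | rep x == x].
have RP x : rep x \in R by rewrite mem_filter mem_enum andbT; apply/eqP/rep_rep; rewrite repE.
have uR : uniq R by apply/filter_uniq/enum_uniq.
pose ext h := map h R ++ [seq i <- enum 'I_n | i \notin map h R].
have ext_uniq h : (forall x y, (f x == f y) = (h x == h y)) -> uniq (ext h).
  move=> fh; rewrite cat_uniq; apply/and3P; split; last exact/filter_uniq/enum_uniq.
    rewrite map_inj_in_uniq ?uR// => x y.
    rewrite !mem_filter => /andP[/eqP xr _] /andP[/eqP yr _] /eqP.
    by rewrite -fh => /eqP/rep_rep; rewrite xr yr.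
  by apply/hasPn => i; rewrite mem_filter => /andP[].
have ext_mem h i : i \in ext h.
  by rewrite mem_cat mem_filter mem_enum andbT orbN.
have ext_size h : (forall x y, (f x == f y) = (h x == h y)) -> size (ext h) = n.
  move=> fh; rewrite -[RHS]card_ord cardE; apply/eqP; rewrite -uniq_size_uniq ?ext_uniq//.
    exact: enum_uniq.
  by move=> i; rewrite mem_enum ext_mem.
have [u u'] := (ext_uniq f (fun _ _ => erefl), ext_uniq f' ff').
have sz : size (ext f) = size (ext f') by rewrite !ext_size.
pose s0 i := nth i (ext f') (index i (ext f)).
have s0I : injective s0.
  move=> i j; have il : (index i (ext f) < size (ext f'))%N by rewrite -sz index_mem.
  have jl : (index j (ext f) < size (ext f'))%N by rewrite -sz index_mem.
  rewrite /s0 (set_nth_default j) // => /eqP; rewrite nth_uniq// => /eqP e.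
  by rewrite -(nth_index j (ext_mem f i)) e nth_index.
exists (perm s0I) => x; rewrite permE -(repE x) -(repE' x) /s0.
have rl : (index (rep x) R < size R)%N by rewrite index_mem.
have e1 : f (rep x) = nth (f (rep x)) (ext f) (index (rep x) R).
  by rewrite nth_cat size_map rl (nth_map (rep x)) ?nth_index.
rewrite {2}e1 index_uniq//; last by rewrite size_cat size_map ltn_addr.
by rewrite nth_cat size_map rl (nth_map (rep x)) ?nth_index.
Qed.

Lemma coarser_factor f f' : (forall x y, f x = f y -> f' x = f' y) ->
  exists phi : 'I_n -> 'I_n, forall x, f' x = phi (f x).
Proof.
move=> ff'; exists (fun i => if [pick x | f x == i] is Some x then f' x else i) => x.
by case: pickP => [y /eqP/ff'//|/(_ x)]; rewrite eqxx.
Qed.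

Lemma coarser_card f f' : (forall x y, f x = f y -> f' x = f' y) ->
  (#|(f' @: [set: X])%SET| <= #|(f @: [set: X])%SET|)%N /\
  (#|(f' @: [set: X])%SET| = #|(f @: [set: X])%SET| -> forall x y, (f x == f y) = (f' x == f' y)).
Proof.
move=> ff'; have [phi phiE] := coarser_factor ff'.
have -> : (f' @: [set: X] = phi @: (f @: [set: X]))%SET.
  by rewrite -imset_comp; apply: eq_imset.
split; first exact: leq_imset_card.
move=> /eqP/imset_injP pI x y; apply/eqP/eqP => [/ff'//|].
by rewrite !phiE => /pI; apply; apply: imset_f.
Qed.

End SameKernel.

Section SpanOfPartitions.
Context {R : realType} {n : nat} {Gamma : groupType} (g : 'I_n -> Gamma).

Definition tlabel k l (i : k.-tuple 'I_n) (j : l.-tuple 'I_n) (x : 'I_k + 'I_l) : 'I_n :=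
  match x with inl r => tnth i r | inr r => tnth j r end.

Lemma delta_part_const k l (p : part k l) i j :
  delta_part p i j <-> const_on p (tlabel i j).
Proof. by split=> [/delta_partP//|H]; apply/delta_partP. Qed.

Definition tprod k (i : k.-tuple 'I_n) : Gamma := lprod g (tnth i).

Hypothesis tprod_map : forall (phi : 'I_n -> 'I_n) k l (i : k.-tuple 'I_n) (j : l.-tuple 'I_n),
  tprod i = tprod j -> tprod (map_tuple phi i) = tprod (map_tuple phi j).

Local Notation kerp f := (preim_partition f [set: _]%SET).

Lemma const_on_kernel (X : finType) (f f' : X -> 'I_n) :
  const_on (kerp f) f' <-> forall x y, f x = f y -> f' x = f' y.
Proof.
have eP x y z : [rel x y | f x == f y] z z *
    ([rel x y | f x == f y] x y -> [rel x y | f x == f y] x z = [rel x y | f x == f y] y z).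
  by split=> //= /eqP->.
apply: iff_trans (const_on_equivalence f' eP) _.
by split=> H x y => [fxy|/eqP]; apply: H => //=; apply/eqP.
Qed.

Lemma tlabel_map (phi : 'I_n -> 'I_n) k l (i i0 : k.-tuple 'I_n) (j j0 : l.-tuple 'I_n) :
  (forall x, tlabel i j x = phi (tlabel i0 j0 x)) ->
  i = map_tuple phi i0 /\ j = map_tuple phi j0.
Proof.
move=> H; split; apply: eq_from_tnth => r; rewrite tnth_map.
  exact: (H (inl r)).
exact: (H (inr r)).
Qed.

Lemma tlabel_eta k l (f : 'I_k + 'I_l -> 'I_n) :
  f =1 tlabel [tuple f (inl r) | r < k] [tuple f (inr r) | r < l].
Proof. by case=> r; rewrite /= tnth_mktuple. Qed.

(** Any labelling constant on the blocks of the kernel is some phi applied to the given one, and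
    [tprod_map] carries the equality of words over. *)
Lemma kernel_group_parts k l (i : k.-tuple 'I_n) (j : l.-tuple 'I_n) :
  tprod i = tprod j -> kerp (tlabel i j) \in group_parts g k l.
Proof.
move=> ij; apply/group_partsP; split; first exact: preim_partitionP.
move=> f /const_on_kernel/coarser_factor[phi fphi].
have [e1 e2] : [tuple f (inl r) | r < k] = map_tuple phi i /\
               [tuple f (inr r) | r < l] = map_tuple phi j.
  by apply: tlabel_map => x; rewrite -tlabel_eta.
have := tprod_map phi ij; rewrite -e1 -e2 /tprod.
have E1 : lprod g (tnth [tuple f (inl r) | r < k]) = lprod g (f \o inl).
  by apply: eq_lprod => r; rewrite tnth_mktuple.
have E2 : lprod g (tnth [tuple f (inr r) | r < l]) = lprod g (f \o inr).
  by apply: eq_lprod => r; rewrite tnth_mktuple.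
by rewrite E1 E2.
Qed.

Lemma delta_part_tprod k l (p : part k l) i j :
  p \in group_parts g k l -> delta_part p i j -> tprod i = tprod j.
Proof. by move=> /group_partsP[_ pC] /delta_part_const/pC. Qed.

(* Subtracting M(i, j) T_p for the kernels p of the labellings (i, j) with the
   most values leaves an invariant matrix supported on labellings with fewer. *)
Lemma invariant_span k l (M : 'M[R[i]]_(tdim n l, tdim n k)) :
  (forall (q : 'S_n) j i, M (enum_rank (map_tuple q j)) (enum_rank (map_tuple q i)) =
    M (enum_rank j) (enum_rank i)) ->
  (forall j i, M (enum_rank j) (enum_rank i) != 0 -> tprod i = tprod j) ->
  M \in <<[seq Tpart n p | p <- enum (group_parts g k l)]>>%VS.
Proof.
pose im (i : k.-tuple 'I_n) (j : l.-tuple 'I_n) := #|(tlabel i j @: [set: _])%SET|.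
have [m] : exists m, forall j i, M (enum_rank j) (enum_rank i) != 0 -> (im i j < m)%N.
  by exists n.+1 => j i _; rewrite ltnS -[X in (_ <= X)%N]card_ord max_card.
elim: m M => [|m IH] M Mm inv supp.
  rewrite (_ : M = 0) ?mem0v//; apply/matrixP => j i; rewrite mxE.
  rewrite -(enum_valK j) -(enum_valK i); apply/eqP/negPn/negP => /Mm.
  by rewrite ltn0.
pose P p (ij : k.-tuple 'I_n * l.-tuple 'I_n) :=
  [&& M (enum_rank ij.2) (enum_rank ij.1) != 0, im ij.1 ij.2 == m & kerp (tlabel ij.1 ij.2) == p].
(* Any labelling with kernel p may supply the coefficient: two of them differ by a permutation of
   the labels, under which M is invariant. *)
pose c (p : part k l) : R[i] :=
  if [pick ij | P p ij] is Some ij then M (enum_rank ij.2) (enum_rank ij.1) else 0.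
have cP p : c p != 0 -> exists i j, P p (i, j).
  by rewrite /c; case: pickP => [[i j] Pij _|]; [exists i, j | rewrite eqxx].
have cG p : c p != 0 -> p \in group_parts g k l.
  by move=> /cP[i [j /and3P[/supp ij _ /eqP<-]]]; apply: kernel_group_parts.
pose S := \sum_p c p *: Tpart n p : 'M[R[i]]_(tdim n l, tdim n k).
have SE j i : S (enum_rank j) (enum_rank i) = \sum_p c p * (delta_part p i j)%:R.
  by rewrite summxE; apply: eq_bigr => p _; rewrite mxE TpartE.
have Sspan : S \in <<[seq Tpart n p | p <- enum (group_parts g k l)]>>%VS.
  apply: memv_suml => p _; have [->|/cG pG] := eqVneq (c p) 0; first by rewrite scale0r mem0v.
  by apply/memvZ/memv_span/map_f; rewrite mem_enum.
rewrite -(subrK S M); apply: memvD => //; apply: IH => [j i|q j i|j i].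
- rewrite ltnNge; apply: contra_neqN => mi; rewrite mxE [X in _ + X]mxE SE.
  (* A labelling constant on the blocks of p is coarser than one with m values; having at least m
     values itself, it has exactly m and therefore the same kernel. *)
  have coarse p : c p * (delta_part p i j)%:R != 0 ->
      im i j = m /\ p = kerp (tlabel i j).
    rewrite mulf_eq0 negb_or => /andP[/cP[i' [j' /and3P[_ /eqP im' /eqP<-]]]].
    rewrite pnatr_eq0 eqb0 negbK => /delta_part_const/const_on_kernel co.
    have [le eq] := coarser_card co.
    have imm : im i j = m by apply/eqP; rewrite eqn_leq mi andbT -im'.
    split=> //; apply: eq_in_imset => x _; apply/setP => y; rewrite !inE.
    by apply: eq; rewrite -[LHS]/(im i j) imm; apply/esym.
  have [/eqP im_m|im_m] := eqVneq (im i j) m; last first.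
    rewrite big1 => [|p _]; last by apply: contra_neq_eq im_m => /coarse[].
    rewrite oppr0 addr0; apply: contra_neq_eq im_m => /Mm; rewrite ltnS => mi'.
    by apply/eqP; rewrite eqn_leq mi'.
  rewrite (bigD1 (kerp (tlabel i j)))//= big1 ?addr0 => [|p]; last first.
    by apply: contraNeq => /coarse[_ ->].
  have -> : delta_part (kerp (tlabel i j)) i j by apply/delta_part_const/const_on_kernel.
  rewrite mulr1 /c; case: pickP => [[i' j'] /and3P[_ _ /eqP ke]|/(_ (i, j))].
    have co : forall x y, tlabel i j x = tlabel i j y -> tlabel i' j' x = tlabel i' j' y.
      by apply/const_on_kernel; rewrite /= -ke; apply/const_on_kernel.
    have co' : forall x y, tlabel i' j' x = tlabel i' j' y -> tlabel i j x = tlabel i j y.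
      by apply/const_on_kernel; rewrite /= ke; apply/const_on_kernel.
    have [|s sE] := @same_kernel_perm _ _ (tlabel i j) (tlabel i' j').
      by move=> x y; apply/eqP/eqP => [/co|/co'].
    by have [-> ->] := tlabel_map sE; rewrite inv subrr.
  by rewrite /P /= im_m eqxx !andbT => /negbFE/eqP->; rewrite subrr.
- rewrite mxE [X in _ + X]mxE [in RHS]mxE [X in _ = _ + X]mxE !SE inv; congr (_ - _).
  by apply: eq_bigr => p _; rewrite delta_part_perm.
- rewrite mxE [X in _ + X]mxE SE; have [M0|/supp//] := eqVneq (M (enum_rank j) (enum_rank i)) 0.
  rewrite M0 add0r oppr_eq0 => S0; have [//|ij] := eqVneq (tprod i) (tprod j).
  case/eqP: S0; apply: big1 => p _; have [->|/cG pG] := eqVneq (c p) 0; first by rewrite mul0r.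
  case: (boolP (delta_part p i j)) => [/(delta_part_tprod pG)/eqP|_]; last by rewrite mulr0.
  by rewrite (negPf ij).
Qed.

End SpanOfPartitions.

(** * The quantum group of a reflection group *)

Lemma star_hom_cvg (R : realType) (A B : cstarAlgType R) (f : {lrmorphism A -> B}) u x :
  star_hom f -> cvgC u x -> cvgC (fun m => f (u m)) (f x).
Proof.
move=> fS; apply: (ncvg_comp (f := f) ler01) => y.
by rewrite -raddfB mul1r star_hom_contractive.
Qed.

Lemma cvgC_sum (R : realType) (A : cstarAlgType R) (I : Type) (r : seq I)
    (u : I -> nat -> A) (l : I -> A) :
  (forall i, cvgC (u i) (l i)) -> cvgC (fun m => \sum_(i <- r) u i m) (\sum_(i <- r) l i).
Proof.
move=> ul; elim: r => [|i r IH].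
  by rewrite big_nil; under eq_fun do rewrite big_nil; apply: cvgC_cst.
by rewrite big_cons; under eq_fun do rewrite big_cons; apply: cvgCD.
Qed.

Lemma star_hom_commute (R : realType) (B D : cstarAlgType R) (S : set B)
    (F : {lrmorphism B -> D}) (r : D) :
  star_hom F -> cstar_generates S -> star r = r ->
  (forall b, S b -> F b * r = r * F b) -> forall b, F b * r = r * F b.
Proof.
move=> FS gen rS comm b; have [u uS ub] := cstar_dense_cvg gen b.
have ru m : F (u m) * r = r * F (u m).
  apply: (uS m [set b | F b * r = r * F b]); split=> //.
  split=> [|c x y /= ex ey|x y /= ex ey|x /= ex] /=.
  - by rewrite rmorph1 mulr1 mul1r.
  - by rewrite (linearP F)/= mulrDl mulrDr -scalerAl -scalerAr ex ey.
  - by rewrite (rmorphM F)/= -mulrA ey mulrA ex mulrA.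
  - by apply: (can_inj (@starK _ D)); rewrite !starM rS -FS starK ex.
have cb := star_hom_cvg FS ub.
apply: (cvgC_uniq (cvgCMr r cb)); under eq_fun do rewrite ru.
exact: cvgCMl.
Qed.

Section PermTensor.
Context {R : realType} {n : nat} {B W : cstarAlgType R}.
Context (j1 : {lrmorphism B -> W}) (j2 : {lrmorphism csym R n -> W}).
Context (e : 'S_n -> {lrmorphism W -> B}).
Hypothesis eS : forall r, star_hom (e r).
Hypothesis e_sep : forall x y, (forall r, e r x = e r y) -> x = y.
Hypothesis e1 : forall r b, e r (j1 b) = b.
Hypothesis e2 : forall r (f : csym R n), e r (j2 f) = (f r)%:A.

Definition tdelta (r : 'S_n) : W := j2 (csym_delta r).
Local Notation Q := tdelta.

Lemma e_tdelta r t : e r (Q t) = (r == t)%:R.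
Proof. by rewrite e2 ffunE; case: (_ == _); rewrite ?scale1r ?scale0r. Qed.

Lemma tdelta_mul r t : Q r * Q t = (r == t)%:R *: Q r.
Proof.
apply: e_sep => k; rewrite (rmorphM (e k))/= !e_tdelta; have [<-|rt] := eqVneq r t.
  by rewrite scale1r e_tdelta -natrM mulnb andbb.
rewrite scale0r (linear0 (e k)) -natrM mulnb; have [->|_] := eqVneq k r; last by [].
by rewrite (negPf rt).
Qed.

Lemma tdelta_star r : star (Q r) = Q r.
Proof.
apply: e_sep => t; rewrite eS e_tdelta; case: (_ == _); rewrite ?star1//.
exact: star0.
Qed.

Lemma tdelta_sum : \sum_r Q r = 1.
Proof. by rewrite -(linear_sum j2) csym_delta_sum rmorph1. Qed.

Lemma tdeltaC r x : Q r * x = x * Q r.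
Proof.
apply: e_sep => t; rewrite !(rmorphM (e t))/= e_tdelta.
by case: (_ == _); rewrite ?mul1r ?mulr1 ?mul0r ?mulr0.
Qed.

Lemma tdelta_e r x : x * Q r = j1 (e r x) * Q r.
Proof.
apply: e_sep => t; rewrite !(rmorphM (e t))/= e_tdelta e1.
by have [->|_] := eqVneq t r; rewrite ?mulr1 ?mulr0.
Qed.

Lemma tdelta_decomp x : x = \sum_r j1 (e r x) * Q r.
Proof.
by rewrite -[LHS]mulr1 -tdelta_sum mulr_sumr; apply: eq_bigr => r _; apply: tdelta_e.
Qed.

(** By [tdelta_decomp] an element of W is given by its coordinates, so a morphism F on these and
    orthogonal projections of sum 1 commuting with its image determine a morphism on W. *)
Lemma perm_tensor_lift (D : cstarAlgType R) (F : {lrmorphism B -> D}) (P : 'S_n -> D) :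
  star_hom F -> (forall r t, P r * P t = (r == t)%:R *: P r) ->
  (forall r, star (P r) = P r) -> \sum_r P r = 1 -> (forall r b, F b * P r = P r * F b) ->
  exists E : {lrmorphism W -> D},
    [/\ star_hom E, forall x, E x = \sum_r F (e r x) * P r & forall r, E (Q r) = P r].
Proof.
move=> FS PM PS P1 PC; pose E0 x := \sum_r F (e r x) * P r.
have [E EE] : exists E : {lrmorphism W -> D}, E =1 E0.
  apply: mk_lrmorphism => [c x y||x y]; rewrite /E0.
  - rewrite scaler_sumr -big_split; apply: eq_bigr => q _ /=.
    by rewrite !linearP mulrDl -scalerAl.
  - by under eq_bigr do rewrite !rmorph1 mul1r; apply: P1.
  - rewrite mulr_suml; apply: eq_bigr => q _.
    have PP r : F (e q x) * P q * (F (e r y) * P r) = (q == r)%:R *: (F (e q x) * F (e r y) * P q).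
      by rewrite -mulrA (mulrA (P q)) -PC -(mulrA _ (P q)) PM mulrA -scalerAr.
    rewrite mulr_sumr (bigD1 q)//= big1 ?addr0 => [|r rq]; last first.
      by rewrite PP eq_sym (negPf rq) scale0r.
    by rewrite PP eqxx scale1r (rmorphM (e q)) (rmorphM F).
exists E; split=> // [x|r].
  by rewrite !EE /E0 star_sum; apply: eq_bigr => q _; rewrite starM PS eS -FS PC.
rewrite EE /E0 (bigD1 r)//= big1 ?addr0 => [|t tr]; rewrite e_tdelta ?eqxx ?rmorph1 ?mul1r//.
by rewrite (negPf tr) (linear0 F) mul0r.
Qed.

End PermTensor.

Section ReflectionGroup.
Context {n : nat} {Gamma : groupType} (q : z2free n -> Gamma).
Hypothesis qP : strongly_symmetric_reflection_group q.

Let qM : {morph q : x y / (x * y)%g}. Proof. by have [] := qP. Qed.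

Lemma srg_q1 : q 1%g = 1%g.
Proof. by apply: (mulgI (q 1%g)); rewrite -qM !mulg1. Qed.

Definition srg_gen i : Gamma := q (z2gen i).

Lemma srg_gen_sq i : (srg_gen i * srg_gen i = 1)%g.
Proof. by rewrite -qM z2gen_sq srg_q1. Qed.

Lemma z2sigmaM (phi : 'I_n -> 'I_n) : {morph z2sigma phi : x y / (x * y)%g}.
Proof. by apply: z2liftM => i; apply: z2gen_sq. Qed.

Lemma srg_q_sigma (phi : 'I_n -> 'I_n) x y : q x = q y -> q (z2sigma phi x) = q (z2sigma phi y).
Proof.
move=> qxy; have [_ _ sym] := qP; apply: (mulIg (q (z2sigma phi y^-1%g))).
rewrite -!qM -!z2sigmaM mulgV (sym phi 1%g srg_q1) sym//.
by rewrite qM qxy -qM mulgV srg_q1.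
Qed.

(** The endomorphism of Gamma induced by sigma_phi, computed on a chosen preimage; by strong
    symmetry the choice does not matter ([srg_actE]). *)
Definition srg_act (phi : 'I_n -> 'I_n) (h : Gamma) : Gamma :=
  q (z2sigma phi (xget 1%g [set x | q x = h])).

Lemma srg_actE phi x : srg_act phi (q x) = q (z2sigma phi x).
Proof. by apply: srg_q_sigma; apply: (@xgetPex _ 1%g [set y | q y = q x]); exists x. Qed.

Lemma srg_actM phi : {morph srg_act phi : x y / (x * y)%g}.
Proof.
move=> x y; have [_ qs _] := qP; have [[x' <-] [y' <-]] := (qs x, qs y).
by rewrite -qM !srg_actE z2sigmaM qM.
Qed.

Lemma srg_act1 phi : srg_act phi 1%g = 1%g.
Proof. by apply: (mulgI (srg_act phi 1%g)); rewrite -srg_actM !mulg1. Qed.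

Lemma srg_act_gen phi i : srg_act phi (srg_gen i) = srg_gen (phi i).
Proof. by rewrite srg_actE /z2sigma z2lift_gen. Qed.

Lemma srg_word h : exists w : seq 'I_n, h = (\prod_(i <- w) srg_gen i)%g.
Proof.
have [_ qs _] := qP; have [x <-] := qs h; exists (z2word x).
have -> : x = foldr (fun i y => z2gen i * y)%g 1%g (z2word x).
  apply: val_inj; rewrite /= -[LHS](z2reduce_id (z2wordP x)).
  by elim: (z2word x) => //= i w ->.
rewrite [in RHS](_ : z2word _ = z2word x); last first.
  rewrite -[RHS](z2reduce_id (z2wordP x)).
  by elim: (z2word x) => //= i w ->.
elim: (z2word x) => [|i w IH] /=; first by rewrite big_nil srg_q1.
by rewrite qM IH big_cons.
Qed.

Lemma srg_tprod_map (phi : 'I_n -> 'I_n) k l (i : k.-tuple 'I_n) (j : l.-tuple 'I_n) :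
  tprod srg_gen i = tprod srg_gen j ->
  tprod srg_gen (map_tuple phi i) = tprod srg_gen (map_tuple phi j).
Proof.
have H m (t : m.-tuple 'I_n) :
    tprod srg_gen (map_tuple phi t) = srg_act phi (tprod srg_gen t).
  rewrite /tprod /lprod (big_morph _ (srg_actM phi) (srg_act1 phi)).
  by apply: eq_bigr => r _; rewrite tnth_map srg_act_gen.
by rewrite !H => ->.
Qed.

End ReflectionGroup.

Section GroupUnitaries.
Context {R : realType} {Gamma : groupType} {B : cstarAlgType R} (v : Gamma -> B).
Hypothesis vmax : max_group_cstar v.
Hypothesis vinj : injective v.

(* The trivial representation forces c = d when c v(x) = d v(y). *)
Lemma unitaries_independent (c d : R[i]) x y : c *: v x = d *: v y -> x != y -> c = 0 /\ d = 0.
Proof.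
move=> e xy; have [[v1 vM vU] _ vuniv] := vmax.
have [|F [_ Fv]] := vuniv B (fun=> 1); first by split=> *; rewrite ?star1 ?mulr1.
have cd : c = d.
  have /eqP := congr1 F e; rewrite !(linearZ_LR F)/= !Fv -subr_eq0 -scalerBl scaler_eq0.
  by rewrite oner_eq0 orbF subr_eq0 => /eqP.
suff c0 : c = 0 by rewrite -cd c0.
apply/eqP/negPn/negP => c0; case/eqP: xy; apply: vinj; apply: (scalerI c0).
by rewrite e cd.
Qed.

Lemma unitary_neq0 x : v x != 0.
Proof.
have [[_ _ vU] _ _] := vmax; apply/eqP => e; have [] := vU x.
by rewrite e mulr0 => /eqP; rewrite eq_sym oner_eq0.
Qed.

End GroupUnitaries.

Section Realization.
Context {R : realType} {n : nat} {Gamma : groupType} (q : z2free n -> Gamma).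
Hypothesis qP : strongly_symmetric_reflection_group q.
Context {B : cstarAlgType R} (v : Gamma -> B).
Hypothesis vmax : max_group_cstar v.
Hypothesis vinj : injective v.
Context {W : cstarAlgType R} (j1 : {lrmorphism B -> W}) (j2 : {lrmorphism csym R n -> W}).
Context (e : 'S_n -> {lrmorphism W -> B}).
Hypothesis tW : is_tensor j1 j2.
Hypothesis eS : forall r, star_hom (e r).
Hypothesis e_sep : forall x y, (forall r, e r x = e r y) -> x = y.
Hypothesis e1 : forall r b, e r (j1 b) = b.
Hypothesis e2 : forall r (f : csym R n), e r (j2 f) = (f r)%:A.

Local Notation g := (srg_gen q).
Local Notation Q := (tdelta j2).

Definition bowtie_mx : 'M[W]_n :=
  \matrix_(i, j) (j1 (v (q (z2gen i))) * j2 (perm_coord R i j)).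
Local Notation U := bowtie_mx.

Let vU : unitary_rep v. Proof. by have [] := vmax. Qed.
Let v1 : v 1%g = 1. Proof. by have [] := vU. Qed.
Let vM x y : v (x * y)%g = v x * v y. Proof. by have [_] := vU. Qed.
Let QC := tdeltaC e_sep e2.
Let QM := tdelta_mul e_sep e2.
Let QS := tdelta_star eS e_sep e2.
Let Q1 := @tdelta_sum R n W j2.
Let eQ := e_tdelta e2.

Lemma unitary_gen_sq i : v (g i) * v (g i) = 1.
Proof. by rewrite -vM srg_gen_sq. Qed.

Lemma unitary_gen_star i : star (v (g i)) = v (g i).
Proof.
rewrite -(unitary_repV _ vU); congr v; apply: (mulIg (g i)).
by rewrite mulVg srg_gen_sq.
Qed.

Lemma e_bowtie r i j : e r (U i j) = (r j == i)%:R *: v (g i).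
Proof. by rewrite mxE (rmorphM (e r))/= e1 e2 ffunE -scalerAr mulr1. Qed.

Lemma bowtie_star i j : star (U i j) = U i j.
Proof.
apply: e_sep => r; rewrite eS e_bowtie starZ unitary_gen_star.
by case: (_ == _); rewrite ?conjC_nat.
Qed.

Lemma bowtie_row i j : \sum_k U i k * U j k = (i == j)%:R.
Proof.
apply: e_sep => r; rewrite (linear_sum (e r))/= (bigD1 (r^-1%g i))//= big1 ?addr0 => [|k kr].
  rewrite (rmorphM (e r))/= !e_bowtie permKV eqxx scale1r.
  have [<-|_] := eqVneq i j; first by rewrite scale1r unitary_gen_sq rmorph1.
  by rewrite scale0r mulr0 (linear0 (e r)).
rewrite (rmorphM (e r))/= !e_bowtie; have [ki|_] := eqVneq (r k) i.
  by rewrite -ki permK eqxx in kr.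
by rewrite scale0r mul0r.
Qed.

Lemma bowtie_col i j : \sum_k U k i * U k j = (i == j)%:R.
Proof.
apply: e_sep => r; rewrite (linear_sum (e r))/= (bigD1 (r i))//= big1 ?addr0 => [|k kr].
  rewrite (rmorphM (e r))/= !e_bowtie eqxx scale1r (inj_eq perm_inj) [j == i]eq_sym.
  have [ij|_] := eqVneq i j; first by rewrite scale1r unitary_gen_sq rmorph1.
  by rewrite scale0r mulr0 (linear0 (e r)).
by rewrite (rmorphM (e r))/= !e_bowtie [r i == k]eq_sym (negPf kr) scale0r mul0r.
Qed.

Lemma bowtie_tdelta i j t : U i j * Q t = (t j == i)%:R *: (j1 (v (g i)) * Q t).
Proof. by rewrite (tdelta_e e_sep e1 e2) e_bowtie (linearZ_LR j1)/= -scalerAl. Qed.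

Lemma bowtie_rowsum i : \sum_j U i j = j1 (v (g i)).
Proof.
apply: e_sep => r; rewrite (linear_sum (e r))/= (bigD1 (r^-1%g i))//= big1 ?addr0 => [|k kr].
  by rewrite e_bowtie permKV eqxx scale1r e1.
rewrite e_bowtie; have [ki|_] := eqVneq (r k) i; last by rewrite scale0r.
by rewrite -ki permK eqxx in kr.
Qed.

(** The squares of the entries have coordinates 0 and 1, and their product singles out one
    permutation. This puts [Q t] into the *-algebra of the entries, as [bowtie_rowsum] does for the
    unitaries of the generators. *)
Lemma bowtie_prod_sq t : Q t = \prod_j (U (t j) j * U (t j) j).
Proof.
apply: e_sep => r; rewrite eQ (rmorph_prod (e r))/=.
have H (l : seq 'I_n) : \prod_(j <- l) e r (U (t j) j * U (t j) j) =
    (all (fun j => r j == t j) l)%:R.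
  elim: l => [|j l IH]; first by rewrite big_nil.
  rewrite big_cons IH (rmorphM (e r))/= e_bowtie; case: (r j == t j).
    by rewrite scale1r unitary_gen_sq mul1r.
  by rewrite scale0r !mul0r.
rewrite H; congr (_%:R); congr nat_of_bool; apply/eqP/allP => [-> //|a].
by apply/permP => j; apply/eqP/a; rewrite mem_index_enum.
Qed.

Local Notation S := (star_alg_gen (entries U)).

Lemma bowtie_gen_subalg : star_subalg S. Proof. by have [] := star_alg_genP (entries U). Qed.

Lemma bowtie_gen_entry i j : S (U i j).
Proof. by have [_ GE] := star_alg_genP (entries U); apply: GE; exists i, j. Qed.

Lemma star_subalg0 (A : cstarAlgType R) (G : set A) : star_subalg G -> G 0.
Proof. by move=> [G1 Gl _ _]; have := Gl (-1) 1 1 G1 G1; rewrite scaleN1r addNr. Qed.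

Lemma star_subalg_sum (A : cstarAlgType R) (G : set A) (I : Type) (r : seq I) (F : I -> A) :
  star_subalg G -> (forall i, G (F i)) -> G (\sum_(i <- r) F i).
Proof.
move=> Gs GF; have G0 := star_subalg0 Gs; have [_ Gl _ _] := Gs.
apply: big_ind => // x y Gx Gy; rewrite -[x]scale1r; exact: Gl.
Qed.

Lemma star_subalg_prod (A : cstarAlgType R) (G : set A) (I : Type) (r : seq I) (F : I -> A) :
  star_subalg G -> (forall i, G (F i)) -> G (\prod_(i <- r) F i).
Proof. by move=> [G1 _ GM _] GF; apply: big_ind. Qed.

Lemma bowtie_gen_tdelta t : S (Q t).
Proof.
rewrite bowtie_prod_sq; apply: (star_subalg_prod (G := S)) => [|j]; first exact: bowtie_gen_subalg.
by have [_ _ SM _] := bowtie_gen_subalg; apply: SM; apply: bowtie_gen_entry.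
Qed.

Lemma bowtie_gen_unitary h : S (j1 (v h)).
Proof.
have [w ->] := srg_word qP h; have [S1 _ SM _] := bowtie_gen_subalg.
elim: w => [|i w IH]; first by rewrite big_nil v1 (rmorph1 j1).
rewrite big_cons vM (rmorphM j1)/=; apply: SM => //.
rewrite -bowtie_rowsum; apply: (star_subalg_sum (G := S)) => [|j]; first exact: bowtie_gen_subalg.
exact: bowtie_gen_entry.
Qed.

Lemma bowtie_generates : cstar_generates (entries U).
Proof.
move=> x eps eps0; have [_ vgen _] := vmax; have [[S1 Sl SM SS] jS] := (bowtie_gen_subalg, tW).
have [[j1S _] _ _ _] := tW.
have /choice[u uP] : forall r, exists u : nat -> B,
    (forall m, star_alg_gen (range v) (u m)) /\ cvgC u (e r x).
  by move=> r; have [u uS ux] := cstar_dense_cvg vgen (e r x); exists u.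
have uS r m : S (j1 (u r m)).
  apply: ((uP r).1 m [set b | S (j1 b)]); split; last by move=> _ [h _ <-]; apply: bowtie_gen_unitary.
  split=> [|c a b aS bS|a b aS bS|a aS] /=.
  - by rewrite (rmorph1 j1).
  - by rewrite (linearP j1)/=; apply: Sl.
  - by rewrite (rmorphM j1)/=; apply: SM.
  - by rewrite j1S; apply: SS.
have cv : cvgC (fun m => \sum_r j1 (u r m) * Q r) (\sum_r j1 (e r x) * Q r).
  by apply: cvgC_sum => r; apply: cvgCMr; apply: star_hom_cvg => //; apply: (uP r).2.
rewrite -(tdelta_decomp e_sep e1 e2 x) in cv.
have [m mx] := cv eps eps0; exists (\sum_r j1 (u r m) * Q r).
  apply: (star_subalg_sum (G := S)) => [|r]; first exact: bowtie_gen_subalg.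
  by apply: SM => //; apply: bowtie_gen_tdelta.
by rewrite cnormB; apply: mx.
Qed.

Lemma e_tpow r k (i j : k.-tuple 'I_n) :
  e r (tpow U i j) = (map_tuple r j == i)%:R *: v (tprod g i).
Proof.
elim: k i j => [|k IH] i j.
  rewrite !tuple0 tpow_nil /tprod /lprod big_ord0 v1 rmorph1 (_ : _ == _) ?scale1r//.
  exact/eqP/tuple0.
case/tupleP: i => a i; case/tupleP: j => b j.
rewrite tpow_cons (rmorphM (e r))/= IH e_bowtie.
have -> : (map_tuple r [tuple of b :: j] == [tuple of a :: i]) =
          (r b == a) && (map_tuple r j == i).
  by rewrite -[LHS]val_eqE /= eqseq_cons.
have -> : tprod g [tuple of a :: i] = (g a * tprod g i)%g.
  rewrite /tprod /lprod big_ord_recl tnth0; congr (_ * _)%g.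
  by apply: eq_bigr => m _; rewrite tnthS.
by rewrite vM -scalerAl -scalerAr scalerA -natrM mulnb.
Qed.

(** At a permutation r the tensor powers of U are monomial, so [e r] leaves one term on each side of
    the intertwining relation, taken in the row [map_tuple r j]. *)
Lemma bowtie_intertwiner k l (M : 'M[R[i]]_(tdim n l, tdim n k)) :
  intertwiner U M <-> forall (r : 'S_n) j i,
    M (enum_rank (map_tuple r j)) (enum_rank (map_tuple r i)) *: v (tprod g (map_tuple r i)) =
    M (enum_rank j) (enum_rank i) *: v (tprod g (map_tuple r j)).
Proof.
have lhs (r : 'S_n) j i : e r (\sum_i' M (enum_rank j) (enum_rank i') *: tpow U i' i) =
    M (enum_rank j) (enum_rank (map_tuple r i)) *: v (tprod g (map_tuple r i)).
  rewrite (linear_sum (e r))/= (bigD1 (map_tuple r i))//= big1 ?addr0 => [|i' ii'].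
    by rewrite (linearZ_LR (e r))/= e_tpow eqxx scale1r.
  by rewrite (linearZ_LR (e r))/= e_tpow eq_sym (negPf ii') scale0r scaler0.
have rhs (r : 'S_n) j i :
    e r (\sum_j' M (enum_rank j') (enum_rank i) *: tpow U (map_tuple r j) j') =
    M (enum_rank j) (enum_rank i) *: v (tprod g (map_tuple r j)).
  have K (x y : l.-tuple 'I_n) : (map_tuple r x == map_tuple r y) = (x == y).
    by rewrite -!val_eqE /=; apply: inj_eq; apply: inj_map; apply: perm_inj.
  rewrite (linear_sum (e r))/= (bigD1 j)//= big1 ?addr0 => [|j' jj'].
    by rewrite (linearZ_LR (e r))/= e_tpow eqxx scale1r.
  by rewrite (linearZ_LR (e r))/= e_tpow K (negPf jj') scale0r scaler0.
split=> [/intertwinerP H r j i|H]; first by rewrite -lhs -rhs H.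
apply/intertwinerP => j i; apply: e_sep => r.
have -> : j = map_tuple r (map_tuple (r^-1)%g j).
  by apply: eq_from_tnth => m; rewrite !tnth_map permKV.
by rewrite lhs rhs H.
Qed.

(** Where the two words differ in Gamma, independence of the unitaries kills both coefficients;
    where they agree, the relation says that M is invariant under S_n. [invariant_span] then
    applies. *)
Lemma bowtie_hom k l (M : 'M[R[i]]_(tdim n l, tdim n k)) :
  intertwiner U M <-> M \in <<[seq Tpart n p | p <- enum (group_parts g k l)]>>%VS.
Proof.
have tm := srg_tprod_map qP; have ind := unitaries_independent vmax vinj.
apply: iff_trans (bowtie_intertwiner M) _; split=> [H|].
  have supp j i : M (enum_rank j) (enum_rank i) != 0 -> tprod g i = tprod g j.
    have [//|ij] := eqVneq (tprod g i) (tprod g j); have := H 1%g j i.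
    have K m (t : m.-tuple 'I_n) : map_tuple (1%g : 'S_n) t = t.
      by apply: eq_from_tnth => b; rewrite tnth_map perm1.
    by rewrite !K => /ind/(_ ij)[->]; rewrite eqxx.
  apply: invariant_span => // r j i.
  have [ij|ij] := eqVneq (tprod g i) (tprod g j).
    have := H r j i; rewrite (tm r _ _ _ _ ij) => /eqP; rewrite -subr_eq0 -scalerBl.
    by rewrite scaler_eq0 (negPf (unitary_neq0 vmax _)) orbF subr_eq0 => /eqP.
  have rij : tprod g (map_tuple r i) != tprod g (map_tuple r j).
    apply: contraNneq ij => /(tm (r^-1)%g).
    have K m (t : m.-tuple 'I_n) : map_tuple (r^-1)%g (map_tuple r t) = t.
      by apply: eq_from_tnth => b; rewrite !tnth_map permK.
    by rewrite !K => ->.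
  by have [-> ->] := ind _ _ _ _ (H r j i) rij.
apply: (span_ind (Q := fun M : 'M_(tdim n l, tdim n k) => forall (r : 'S_n) j i,
    M (enum_rank (map_tuple r j)) (enum_rank (map_tuple r i)) *: v (tprod g (map_tuple r i)) =
    M (enum_rank j) (enum_rank i) *: v (tprod g (map_tuple r j)))) => [r j i|c x y xP yP r j i|].
- by rewrite !mxE !scale0r.
- by rewrite !mxE !scalerDl -!scalerA xP yP.
- move=> M' /mapP[p]; rewrite mem_enum => pC -> r j i; rewrite !TpartE delta_part_perm.
  case E: (delta_part p i j); last by rewrite !scale0r.
  by rewrite (tm r _ _ _ _ (delta_part_tprod pC E)).
Qed.

Lemma bowtie_orthogonal_relations :
  (U *m adjmx U = 1%:M /\ adjmx U *m U = 1%:M) /\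
  exists V : 'M[W]_n, U^T *m V = 1%:M /\ V *m U^T = 1%:M.
Proof.
have UE : adjmx U = U^T by apply/matrixP => i j; rewrite !mxE -[RHS]/(_ * _); have := bowtie_star j i; rewrite !mxE.
have r : U *m U^T = 1%:M.
  by apply/matrixP => i j; rewrite mxE [RHS]mxE -bowtie_row; apply: eq_bigr => k _; rewrite [U^T _ _]mxE.
have c : U^T *m U = 1%:M.
  by apply/matrixP => i j; rewrite mxE [RHS]mxE -bowtie_col; apply: eq_bigr => k _; rewrite [U^T _ _]mxE.
by rewrite UE; split; [|exists U].
Qed.

(** On the *-algebra of the entries f already yields a unitary representation of Gamma and the
    projections [f (Q r)]; the universal property of C*(Gamma) and [perm_tensor_lift] continue them
    to W. *)
Lemma bowtie_maximal : maximal_version U.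
Proof.
move=> D f [f1 fl fM fS].
have [[S1 Sl SM SS] SE] := star_alg_genP (entries U).
have S0 := star_subalg0 bowtie_gen_subalg.
have f0 : f 0 = 0 by have := fl (-1) 1 1 S1 S1; rewrite !scaleN1r !addNr.
have fZ c x : S x -> f (c *: x) = c *: f x.
  by move=> Sx; have := fl c x 0 Sx S0; rewrite !addr0 f0 addr0.
have fsum (I : Type) (r : seq I) (F : I -> W) : (forall i, S (F i)) ->
    f (\sum_(i <- r) F i) = \sum_(i <- r) f (F i).
  move=> SF; elim: r => [|i r IH]; first by rewrite !big_nil.
  rewrite !big_cons -IH -[F i]scale1r fl ?scale1r//.
  exact: (star_subalg_sum (G := S)) bowtie_gen_subalg SF.
have Sv := bowtie_gen_unitary; have SQ := bowtie_gen_tdelta.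
have [_ vgen vuniv] := vmax; have [[j1S _] _ _ _] := tW.
have fvU : unitary_rep (fun h => f (j1 (v h))).
  have [_ _ vUU] := vU; split=> [|h k|h]; first by rewrite v1 (rmorph1 j1).
    by rewrite vM (rmorphM j1)/= fM.
  have Ss := SS _ (Sv h); rewrite -fS// -!fM// -j1S -!(rmorphM j1)/=.
  by have [-> ->] := vUU h; rewrite (rmorph1 j1).
have [F [FS Fv]] := vuniv _ _ fvU.
have [||||E [ES EE EQ]] := @perm_tensor_lift _ _ _ _ _ _ eS e2 D F (fun r => f (Q r)) FS.
- by move=> r t; rewrite -fM// QM fZ.
- by move=> r; rewrite -fS// QS.
- by rewrite -fsum// Q1.
- move=> r b; apply: (star_hom_commute FS vgen) => [|_ [h _ <-]]; first by rewrite -fS// QS.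
  by rewrite Fv -!fM// QC.
exists E; split=> // x Sx; apply: (Sx [set x | S x /\ E x = f x] _).2.
split; last first.
  move=> _ [i [j ->]]; split; first exact: bowtie_gen_entry.
  rewrite EE -[U i j in RHS]mulr1 -Q1 mulr_sumr fsum => [|r]; last first.
    by apply: SM => //; apply: bowtie_gen_entry.
  apply: eq_bigr => r _; rewrite e_bowtie bowtie_tdelta (linearZ_LR F)/= Fv fZ ?fM -?scalerAl//.
  by apply: SM.
split=> [|c x' y [Sx' ex] [Sy ey]|x' y [Sx' ex] [Sy ey]|x' [Sx' ex]].
- by split=> //; rewrite f1; apply: rmorph1.
- by split; [exact: Sl|rewrite (linearP E)/= fl// ex ey].
- by split; [exact: SM|rewrite (rmorphM E)/= fM// ex ey].
- by split; [exact: SS|rewrite ES fS// ex].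
Qed.

(** * The comultiplication of the constructed quantum group *)

Section Comultiplication2.
Context {T : cstarAlgType R} (I1 I2 : {lrmorphism W -> T}).
Hypothesis tens : is_tensor I1 I2.

Local Notation act := (srg_act q).

Definition ttdelta t r := I1 (Q t) * I2 (Q r).
Local Notation X := ttdelta.

Let IC a b : I1 a * I2 b = I2 b * I1 a. Proof. by have [_ ->] := tens. Qed.
Let I1S : star_hom I1. Proof. by have [[? ?] _ _ _] := tens. Qed.
Let I2S : star_hom I2. Proof. by have [[? ?] _ _ _] := tens. Qed.
Let TM := tensorM tens.

Lemma ttdeltaC t r a b : X t r * (I1 a * I2 b) = I1 a * I2 b * X t r.
Proof. by rewrite !TM !QC. Qed.

Lemma ttdelta_ext a b : (forall t r, a * X t r = b * X t r) -> a = b.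
Proof.
have X1 : \sum_t \sum_r X t r = 1.
  under eq_bigr do rewrite -mulr_sumr -(linear_sum I2) Q1 rmorph1 mulr1.
  by rewrite -(linear_sum I1) Q1 rmorph1.
move=> ab; rewrite -[a]mulr1 -[b]mulr1 -X1 !mulr_sumr; apply: eq_bigr => t _.
by rewrite !mulr_sumr; apply: eq_bigr => r _.
Qed.

Lemma ttdelta_mul t r t' r' : X t r * X t' r' = ((t == t') && (r == r'))%:R *: X t r.
Proof.
by rewrite TM !QM (linearZ_LR I1) (linearZ_LR I2)/= -scalerAl -scalerAr scalerA -natrM mulnb.
Qed.

(** The image of the indicator of s, dual to multiplication in S_n: the sum of delta_t (x) delta_r
    over r t = s. *)
Definition coproj (s : 'S_n) : T := \sum_t X t (s * t^-1)%g.

Lemma coproj_ttdelta s t r : coproj s * X t r = (s == r * t)%g%:R *: X t r.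
Proof.
rewrite mulr_suml (bigD1 t)//= big1 ?addr0 => [|k kt].
  rewrite ttdelta_mul eqxx /= -(inj_eq (mulIg t)) mulgKV.
  by have [->|_] := eqVneq s (r * t)%g; rewrite ?mulgK// !scale0r.
by rewrite ttdelta_mul (negPf kt) scale0r.
Qed.

Lemma coproj_comm s t r a b :
  coproj s * (I1 a * I2 b * X t r) = (s == r * t)%g%:R *: (I1 a * I2 b * X t r).
Proof. by rewrite -ttdeltaC mulrA coproj_ttdelta -scalerAl. Qed.

(* Forced by Delta (u_ij) = sum_k u_ik (x) u_kj: the image of u_h is
   sum_t u_h delta_t (x) u_(t^-1 h). *)
Definition cogroup (h : Gamma) : T :=
  \sum_t I1 (j1 (v h) * Q t) * I2 (j1 (v (act (t^-1)%g h))).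

Definition cofactor_elt (t : 'S_n) h := I1 (j1 (v h)) * I2 (j1 (v (act (t^-1)%g h))).

Lemma cogroup_ttdelta h t r : cogroup h * X t r = cofactor_elt t h * X t r.
Proof.
rewrite mulr_suml (bigD1 t)//= big1 ?addr0 => [|k kt].
  by rewrite !TM -mulrA QM eqxx scale1r.
by rewrite TM -mulrA QM (negPf kt) scale0r mulr0 (linear0 I1) mul0r.
Qed.

Lemma ttdelta_cogroup h t r : X t r * cogroup h = cogroup h * X t r.
Proof. by rewrite mulr_sumr mulr_suml; apply: eq_bigr => k _; rewrite ttdeltaC. Qed.

Lemma cofactor_eltM t h k : cofactor_elt t h * cofactor_elt t k = cofactor_elt t (h * k)%g.
Proof. by rewrite /cofactor_elt (srg_actM qP) !vM !(rmorphM j1) TM. Qed.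

Lemma cofactor_elt1 t : cofactor_elt t 1%g = 1.
Proof. by rewrite /cofactor_elt (srg_act1 qP) v1 (rmorph1 j1) (rmorph1 I1) (rmorph1 I2) mulr1. Qed.

Lemma cofactor_elt_star t h : star (cofactor_elt t h) = cofactor_elt t h^-1%g.
Proof.
have [[j1S _] _ _ _] := tW.
have actV : act (t^-1)%g h^-1%g = ((act (t^-1)%g h)^-1)%g.
  by apply: (mulgI (act (t^-1)%g h)); rewrite -(srg_actM qP) !mulgV (srg_act1 qP).
rewrite /cofactor_elt starM -I1S -I2S -!j1S -IC actV.
by rewrite !(unitary_repV _ vU).
Qed.

Lemma cogroup_unitary : unitary_rep cogroup.
Proof.
have c1 : cogroup 1%g = 1.
  by apply: ttdelta_ext => t r; rewrite cogroup_ttdelta cofactor_elt1.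
have cM h k : cogroup (h * k)%g = cogroup h * cogroup k.
  apply: ttdelta_ext => t r; rewrite cogroup_ttdelta -(mulrA (cogroup h)) cogroup_ttdelta.
  rewrite -[cofactor_elt t k * _]ttdeltaC (mulrA (cogroup h)) cogroup_ttdelta.
  rewrite -(mulrA (cofactor_elt t h)) ttdeltaC (mulrA (cofactor_elt t h)).
  by rewrite cofactor_eltM.
have cV h : star (cogroup h) = cogroup h^-1%g.
  apply: ttdelta_ext => t r; rewrite cogroup_ttdelta -cofactor_elt_star.
  have XS : star (X t r) = X t r by rewrite starM -I1S -I2S !QS -IC.
  rewrite -{1 2}XS -!starM ttdelta_cogroup cogroup_ttdelta.
  by rewrite ttdeltaC.
by split=> // h; rewrite cV -!cM mulVg mulgV c1.
Qed.

(** The [cogroup h] commute with the [coproj s], so [perm_tensor_lift] glues them. The formula on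
    the entries is checked on each block [X t r], where only k = r j contributes. *)
Lemma bowtie_comult : exists Delta : {lrmorphism W -> T},
  star_hom Delta /\ forall i j, Delta (U i j) = \sum_k I1 (U i k) * I2 (U k j).
Proof.
have [_ vgen vuniv] := vmax; have [F [FS Fv]] := vuniv _ _ cogroup_unitary.
have coS r : star (coproj r) = coproj r.
  rewrite star_sum; apply: eq_bigr => t _.
  by rewrite starM -I1S -I2S !QS -IC.
have [||||Delta [DS DE _]] := @perm_tensor_lift _ _ _ _ _ _ eS e2 T F coproj FS.
- move=> r t; apply: ttdelta_ext => a b.
  rewrite -mulrA coproj_ttdelta -scalerAr coproj_ttdelta -scalerAl coproj_ttdelta.
  have [<-|rt] := eqVneq r t; first by case: (_ == _); rewrite ?scale1r ?scale0r.
  rewrite scale0r; case: eqVneq => [tE|_]; last by rewrite scale0r.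
  by rewrite -tE (negPf rt) scale0r scaler0.
- exact: coS.
- apply: ttdelta_ext => t r; rewrite mulr_suml (bigD1 (r * t)%g)//= big1 ?addr0 => [|k kr].
    by rewrite coproj_ttdelta eqxx scale1r mul1r.
  by rewrite coproj_ttdelta (negPf kr) scale0r.
- move=> r b; apply: (star_hom_commute FS vgen) => // _ [h _ <-].
  rewrite Fv; apply: ttdelta_ext => t k; rewrite -!mulrA coproj_ttdelta cogroup_ttdelta.
  by rewrite -scalerAr cogroup_ttdelta coproj_comm.
exists Delta; split=> // i j; rewrite DE; apply: ttdelta_ext => t r.
rewrite !mulr_suml (bigD1 (r * t)%g)//= big1 ?addr0 => [|k kr]; last first.
  by rewrite -mulrA coproj_ttdelta (negPf kr) scale0r mulr0.
rewrite -mulrA coproj_ttdelta eqxx scale1r e_bowtie permM (linearZ_LR F)/= Fv.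
rewrite -scalerAl cogroup_ttdelta (bigD1 (r j))//= big1 ?addr0 => [|k kr]; last first.
  by rewrite TM !bowtie_tdelta [r j == k]eq_sym (negPf kr) scale0r (linear0 I2) mulr0.
rewrite [in RHS]TM !bowtie_tdelta eqxx scale1r (linearZ_LR I1)/= -scalerAl.
have [<-|_] := eqVneq (t (r j)) i; last by rewrite !scale0r.
by rewrite !scale1r /cofactor_elt TM (srg_act_gen qP) permK.
Qed.

End Comultiplication2.

End Realization.

Theorem reflection_group_easy (R : realType) (n : nat) (i0 : 'I_n) (Gamma : groupType)
    (q : z2free n -> Gamma) : strongly_symmetric_reflection_group q ->
  exists (A : cstarAlgType R) (u : 'M[A]_n) (C : forall k l, {set part k l}),
    [/\ easy_quantum_group u C, maximal_version u, pi0 \in C 3%N 3%N & iso_bowtie u q].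
Proof.
move=> qP; have [B [v [vmax vinj]]] := @group_cstar R Gamma.
have [W [j1 [j2 [e [tW eS esep _ [e1 e2]]]]]] := @perm_tensor R n B.
have [T [I1 [I2 tens]]] := @spatial_tensor R W W.
have gg := srg_gen_sq qP.
exists W, (bowtie_mx q v j1 j2), (group_parts (srg_gen q)); split.
- split; [split| |].
  + have [uu inv] := bowtie_orthogonal_relations qP vmax eS esep e1 e2.
    have [Delta [DS DE]] := bowtie_comult qP vmax tW eS esep e1 e2 tens.
    split=> //; first exact: (bowtie_generates qP vmax tW esep e1 e2).
    by exists T, I1, I2, Delta.
  + exact: (bowtie_star qP vmax eS esep e1 e2).
  + exact: group_parts_category.
  + exact: (bowtie_hom qP vmax vinj esep e1 e2).
- exact: (bowtie_maximal qP vmax tW eS esep e1 e2).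
- exact: group_parts_pi0.
- exists B, v, W, j1, j2; split=> //; exists idfun; split=> //.
Qed.

Local Close Scope ring_scope.
Local Close Scope classical_set_scope.

Theorem theorem2 (R : realType) (n : nat) (n_ge1 : (1 <= n)%N) :
  (forall (A : cstarAlgType R) (u : 'M[A]_n)
          (C : forall k l, {set part k l}),
     easy_quantum_group u C -> maximal_version u -> pi0 \in C 3 3 ->
     exists (Gamma : groupType) (q : z2free n -> Gamma),
       strongly_symmetric_reflection_group q /\ iso_bowtie u q)
  /\
  (forall (Gamma : groupType) (q : z2free n -> Gamma),
     strongly_symmetric_reflection_group q ->
     exists (A : cstarAlgType R) (u : 'M[A]_n)
            (C : forall k l, {set part k l}),
       [/\ easy_quantum_group u C, maximal_version u, pi0 \in C 3 3 &
           iso_bowtie u q]).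
Proof.
split=> [A u C uC um pC|Gamma q qP]; first exact: easy_bowtie uC um pC.
exact: reflection_group_easy (Ordinal n_ge1) _ _ qP.
Qed.
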